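(* Let $d\ge 6$ and let $(S_k)_{k\ge0}$ be a simple random walk on $\mathbb{Z}^d$ with $S_0=0$, with range $\mathcal{R}_n=\{S_0,\dots,S_n\}$. There is a constant $\sigma_d>0$ such that \[ \frac{\mathrm{Cap}(\mathcal{R}_n)-\mathbb{E}[\mathrm{Cap}(\mathcal{R}_n)]}{\sqrt n}\Longrightarrow \sigma_d\,\mathcal{N}(0,1)\qquad\text{as } n\to\infty, \] where $\Longrightarrow$ denotes convergence in distribution and $\mathcal{N}(0,1)$ is a standard normal random variable.
   Context: For a finite set $A\subseteq\mathbb{Z}^d$ ($d\ge3$), its capacity is $\mathrm{Cap}(A)=\sum_{x\in A}\mathbb{P}_x(T_A^+=\infty)$, where $T_A^+=\inf\{t\ge1: S_t\in A\}$ is the first return time to $A$ of a simple random walk $S$ and $\mathbb{P}_x$ is the law of the walk started at $x$. *)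

(* Defs.v *)
From Stdlib Require Import Reals Lra Lia ZArith Arith List ClassicalEpsilon.
Import ListNotations.
Open Scope R_scope.

(** Points of Z^d are lists of integers of length d. *)
Definition point := list Z.
Definition point_eq_dec := list_eq_dec Z.eq_dec.

Definition origin (d : nat) : point := repeat 0%Z d.

Definition vadd (u v : point) : point :=
  map (fun p => (fst p + snd p)%Z) (combine u v).

(** The 2d steps of the simple random walk: step i is +e_(i/2) if i is even,
    -e_(i/2) if i is odd, for i < 2d. *)
Definition step (d i : nat) : point :=
  map (fun j => if Nat.eqb j (i / 2) then (if Nat.even i then 1%Z else (-1)%Z) else 0%Z)
      (seq 0 d).

Fixpoint words (k n : nat) : list (list nat) :=
  match n with
  | O => [[]]
  | S n' => flat_map (fun w => map (fun i => i :: w) (seq 0 k)) (words k n')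
  end.

Fixpoint path (d : nat) (x : point) (w : list nat) : list point :=
  x :: match w with
       | [] => []
       | i :: w' => path d (vadd x (step d i)) w'
       end.

Definition memb (y : point) (A : list point) : bool :=
  if in_dec point_eq_dec y A then true else false.

Definition prob (d m : nat) (P : list nat -> bool) : R :=
  INR (length (filter P (words (2 * d) m))) / INR ((2 * d) ^ m).

Definition no_return_by (d : nat) (A : list point) (x : point) (m : nat) : R :=
  prob d m (fun w => forallb (fun y => negb (memb y A)) (tl (path d x w))).

(** Escape probability P_x(T_A^+ = oo) = lim_m P_x(T_A^+ > m). *)
Definition escape (d : nat) (A : list point) (x : point) : R :=
  epsilon (inhabits 0) (fun l => Un_cv (no_return_by d A x) l).

Definition Cap (d : nat) (A : list point) : R :=
  fold_right Rplus 0 (map (escape d A) (nodup point_eq_dec A)).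

Definition cap_range (d : nat) (w : list nat) : R :=
  Cap d (path d (origin d) w).

Definition mean_cap_range (d n : nat) : R :=
  fold_right Rplus 0 (map (cap_range d) (words (2 * d) n)) / INR ((2 * d) ^ n).

Definition cdf_normalized (d n : nat) (t : R) : R :=
  prob d n (fun w =>
    if Rle_dec ((cap_range d w - mean_cap_range d n) / sqrt (INR n)) t
    then true else false).

Definition gauss_density (u : R) : R := exp (- (u * u) / 2).

Lemma gauss_density_integrable (a b : R) :
  a <= b -> Riemann_integrable gauss_density a b.
Proof.
  intros Hab. apply continuity_implies_RiemannInt; [exact Hab|].
  intros x _. unfold gauss_density.
  apply continuity_pt_comp with (f1 := fun u => - (u * u) / 2) (f2 := exp).
  - unfold Rdiv. apply continuity_pt_mult.
    + apply continuity_pt_opp. apply continuity_pt_mult; apply derivable_continuous_pt;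
      apply derivable_pt_id.
    + apply continuity_pt_const. intros ? ?; reflexivity.
  - apply derivable_continuous_pt. apply derivable_pt_exp.
Qed.

Definition gauss_int0 (x : R) : R :=
  match Rle_dec 0 x with
  | left h => RiemannInt (gauss_density_integrable 0 x h)
  | right h => - RiemannInt (gauss_density_integrable x 0
                               (Rlt_le _ _ (Rnot_le_lt _ _ h)))
  end.

Definition Phi (x : R) : R := / 2 + gauss_int0 x / sqrt (2 * PI).

(* Main.v *)
(** Split a path of length n in two at any time: the capacity is translation invariant,
    and Cap(A) + Cap(B) - Cap(A u B) lies between 0 and twice the sum of the Green function over
    A x B. In dimension at least 6 the heat kernel is O(n^-3), so this defect has an L^2 norm of
    polylogarithmic size; the cruder bound O(n^(1/4)) suffices. Hence the standard deviation s_n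
    of the capacity satisfies s_(k+l) = sqrt(s_k^2 + s_l^2) + O((k+l)^(1/4)), which forces
    s_n / sqrt n to converge. The limit is positive because swapping a back-and-forth
    piece of path for a long straight excursion raises the mean capacity: this gives linearly many
    nearly orthogonal test functions correlated with the capacity. Halving the path repeatedly,
    down to pieces of bounded length b, the centred capacity is within O(b^(-1/4) sqrt n) in L^2 of
    a sum of independent bounded centred variables, for which Stein's method applies; then b goes
    to infinity. *)

Require Import Defs.
From Stdlib Require Import Reals Lra Lia ZArith Arith List Permutation Bool Classical ClassicalEpsilon.
From Coquelicot Require Import Coquelicot.
Import ListNotations.
Open Scope R_scope.

(** * Averages over words *)

(** Only finite averages occur: a walk is a word of letters, independence is concatenation
    ([E_app]), and a capacity is the limit in [m] of sums of probabilities of no return up to time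
    [m]. Every capacity inequality is proved at fixed [m] with constants free of [m], so neither an
    infinite walk nor an infinite Green sum is ever formed. Dimension six enters through one
    estimate: the Green sum started at time [c] is [O(c^-2)], uniformly in space. The fourfold time
    sum in the second moment of the cut defect is then at most a cube of harmonic sums. An error
    [n^(1/4)] suffices because, relative to the square root of the length, cutting a piece of length
    [l] costs [l^(-1/4)]: over the dyadic scales this is a geometric series governed by the smallest
    pieces, while centred defects of disjoint pieces are independent and add in squares. Fixing [b]
    before [n] makes the pieces bounded, so the method of Stein needs no moment of the capacity
    beyond the second. The price is that the variance of the sum is known only up to a relative
    [O(b^(-1/4))], which must hold uniformly in [n]. *)

Lemma Rabs_le_bounds a b : Rabs a <= b -> - b <= a <= b.
Proof.
  intros H. pose proof (Rle_abs a). pose proof (Rle_abs (- a)) as H1. rewrite Rabs_Ropp in H1. lra.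
Qed.

Definition lsum {A : Type} (l : list A) (f : A -> R) : R :=
  fold_right Rplus 0 (map f l).

Lemma lsum_nil {A} (f : A -> R) : lsum [] f = 0.
Proof. reflexivity. Qed.

Lemma lsum_cons {A} (a : A) l f : lsum (a :: l) f = f a + lsum l f.
Proof. reflexivity. Qed.

Lemma lsum_app {A} (l l' : list A) f : lsum (l ++ l') f = lsum l f + lsum l' f.
Proof.
  induction l as [|a l IH]; simpl.
  - rewrite lsum_nil. ring.
  - rewrite !lsum_cons, IH. ring.
Qed.

Lemma lsum_ext_in {A} (l : list A) f g :
  (forall a, In a l -> f a = g a) -> lsum l f = lsum l g.
Proof.
  intros H. unfold lsum. f_equal. apply map_ext_in. exact H.
Qed.

Lemma lsum_ext {A} (l : list A) f g : (forall a, f a = g a) -> lsum l f = lsum l g.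
Proof. intros H. apply lsum_ext_in. auto. Qed.

Lemma lsum_plus {A} (l : list A) f g :
  lsum l (fun a => f a + g a) = lsum l f + lsum l g.
Proof.
  induction l as [|a l IH].
  - rewrite !lsum_nil. ring.
  - rewrite !lsum_cons, IH. ring.
Qed.

Lemma lsum_scal {A} (l : list A) c f : lsum l (fun a => c * f a) = c * lsum l f.
Proof.
  induction l as [|a l IH].
  - rewrite !lsum_nil. ring.
  - rewrite !lsum_cons, IH. ring.
Qed.

Lemma lsum_scal_r {A} (l : list A) c f : lsum l (fun a => f a * c) = lsum l f * c.
Proof.
  rewrite Rmult_comm, <- lsum_scal. apply lsum_ext. intros. ring.
Qed.

Lemma lsum_minus {A} (l : list A) f g :
  lsum l (fun a => f a - g a) = lsum l f - lsum l g.
Proof.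
  induction l as [|a l IH].
  - rewrite !lsum_nil. ring.
  - rewrite !lsum_cons, IH. ring.
Qed.

Lemma lsum_const {A} (l : list A) c : lsum l (fun _ => c) = INR (length l) * c.
Proof.
  induction l as [|a l IH].
  - rewrite lsum_nil. simpl. ring.
  - rewrite lsum_cons, IH. cbn [length]. rewrite S_INR. ring.
Qed.

Lemma lsum_le_in {A} (l : list A) f g :
  (forall a, In a l -> f a <= g a) -> lsum l f <= lsum l g.
Proof.
  induction l as [|a l IH]; intros H.
  - rewrite !lsum_nil. lra.
  - rewrite !lsum_cons. apply Rplus_le_compat.
    + apply H. now left.
    + apply IH. intros b Hb. apply H. now right.
Qed.

Lemma lsum_le {A} (l : list A) f g : (forall a, f a <= g a) -> lsum l f <= lsum l g.
Proof. intros H. apply lsum_le_in. auto. Qed.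

Lemma lsum_nonneg_in {A} (l : list A) f :
  (forall a, In a l -> 0 <= f a) -> 0 <= lsum l f.
Proof.
  intros H. apply Rle_trans with (lsum l (fun _ => 0)).
  - rewrite lsum_const. lra.
  - apply lsum_le_in. exact H.
Qed.

Lemma lsum_nonneg {A} (l : list A) f : (forall a, 0 <= f a) -> 0 <= lsum l f.
Proof. intros H. apply lsum_nonneg_in. auto. Qed.

Lemma lsum_map {A B} (h : A -> B) (l : list A) f :
  lsum (map h l) f = lsum l (fun a => f (h a)).
Proof. unfold lsum. now rewrite map_map. Qed.

Lemma lsum_flat_map {A B} (h : A -> list B) (l : list A) f :
  lsum (flat_map h l) f = lsum l (fun a => lsum (h a) f).
Proof.
  induction l as [|a l IH]; simpl.
  - reflexivity.
  - now rewrite lsum_app, lsum_cons, IH.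
Qed.

Lemma lsum_swap {A B} (l : list A) (l' : list B) (f : A -> B -> R) :
  lsum l (fun a => lsum l' (f a)) = lsum l' (fun b => lsum l (fun a => f a b)).
Proof.
  induction l as [|a l IH].
  - rewrite lsum_nil. rewrite (lsum_ext l' _ (fun _ => 0)) by reflexivity.
    rewrite lsum_const. ring.
  - rewrite lsum_cons, IH, <- lsum_plus. reflexivity.
Qed.

Lemma lsum_perm {A} (l l' : list A) f : Permutation l l' -> lsum l f = lsum l' f.
Proof.
  induction 1; rewrite ?lsum_cons; try lra.
Qed.

Lemma lsum_filter {A} (P : A -> bool) (l : list A) f :
  lsum (filter P l) f = lsum l (fun a => (if P a then 1 else 0) * f a).
Proof.
  induction l as [|a l IH]; simpl.
  - reflexivity.
  - rewrite lsum_cons. destruct (P a); rewrite ?lsum_cons, IH; ring.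
Qed.

Lemma length_filter_lsum {A} (P : A -> bool) (l : list A) :
  INR (length (filter P l)) = lsum l (fun a => if P a then 1 else 0).
Proof.
  rewrite <- (Rmult_1_r (INR _)), <- (lsum_const _ 1), lsum_filter.
  apply lsum_ext. intros a. ring.
Qed.

Lemma lsum_single_le {A} (l : list A) f a :
  (forall b, 0 <= f b) -> In a l -> f a <= lsum l f.
Proof.
  intros H. induction l as [|b l IH]; intros Ha; [destruct Ha|].
  destruct Ha as [<-|Ha]; rewrite lsum_cons.
  - pose proof (lsum_nonneg l f H). lra.
  - specialize (IH Ha). pose proof (H b). lra.
Qed.

Lemma lsum_mul {A B} (l : list A) (l' : list B) f g :
  lsum l f * lsum l' g = lsum l (fun a => lsum l' (fun b => f a * g b)).
Proof.
  rewrite <- lsum_scal_r. apply lsum_ext. intros a. now rewrite lsum_scal.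
Qed.

Lemma lsum_seq_S (m n : nat) f : lsum (seq m (S n)) f = lsum (seq m n) f + f (m + n)%nat.
Proof. rewrite seq_S, lsum_app, lsum_cons, lsum_nil. ring. Qed.

Lemma lsum_seq_shift (m n : nat) f : lsum (seq (S m) n) f = lsum (seq m n) (fun i => f (S i)).
Proof. now rewrite <- seq_shift, lsum_map. Qed.

Lemma lsum_seq_shift_add (m n k : nat) f :
  lsum (seq (m + k) n) f = lsum (seq m n) (fun i => f (i + k)%nat).
Proof.
  revert f. induction k as [|k IH]; intros f.
  - rewrite Nat.add_0_r. apply lsum_ext. intros. f_equal. lia.
  - rewrite Nat.add_succ_r, lsum_seq_shift, IH. apply lsum_ext. intros. f_equal. lia.
Qed.

Lemma lsum_Un_cv {A} (l : list A) (f : nat -> A -> R) (g : A -> R) :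
  (forall a, In a l -> Un_cv (fun m => f m a) (g a)) ->
  Un_cv (fun m => lsum l (f m)) (lsum l g).
Proof.
  induction l as [|a l IH]; intros H.
  - intros e He. exists 0%nat. intros n _. rewrite !lsum_nil, R_dist_eq. exact He.
  - apply (CV_plus (fun m => f m a) (fun m => lsum l (f m))).
    + apply H. now left.
    + apply IH. intros b Hb. apply H. now right.
Qed.

(** The expectation under the uniform law on words of length [n] over [K] letters; with [K = 2 * d]
    these are the first [n] steps of the walk. *)
Definition E (K n : nat) (F : list nat -> R) : R := lsum (words K n) F / INR (K ^ n).

Lemma INR_pow_pos (K n : nat) : (0 < K)%nat -> 0 < INR (K ^ n).
Proof.
  intros HK. apply lt_0_INR. apply Nat.neq_0_lt_0. apply Nat.pow_nonzero. lia.
Qed.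

Lemma words_length K n w : In w (words K n) -> length w = n.
Proof.
  revert w. induction n as [|n IH]; intros w Hw; simpl in Hw.
  - destruct Hw as [<-|[]]. reflexivity.
  - apply in_flat_map in Hw. destruct Hw as [v [Hv Hw]].
    apply in_map_iff in Hw. destruct Hw as [i [<- _]]. simpl. f_equal. auto.
Qed.

Lemma length_words K n : length (words K n) = (K ^ n)%nat.
Proof.
  induction n as [|n IH]; simpl; [reflexivity|].
  rewrite flat_map_constant_length with (c := K).
  - rewrite IH. lia.
  - intros w _. now rewrite length_map, length_seq.
Qed.

Lemma E_0 K F : E K 0 F = F [].
Proof. unfold E. simpl. rewrite lsum_cons, lsum_nil. field. Qed.

Lemma E_S K n F : (0 < K)%nat ->
  E K (S n) F = lsum (seq 0 K) (fun i => E K n (fun w => F (i :: w))) / INR K.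
Proof.
  intros HK. unfold E. cbn [words Nat.pow]. rewrite lsum_flat_map, mult_INR.
  rewrite (lsum_ext _ _ (fun w => lsum (seq 0 K) (fun i => F (i :: w))))
    by (intros; apply lsum_map).
  rewrite lsum_swap. unfold Rdiv. rewrite lsum_scal_r. field. split; apply Rgt_not_eq.
  - now apply lt_0_INR.
  - apply INR_pow_pos; assumption.
Qed.

Lemma E_ext K n F G : (forall w, length w = n -> F w = G w) -> E K n F = E K n G.
Proof.
  intros H. unfold E. f_equal. apply lsum_ext_in. intros w Hw. apply H.
  now apply words_length in Hw.
Qed.

Lemma E_le K n F G : (0 < K)%nat -> (forall w, length w = n -> F w <= G w) -> E K n F <= E K n G.
Proof.
  intros HK H. unfold E, Rdiv. apply Rmult_le_compat_r.
  - left. apply Rinv_0_lt_compat, INR_pow_pos, HK.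
  - apply lsum_le_in. intros w Hw. apply H. now apply words_length in Hw.
Qed.

Lemma E_const K n c : (0 < K)%nat -> E K n (fun _ => c) = c.
Proof.
  intros HK. unfold E. rewrite lsum_const, length_words. field.
  apply Rgt_not_eq, INR_pow_pos, HK.
Qed.

Lemma E_nonneg K n F : (0 < K)%nat -> (forall w, length w = n -> 0 <= F w) -> 0 <= E K n F.
Proof.
  intros HK H. rewrite <- (E_const K n 0 HK). now apply E_le.
Qed.

Lemma E_plus K n F G : E K n (fun w => F w + G w) = E K n F + E K n G.
Proof. unfold E. rewrite lsum_plus. unfold Rdiv. ring. Qed.

Lemma E_minus K n F G : E K n (fun w => F w - G w) = E K n F - E K n G.
Proof. unfold E. rewrite lsum_minus. unfold Rdiv. ring. Qed.

Lemma E_scal K n c F : E K n (fun w => c * F w) = c * E K n F.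
Proof. unfold E. rewrite lsum_scal. unfold Rdiv. ring. Qed.

Lemma E_scal_r K n c F : E K n (fun w => F w * c) = E K n F * c.
Proof. unfold E. rewrite lsum_scal_r. unfold Rdiv. ring. Qed.

Lemma E_lsum {A} K n (l : list A) (F : A -> list nat -> R) :
  E K n (fun w => lsum l (fun a => F a w)) = lsum l (fun a => E K n (F a)).
Proof.
  unfold E. rewrite lsum_swap. unfold Rdiv. rewrite lsum_scal_r. reflexivity.
Qed.

Lemma E_app K n m F : (0 < K)%nat ->
  E K (n + m) F = E K n (fun u => E K m (fun v => F (u ++ v))).
Proof.
  intros HK. revert F. induction n as [|n IH]; intros F.
  - now rewrite E_0.
  - cbn [Nat.add]. rewrite !E_S by assumption. f_equal. apply lsum_ext. intros i.
    now rewrite IH.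
Qed.

Lemma E_swap K n m (F : list nat -> list nat -> R) :
  E K n (fun u => E K m (F u)) = E K m (fun v => E K n (fun u => F u v)).
Proof.
  unfold E, Rdiv. rewrite !lsum_scal_r, lsum_swap. ring.
Qed.

Lemma E_S_last K n F : (0 < K)%nat ->
  E K (S n) F = E K n (fun w => lsum (seq 0 K) (fun i => F (w ++ [i])) / INR K).
Proof.
  intros HK. replace (S n) with (n + 1)%nat by lia. rewrite E_app by assumption.
  apply E_ext. intros w _. rewrite E_S by assumption. f_equal. apply lsum_ext. intros i.
  now rewrite E_0.
Qed.

(** Time reversal: the piece of a path before a cut can be read backwards, as a walk that starts at
    the cut. *)
Lemma E_rev K n F : (0 < K)%nat -> E K n (fun w => F (rev w)) = E K n F.
Proof.
  intros HK. revert F. induction n as [|n IH]; intros F.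
  - now rewrite !E_0.
  - rewrite E_S, E_S_last by assumption. cbn [rev].
    rewrite (lsum_ext _ _ (fun i => E K n (fun w => F (w ++ [i])))).
    + unfold Rdiv. rewrite E_scal_r, E_lsum. reflexivity.
    + intros i. apply (IH (fun w => F (w ++ [i]))).
Qed.

Lemma E_firstn K n k F : (0 < K)%nat -> (k <= n)%nat ->
  E K n (fun w => F (firstn k w)) = E K k F.
Proof.
  intros HK Hk. replace n with (k + (n - k))%nat by lia. rewrite E_app by assumption.
  apply E_ext. intros u Hu.
  rewrite <- (E_const K (n - k) (F u) HK). apply E_ext. intros v _.
  rewrite firstn_app, Hu, Nat.sub_diag, firstn_O, app_nil_r. now rewrite firstn_all2 by lia.
Qed.

Lemma E_cauchy_schwarz K n F G : (0 < K)%nat ->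
  E K n (fun w => F w * G w) ^ 2 <= E K n (fun w => F w ^ 2) * E K n (fun w => G w ^ 2).
Proof.
  intros HK.
  set (a := E K n (fun w => F w ^ 2)). set (b := E K n (fun w => F w * G w)).
  set (c := E K n (fun w => G w ^ 2)).
  assert (H : forall s t, 0 <= s ^ 2 * a + 2 * s * t * b + t ^ 2 * c).
  { intros s t. replace (s ^ 2 * a + 2 * s * t * b + t ^ 2 * c)
      with (E K n (fun w => (s * F w + t * G w) ^ 2)).
    - apply E_nonneg; [assumption|]. intros. apply pow2_ge_0.
    - unfold a, b, c. rewrite <- !E_scal, <- !E_plus. apply E_ext. intros. ring. }
  assert (Ha : 0 <= a) by (specialize (H 1 0); lra).
  assert (Hc : 0 <= c) by (specialize (H 0 1); lra).
  destruct (Req_dec c 0) as [Hc0|Hc0].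
  - destruct (Req_dec b 0) as [->|Hb]; [nra|].
    (* With [c = 0] the form is affine in its second argument, and this argument gives it the value
       -1. *)
    pose proof (H 1 (- (a + 1) / (2 * b))) as H1. rewrite Hc0 in H1.
    replace (1 ^ 2 * a + 2 * 1 * (- (a + 1) / (2 * b)) * b + (- (a + 1) / (2 * b)) ^ 2 * 0)
      with (-1) in H1 by (field; assumption). lra.
  - specialize (H c (- b)). assert (0 < c) by lra.
    apply Rmult_le_reg_l with c; [assumption|]. nra.
Qed.

Lemma E_square_le K n F : (0 < K)%nat -> E K n F ^ 2 <= E K n (fun w => F w ^ 2).
Proof.
  intros HK. pose proof (E_cauchy_schwarz K n F (fun _ => 1) HK) as H.
  cbv beta in H. rewrite (E_ext K n (fun w => F w * 1) F) in H by (intros; ring).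
  rewrite (E_ext K n (fun w => 1 ^ 2) (fun _ => 1)) in H by (intros; ring).
  rewrite E_const in H by assumption. lra.
Qed.

Lemma E_Rabs K n F : (0 < K)%nat -> Rabs (E K n F) <= E K n (fun w => Rabs (F w)).
Proof.
  intros HK. apply Rabs_le. split.
  - assert (E K n (fun w => -1 * F w) <= E K n (fun w => Rabs (F w))).
    { apply E_le; [assumption|]. intros w _. pose proof (Rle_abs (- F w)) as Ha.
      rewrite Rabs_Ropp in Ha. lra. }
    rewrite E_scal in H. lra.
  - apply E_le; [assumption|]. intros. apply Rle_abs.
Qed.

Lemma E_Rabs_le K n F c : (0 < K)%nat -> (forall w, length w = n -> Rabs (F w) <= c) ->
  Rabs (E K n F) <= c.
Proof.
  intros HK H. eapply Rle_trans; [now apply E_Rabs|]. rewrite <- (E_const K n c) by assumption.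
  now apply E_le.
Qed.

Lemma E_minkowski K n F G : (0 < K)%nat ->
  sqrt (E K n (fun w => (F w + G w) ^ 2))
  <= sqrt (E K n (fun w => F w ^ 2)) + sqrt (E K n (fun w => G w ^ 2)).
Proof.
  intros HK.
  assert (Ha : 0 <= E K n (fun w => F w ^ 2))
    by (apply E_nonneg; [assumption|]; intros; apply pow2_ge_0).
  assert (Hc : 0 <= E K n (fun w => G w ^ 2))
    by (apply E_nonneg; [assumption|]; intros; apply pow2_ge_0).
  pose proof (E_cauchy_schwarz K n F G HK) as H.
  rewrite (E_ext K n (fun w => (F w + G w) ^ 2) (fun w => F w ^ 2 + (2 * (F w * G w) + G w ^ 2)))
    by (intros; ring).
  rewrite !E_plus, E_scal.
  set (a := E K n (fun w => F w ^ 2)) in *. set (c := E K n (fun w => G w ^ 2)) in *.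
  set (b := E K n (fun w => F w * G w)) in *.
  assert (Hb : b <= sqrt a * sqrt c).
  { rewrite <- sqrt_mult by assumption. apply Rle_trans with (Rabs b); [apply Rle_abs|].
    rewrite <- sqrt_Rsqr_abs. apply sqrt_le_1_alt. unfold Rsqr. lra. }
  pose proof (sqrt_pos a). pose proof (sqrt_pos c).
  rewrite <- (sqrt_pow2 (sqrt a + sqrt c)) by lra.
  apply sqrt_le_1_alt.
  pose proof (pow2_sqrt a Ha). pose proof (pow2_sqrt c Hc).
  replace ((sqrt a + sqrt c) ^ 2) with (sqrt a ^ 2 + 2 * (sqrt a * sqrt c) + sqrt c ^ 2) by ring.
  lra.
Qed.

Lemma E_Un_cv K n (F : nat -> list nat -> R) G :
  (forall w, length w = n -> Un_cv (fun m => F m w) (G w)) ->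
  Un_cv (fun m => E K n (F m)) (E K n G).
Proof.
  intros H. unfold E, Rdiv.
  apply (CV_mult (fun m => lsum (words K n) (F m)) (fun _ => / INR (K ^ n))).
  - apply lsum_Un_cv. intros w Hw. apply H. now apply words_length in Hw.
  - intros e He. exists 0%nat. intros. rewrite R_dist_eq. exact He.
Qed.

Lemma prob_E d m P : prob d m P = E (2 * d) m (fun w => if P w then 1 else 0).
Proof. unfold prob, E. now rewrite length_filter_lsum. Qed.

(** * Displacements and paths *)

Lemma vadd_comm x y : vadd x y = vadd y x.
Proof.
  revert y. induction x as [|a x IH]; intros [|b y]; try reflexivity.
  unfold vadd in *. simpl. rewrite IH. f_equal. lia.
Qed.

Lemma vadd_assoc x y z : vadd x (vadd y z) = vadd (vadd x y) z.
Proof.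
  revert y z. induction x as [|a x IH]; intros [|b y] [|c z]; try reflexivity.
  unfold vadd in *. simpl. rewrite IH. f_equal. lia.
Qed.

Lemma length_vadd d x y : length x = d -> length y = d -> length (vadd x y) = d.
Proof.
  intros Hx Hy. unfold vadd. rewrite length_map, length_combine. lia.
Qed.

Lemma length_origin d : length (origin d) = d.
Proof. apply repeat_length. Qed.

Lemma length_step d i : length (step d i) = d.
Proof. unfold step. now rewrite length_map, length_seq. Qed.

Lemma vadd_origin_r d x : length x = d -> vadd x (origin d) = x.
Proof.
  intros <-. induction x as [|a x IH]; [reflexivity|].
  unfold vadd, origin in *. simpl. rewrite IH. f_equal. lia.
Qed.

Lemma vadd_origin_l d x : length x = d -> vadd (origin d) x = x.
Proof. rewrite vadd_comm. apply vadd_origin_r. Qed.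

Definition vopp (x : point) : point := map Z.opp x.

Lemma vopp_involutive x : vopp (vopp x) = x.
Proof.
  unfold vopp. rewrite map_map, <- map_id. apply map_ext. intros. apply Z.opp_involutive.
Qed.

Lemma length_vopp x : length (vopp x) = length x.
Proof. apply length_map. Qed.

Lemma vadd_vopp_r d x : length x = d -> vadd x (vopp x) = origin d.
Proof.
  intros <-. induction x as [|a x IH]; [reflexivity|].
  unfold vadd, origin, vopp in *. simpl. rewrite IH. f_equal. lia.
Qed.

Lemma vopp_vadd x y : vopp (vadd x y) = vadd (vopp x) (vopp y).
Proof.
  revert y. induction x as [|a x IH]; intros [|b y]; try reflexivity.
  unfold vadd, vopp in *. simpl. rewrite IH. f_equal. lia.
Qed.

Lemma vopp_origin d : vopp (origin d) = origin d.
Proof. induction d as [|d IH]; [reflexivity|]. unfold vopp, origin in *. simpl. now rewrite IH. Qed.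

Lemma vadd_vopp_cancel d x y : length x = d -> length y = d -> vadd (vadd y x) (vopp x) = y.
Proof.
  intros Hx Hy. rewrite <- vadd_assoc, (vadd_vopp_r d), vadd_origin_r; auto.
Qed.

Lemma vadd_cancel_l d x y z : length x = d -> length y = d -> length z = d ->
  vadd x y = vadd x z -> y = z.
Proof.
  intros Hx Hy Hz H. rewrite <- (vadd_vopp_cancel d x y), <- (vadd_vopp_cancel d x z) by assumption.
  now rewrite (vadd_comm y), (vadd_comm z), H.
Qed.

Definition coord (j : nat) (x : point) : Z := nth j x 0%Z.

Lemma coord_vadd d j x y : length x = d -> length y = d ->
  coord j (vadd x y) = (coord j x + coord j y)%Z.
Proof.
  unfold coord, vadd. intros <-. revert j y.
  induction x as [|a x IH]; intros j [|b y] Hy; try discriminate Hy.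
  - destruct j; reflexivity.
  - destruct j as [|j]; [reflexivity|]. simpl. apply IH. now injection Hy.
Qed.

Lemma coord_vopp j x : coord j (vopp x) = (- coord j x)%Z.
Proof. unfold coord, vopp. change 0%Z with (Z.opp 0) at 1. apply map_nth. Qed.

Lemma coord_origin j d : coord j (origin d) = 0%Z.
Proof. apply nth_repeat. Qed.

Lemma coord_step d i j : (j < d)%nat ->
  coord j (step d i)
  = if Nat.eqb j (i / 2) then (if Nat.even i then 1%Z else (-1)%Z) else 0%Z.
Proof.
  intros Hj. unfold coord, step.
  set (f := fun j => if Nat.eqb j (i / 2) then (if Nat.even i then 1%Z else (-1)%Z) else 0%Z).
  rewrite nth_indep with (d' := f 0%nat) by now rewrite length_map, length_seq.
  rewrite map_nth, seq_nth by assumption. reflexivity.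
Qed.

Fixpoint disp (d : nat) (w : list nat) : point :=
  match w with
  | [] => origin d
  | i :: w' => vadd (step d i) (disp d w')
  end.

Lemma length_disp d w : length (disp d w) = d.
Proof.
  induction w as [|i w IH]; [apply length_origin|].
  simpl. apply length_vadd; [apply length_step|exact IH].
Qed.

#[local] Hint Resolve length_vadd length_origin length_step length_disp : len.

Lemma disp_app d u v : disp d (u ++ v) = vadd (disp d u) (disp d v).
Proof.
  induction u as [|i u IH]; simpl.
  - now rewrite vadd_origin_l by apply length_disp.
  - now rewrite IH, vadd_assoc.
Qed.

Lemma disp_rev d w : disp d (rev w) = disp d w.
Proof.
  induction w as [|i w IH]; [reflexivity|].
  simpl. rewrite disp_app, IH. simpl.
  rewrite vadd_origin_r by apply length_step. apply vadd_comm.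
Qed.

Lemma path_eq d x w : length x = d ->
  path d x w = map (fun k => vadd x (disp d (firstn k w))) (seq 0 (S (length w))).
Proof.
  revert x. induction w as [|i w IH]; intros x Hx.
  - simpl. now rewrite vadd_origin_r.
  - cbn [path length]. rewrite <- cons_seq. cbn [map firstn disp].
    rewrite vadd_origin_r by assumption. f_equal.
    rewrite IH by auto with len. rewrite <- seq_shift, map_map.
    apply map_ext. intros k. cbn [firstn disp]. now rewrite vadd_assoc.
Qed.

Lemma path_cons d x w : exists l, path d x w = x :: l.
Proof. destruct w; simpl; eauto. Qed.

Lemma path_app d x u v : length x = d ->
  path d x (u ++ v) = path d x u ++ tl (path d (vadd x (disp d u)) v).
Proof.
  revert x. induction u as [|i u IH]; intros x Hx.
  - cbn [disp app]. rewrite vadd_origin_r by assumption. destruct v; reflexivity.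
  - cbn [path disp app]. rewrite IH by auto with len. now rewrite vadd_assoc.
Qed.

Lemma path_length_points d x w y : length x = d -> In y (path d x w) -> length y = d.
Proof.
  intros Hx. rewrite path_eq by assumption. intros Hy. apply in_map_iff in Hy.
  destruct Hy as [k [<- _]]. auto with len.
Qed.

Lemma path_translate d x y w : length x = d -> length y = d ->
  path d (vadd y x) w = map (vadd y) (path d x w).
Proof.
  intros Hx Hy. rewrite !path_eq by auto with len. rewrite map_map.
  apply map_ext. intros k. now rewrite vadd_assoc.
Qed.

Lemma length_path d x w : length (path d x w) = S (length w).
Proof. revert x. induction w as [|i w IH]; intros x; simpl; auto. Qed.

(** The letters [2 * c] and [2 * c + 1] are the two signs of the axis [c]; exchanging them reverses
    a step. *)
Definition flip (i : nat) : nat := if Nat.even i then S i else pred i.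

Lemma flip_even c : flip (2 * c) = (2 * c + 1)%nat.
Proof. unfold flip. rewrite Nat.even_even. lia. Qed.

Lemma flip_odd c : flip (2 * c + 1) = (2 * c)%nat.
Proof. unfold flip. rewrite Nat.even_odd. lia. Qed.

Lemma step_flip d i : step d (flip i) = vopp (step d i).
Proof.
  unfold step, vopp. rewrite map_map. apply map_ext. intros j.
  destruct (Nat.Even_or_Odd i) as [[c ->]|[c ->]].
  - rewrite flip_even, Nat.even_even, Nat.even_odd.
    replace ((2 * c + 1) / 2)%nat with c by (apply (Nat.div_unique _ 2 c 1); lia).
    replace ((2 * c) / 2)%nat with c by (apply (Nat.div_unique _ 2 c 0); lia).
    destruct (Nat.eqb j c); reflexivity.
  - rewrite flip_odd, Nat.even_even, Nat.even_odd.
    replace ((2 * c + 1) / 2)%nat with c by (apply (Nat.div_unique _ 2 c 1); lia).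
    replace ((2 * c) / 2)%nat with c by (apply (Nat.div_unique _ 2 c 0); lia).
    destruct (Nat.eqb j c); reflexivity.
Qed.

Lemma disp_flip d w : disp d (map flip w) = vopp (disp d w).
Proof.
  induction w as [|i w IH]; simpl.
  - now rewrite vopp_origin.
  - now rewrite vopp_vadd, step_flip, IH.
Qed.

Lemma lsum_seq_double d f :
  lsum (seq 0 (2 * d)) f = lsum (seq 0 d) (fun c => f (2 * c)%nat + f (2 * c + 1)%nat).
Proof.
  induction d as [|d IH]; [reflexivity|].
  replace (2 * S d)%nat with (S (S (2 * d))) by lia.
  rewrite !lsum_seq_S, IH. cbn [Nat.add]. replace (S (2 * d)) with (2 * d + 1)%nat by lia. ring.
Qed.

Lemma E_flip d n F : (0 < d)%nat -> E (2 * d) n (fun w => F (map flip w)) = E (2 * d) n F.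
Proof.
  intros Hd. revert F. induction n as [|n IH]; intros F.
  - now rewrite !E_0.
  - rewrite !E_S by lia. f_equal. rewrite !lsum_seq_double. apply lsum_ext. intros c.
    cbn [map]. rewrite flip_even, flip_odd.
    rewrite (IH (fun w => F ((2 * c + 1)%nat :: w))), (IH (fun w => F ((2 * c)%nat :: w))).
    ring.
Qed.

(** * Decay of the one-dimensional simple random walk *)

Fixpoint walk1 (k : nat) (z : Z) : R :=
  match k with
  | O => if Z.eq_dec z 0 then 1 else 0
  | S k' => (walk1 k' (z - 1) + walk1 k' (z + 1)) / 2
  end.

Lemma walk1_nonneg k z : 0 <= walk1 k z.
Proof.
  revert z. induction k as [|k IH]; intros z; simpl.
  - destruct Z.eq_dec; lra.
  - pose proof (IH (z - 1)%Z). pose proof (IH (z + 1)%Z). lra.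
Qed.

Lemma walk1_parity k z : Z.odd (Z.of_nat k + z) = true -> walk1 k z = 0.
Proof.
  revert z. induction k as [|k IH]; intros z Hz.
  - simpl. destruct Z.eq_dec; [subst; discriminate|reflexivity].
  - cbn [walk1]. rewrite !IH; [lra| |].
    + replace (Z.of_nat k + (z + 1))%Z with (Z.of_nat (S k) + z)%Z by lia. assumption.
    + replace (Z.of_nat k + (z - 1))%Z with (Z.of_nat (S k) + z + 2 * (-1))%Z by lia.
      rewrite Z.odd_add_mul_2. assumption.
Qed.

(** The absorption identity [j C(n, j) = n C(n-1, j-1)] and its mirror image, for [n = k + 1] and
    [j = (k + 1 + z) / 2]. Proved from the recursion of [walk1], it needs no binomial coefficient
    and no case distinction on parity. *)
Lemma walk1_ratio k z :
  IZR (Z.of_nat k + 1 + z) * walk1 (S k) z = IZR (Z.of_nat k + 1) * walk1 k (z - 1) /\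
  IZR (Z.of_nat k + 1 - z) * walk1 (S k) z = IZR (Z.of_nat k + 1) * walk1 k (z + 1).
Proof.
  revert z. induction k as [|k IH]; intros z.
  - cbn [walk1 Z.of_nat].
    destruct (Z.eq_dec (z - 1) 0) as [H1|H1], (Z.eq_dec (z + 1) 0) as [H2|H2]; try lia.
    + replace z with 1%Z by lia. simpl. lra.
    + replace z with (-1)%Z by lia. simpl. lra.
    + lra.
  - destruct (IH (z - 1)%Z) as [A1 B1]. destruct (IH (z + 1)%Z) as [A2 B2].
    replace (z - 1 + 1)%Z with z in B1 by lia. replace (z + 1 - 1)%Z with z in A2 by lia.
    rewrite (eq_refl : walk1 (S (S k)) z = (walk1 (S k) (z - 1) + walk1 (S k) (z + 1)) / 2).
    pose proof (eq_refl : walk1 (S k) (z - 1) = (walk1 k (z - 1 - 1) + walk1 k (z - 1 + 1)) / 2) as C1.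
    pose proof (eq_refl : walk1 (S k) (z + 1) = (walk1 k (z + 1 - 1) + walk1 k (z + 1 + 1)) / 2) as C2.
    replace (z - 1 + 1)%Z with z in C1 by lia. replace (z + 1 - 1)%Z with z in C2 by lia.
    rewrite Nat2Z.inj_succ in *. unfold Z.succ in *.
    rewrite ?minus_IZR, ?plus_IZR, ?minus_IZR in *.
    apply (f_equal (Rmult (IZR (Z.of_nat k) + 1))) in C1, C2. split; lra.
Qed.

(* At odd times there is no mass at 0, the only point where the one-step bound loses; hence the
   better bound at odd times. *)
Lemma walk1_bound_parity k z :
  walk1 k z ^ 2 <= / INR (k + 1 + (if Nat.even k then 0 else 1)).
Proof.
  revert z. induction k as [|k IH]; intros z.
  - simpl. destruct Z.eq_dec; lra.
  - destruct (walk1_ratio k z) as [H1 H2].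
    set (q := walk1 (S k) z) in *.
    assert (Hq : 0 <= q) by apply walk1_nonneg.
    pose proof (IH (z - 1)%Z) as I1. pose proof (IH (z + 1)%Z) as I2.
    pose proof (walk1_nonneg k (z - 1)). pose proof (walk1_nonneg k (z + 1)).
    assert (HK : IZR (Z.of_nat k + 1) = INR k + 1) by (rewrite plus_IZR, INR_IZR_INZ; reflexivity).
    assert (Hk : 0 <= INR k) by apply pos_INR.
    rewrite Nat.even_succ, <- Nat.negb_even. 
    destruct (Nat.even k) eqn:Ek; cbn [negb].
    + rewrite !plus_INR, ?S_INR in *. change (INR 1) with 1 in *. change (INR 0) with 0 in *. rewrite ?Rplus_0_l in *.
      assert (Hstep : (INR k + 2) * q <= (INR k + 1) * walk1 k (z - 1) \/
                      (INR k + 2) * q <= (INR k + 1) * walk1 k (z + 1)).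
      { destruct (Z.eq_dec z 0) as [Hz|Hz].
        - left. unfold q. rewrite walk1_parity; [nra|]. subst z.
          rewrite Z.add_0_r. apply Nat.even_spec in Ek. destruct Ek as [c ->].
          replace (Z.of_nat (S (2 * c))) with (1 + 2 * Z.of_nat c)%Z by lia.
          now rewrite Z.odd_add_mul_2.
        - destruct (Z_lt_le_dec 0 z) as [Hz'|Hz'].
          + left. rewrite <- HK, <- H1. apply Rmult_le_compat_r; [assumption|].
            rewrite (plus_IZR (_ + _)), HK.
            assert (1 <= IZR z) by (apply (IZR_le 1); lia). lra.
          + right. rewrite <- HK, <- H2. apply Rmult_le_compat_r; [assumption|].
            rewrite (minus_IZR (_ + _)), HK. assert (IZR z <= -1) by (apply (IZR_le _ (-1)); lia). lra. }
      assert (Hfin : forall r, 0 <= r -> r ^ 2 <= / (INR k + 1 + 0) ->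
                (INR k + 2) * q <= (INR k + 1) * r -> q ^ 2 <= / (INR k + 1 + 1 + 1)).
      { intros r Hr Hr2 Hqr. set (x := INR k) in *.
        (* From [(x + 2)^2 q^2 <= x + 1] the claim follows because
           [(x + 1) (x + 3) <= (x + 2)^2]. *)
        assert (Ha : ((x + 2) * q) ^ 2 <= ((x + 1) * r) ^ 2) by (apply pow_incr; split; nra).
        assert (Hb : (x + 1) * r ^ 2 <= 1).
        { apply Rle_trans with ((x + 1) * / (x + 1 + 0)); [|right; field; lra].
          apply Rmult_le_compat_l; lra. }
        apply Rmult_le_reg_l with (x + 1 + 1 + 1); [lra|]. rewrite Rinv_r by lra.
        assert (Hc : (x + 2) ^ 2 * q ^ 2 <= x + 1).
        { replace ((x + 2) ^ 2 * q ^ 2) with (((x + 2) * q) ^ 2) by ring.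
          apply Rle_trans with (1 := Ha). nra. }
        assert (0 <= q ^ 2) by apply pow2_ge_0.
        apply Rmult_le_reg_l with (x + 1); [lra|]. nra. }
      destruct Hstep as [Hs|Hs]; eapply Hfin; try exact Hs; assumption.
    + rewrite !plus_INR, ?S_INR in *. change (INR 1) with 1 in *. change (INR 0) with 0 in *. rewrite ?Rplus_0_l in *.
      (* From an odd time to the next even one the bound does not change, so it is enough that the
         maximum does not grow. *)
      assert (Hstep : (INR k + 1) * q <= (INR k + 1) * walk1 k (z - 1) \/
                      (INR k + 1) * q <= (INR k + 1) * walk1 k (z + 1)).
      { destruct (Z_lt_le_dec 0 z) as [Hz'|Hz'].
        - left. rewrite <- HK, <- H1. apply Rmult_le_compat_r; [assumption|].
          rewrite (plus_IZR (_ + _)), HK. apply (IZR_lt 0) in Hz'. lra.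
        - right. rewrite <- HK, <- H2. apply Rmult_le_compat_r; [assumption|].
          rewrite (minus_IZR (_ + _)), HK. apply (IZR_le _ 0) in Hz'. lra. }
      replace (INR k + 1 + 1 + 0) with (INR k + 1 + 1) by ring.
      destruct Hstep as [Hs|Hs]; apply Rmult_le_reg_l in Hs; try lra; nra.
Qed.

Lemma walk1_bound k z : walk1 k z ^ 2 <= / INR (k + 1).
Proof.
  apply Rle_trans with (1 := walk1_bound_parity k z).
  apply Rinv_le_contravar; [apply lt_0_INR; lia|]. apply le_INR. lia.
Qed.

(** AM-GM, through pairs and then a triple. It trades a product over six coordinates for a mean of
    sixth powers of single coordinates; the sixth power of a quantity of order [k^(-1/2)] is the
    rate [k^-3] of dimension six. *)
Lemma prod6_le_pow6 a b c e f g :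
  0 <= a -> 0 <= b -> 0 <= c -> 0 <= e -> 0 <= f -> 0 <= g ->
  a * b * c * e * f * g <= (a ^ 6 + b ^ 6 + c ^ 6 + e ^ 6 + f ^ 6 + g ^ 6) / 6.
Proof.
  intros Ha Hb Hc He Hf Hg.
  assert (H3 : forall x y z, 0 <= x -> 0 <= y -> 0 <= z -> x * y * z <= (x ^ 3 + y ^ 3 + z ^ 3) / 3).
  { intros x y z Hx Hy Hz.
    assert (0 <= (x + y + z) * ((x - y) ^ 2 + (y - z) ^ 2 + (x - z) ^ 2)).
    { apply Rmult_le_pos; [lra|]. pose proof (pow2_ge_0 (x - y)).
      pose proof (pow2_ge_0 (y - z)). pose proof (pow2_ge_0 (x - z)). lra. }
    nra. }
  assert (H2 : forall x y, (x * y) ^ 3 <= (x ^ 6 + y ^ 6) / 2).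
  { intros x y. pose proof (pow2_ge_0 (x ^ 3 - y ^ 3)). lra. }
  pose proof (H3 (a * b) (c * e) (f * g)
    (Rmult_le_pos _ _ Ha Hb) (Rmult_le_pos _ _ Hc He) (Rmult_le_pos _ _ Hf Hg)).
  pose proof (H2 a b). pose proof (H2 c e). pose proof (H2 f g). lra.
Qed.

(** * The heat kernel *)

Lemma INR_dim_ge_6 d : (6 <= d)%nat -> 6 <= INR d.
Proof. intros Hd. apply (le_INR 6) in Hd. simpl in Hd. lra. Qed.

(** With probability [1 / d] the argument [s] advances by 1, which lowers the mean of [s^-3] by at
    least [3 / (8 d s^4)]. By convexity, advancing [s] surely by [1 / (8 d)] lowers it by at most
    that much. The factor 8 makes room for [s] near 1. *)
Lemma cube_decay_step (d : nat) (s : R) : (0 < d)%nat -> 1 <= s ->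
  (/ (s + 1) ^ 3 + (INR d - 1) * / s ^ 3) / INR d <= / (s + / (8 * INR d)) ^ 3.
Proof.
  intros Hd Hs. assert (HD : 1 <= INR d) by (apply (le_INR 1); lia).
  set (a := / (8 * INR d)).
  assert (Ha : 0 < a) by (apply Rinv_0_lt_compat; lra).
  assert (H1 : / (s + 1) ^ 3 <= / s ^ 3 - 3 / (8 * s ^ 4)).
  { assert (0 < (s + 1) ^ 3) by (apply pow_lt; lra).
    apply Rmult_le_reg_l with (8 * s ^ 4 * (s + 1) ^ 3).
    - apply Rmult_lt_0_compat; [|assumption]. assert (0 < s ^ 4) by (apply pow_lt; lra). lra.
    - replace (8 * s ^ 4 * (s + 1) ^ 3 * / (s + 1) ^ 3) with (8 * s ^ 4) by (field; lra).
      replace (8 * s ^ 4 * (s + 1) ^ 3 * (/ s ^ 3 - 3 / (8 * s ^ 4)))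
        with ((8 * s - 3) * (s + 1) ^ 3) by (field; lra).
      assert (0 <= s * (s - 1)) by nra. assert (0 <= s * s * (s - 1)) by nra. nra. }
  assert (H2 : / s ^ 3 - 3 * a / s ^ 4 <= / (s + a) ^ 3).
  { assert (0 < (s + a) ^ 3) by (apply pow_lt; lra).
    assert (0 < s ^ 4) by (apply pow_lt; lra).
    apply Rmult_le_reg_l with (s ^ 4 * (s + a) ^ 3); [apply Rmult_lt_0_compat; assumption|].
    replace (s ^ 4 * (s + a) ^ 3 * / (s + a) ^ 3) with (s ^ 4) by (field; lra).
    replace (s ^ 4 * (s + a) ^ 3 * (/ s ^ 3 - 3 * a / s ^ 4))
      with ((s - 3 * a) * (s + a) ^ 3) by (field; lra).
    assert (0 <= s * s * (a * a)) by (apply Rmult_le_pos; nra).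
    assert (0 <= s * a * (a * a)) by (apply Rmult_le_pos; nra).
    assert (0 <= (a * a) * (a * a)) by (apply Rmult_le_pos; nra). nra. }
  apply Rle_trans with (2 := H2).
  apply Rle_trans with ((/ s ^ 3 - 3 / (8 * s ^ 4) + (INR d - 1) * / s ^ 3) / INR d).
  - unfold Rdiv at 1 3. apply Rmult_le_compat_r; [left; apply Rinv_0_lt_compat; lra|]. lra.
  - right. unfold a. field. split; lra.
Qed.

(** A supersolution for the number [k] of steps along one axis when [n] steps of the full walk
    remain, each of them along that axis with probability [1 / d]. It stands in for a large
    deviation bound on that number. *)
Definition cube_decay (d n k : nat) : R := / (INR k + 1 + INR n / (8 * INR d)) ^ 3.

Lemma cube_decay_S d n k : (0 < d)%nat ->
  (cube_decay d n (S k) + (INR d - 1) * cube_decay d n k) / INR d <= cube_decay d (S n) k.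
Proof.
  intros Hd. assert (HD : 1 <= INR d) by (apply (le_INR 1); lia).
  pose proof (pos_INR k). pose proof (pos_INR n).
  assert (0 <= INR n / (8 * INR d)) by (apply Rmult_le_pos; [lra|left; apply Rinv_0_lt_compat; lra]).
  pose proof (cube_decay_step d (INR k + 1 + INR n / (8 * INR d)) Hd) as H2.
  unfold cube_decay. rewrite !S_INR.
  replace (INR k + 1 + 1 + INR n / (8 * INR d)) with (INR k + 1 + INR n / (8 * INR d) + 1) by ring.
  replace (INR k + 1 + (INR n + 1) / (8 * INR d))
    with (INR k + 1 + INR n / (8 * INR d) + / (8 * INR d)) by (field; lra).
  apply H2. lra.
Qed.

Lemma walk1_pow6 k z : walk1 k z ^ 6 <= cube_decay 1 0 k.
Proof.
  unfold cube_decay. replace (INR k + 1 + INR 0 / (8 * INR 1)) with (INR (k + 1))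
    by (rewrite plus_INR; simpl; field).
  replace (walk1 k z ^ 6) with ((walk1 k z ^ 2) ^ 3) by ring.
  rewrite <- pow_inv. apply pow_incr. split; [apply pow2_ge_0|apply walk1_bound].
Qed.

Lemma div2_even c : (2 * c / 2)%nat = c.
Proof. symmetry. apply (Nat.div_unique _ 2 c 0); lia. Qed.

Lemma div2_odd c : ((2 * c + 1) / 2)%nat = c.
Proof. symmetry. apply (Nat.div_unique _ 2 c 1); lia. Qed.

Lemma coord_disp_cons d j i w : (j < d)%nat ->
  coord j (disp d (i :: w))
  = ((if Nat.eqb j (i / 2) then (if Nat.even i then 1 else -1) else 0) + coord j (disp d w))%Z.
Proof.
  intros Hj. cbn [disp]. rewrite (coord_vadd d) by auto with len. now rewrite coord_step.
Qed.

Lemma walk1_S_avg k z c :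
  walk1 k (z - (1 + c)) + walk1 k (z - (-1 + c)) = 2 * walk1 (S k) (z - c).
Proof.
  cbn [walk1]. replace (z - (1 + c))%Z with (z - c - 1)%Z by lia.
  replace (z - (-1 + c))%Z with (z - c + 1)%Z by lia. lra.
Qed.

Definition bump (k : nat -> nat) (c j : nat) : nat := if Nat.eqb j c then S (k j) else k j.

(** Here [k j] counts the steps along axis [j] whose signs are already averaged out, and [w] holds
    the remaining letters. For [k = 0] this is the indicator that the displacement agrees with [z]
    in the first six coordinates; for empty [w] it is a product of one-dimensional kernels. *)
Definition prod6 (d : nat) (k : nat -> nat) (z : nat -> Z) (w : list nat) : R :=
  let r j := walk1 (k j) (z j - coord j (disp d w)) in
  r 0%nat * r 1%nat * r 2%nat * r 3%nat * r 4%nat * r 5%nat.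

Definition cube_decay6 (d n : nat) (k : nat -> nat) : R :=
  let r j := cube_decay d n (k j) in
  (r 0%nat + r 1%nat + r 2%nat + r 3%nat + r 4%nat + r 5%nat) / 6.

(* A step along the coordinate [c], averaged over its sign, lengthens the [c]-th walk by one. *)
Lemma prod6_step d k z c w : (6 <= d)%nat ->
  prod6 d k z ((2 * c)%nat :: w) + prod6 d k z ((2 * c + 1)%nat :: w)
  = 2 * prod6 d (if (c <? 6)%nat then bump k c else k) z w.
Proof.
  intros Hd. unfold prod6. cbv zeta.
  rewrite !coord_disp_cons by lia. rewrite div2_even, div2_odd, Nat.even_even, Nat.even_odd.
  destruct c as [|[|[|[|[|[|c]]]]]];
    [..|replace (S (S (S (S (S (S c))))) <? 6)%nat with false by (symmetry; apply Nat.ltb_ge; lia);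
        cbn [Nat.eqb]; rewrite ?Z.add_0_l; ring];
    cbn [Nat.eqb Nat.ltb Nat.leb]; rewrite ?Z.add_0_l; unfold bump; cbn [Nat.eqb];
    match goal with |- context [walk1 ?n (?x - (1 + ?y))] =>
      replace (walk1 n (x - (1 + y))) with (2 * walk1 (S n) (x - y) - walk1 n (x - (-1 + y)))
        by (rewrite <- walk1_S_avg; ring)
    end; ring.
Qed.

(** The bound is a sum over axes, so the induction on [n] treats each axis alone: one step raises
    its count with probability [1 / d], which is the average in [cube_decay_S]. AM-GM is used only
    once, when no letter is left. *)
Lemma E_prod6_le d n k z : (6 <= d)%nat -> E (2 * d) n (prod6 d k z) <= cube_decay6 d n k.
Proof.
  intros Hd. assert (Hd0 : (0 < d)%nat) by lia. pose proof (INR_dim_ge_6 d Hd) as HD.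
  revert k. induction n as [|n IH]; intros k.
  - rewrite E_0. unfold prod6, cube_decay6. cbv zeta.
    eapply Rle_trans; [apply prod6_le_pow6; apply walk1_nonneg|].
    assert (H : forall j x, walk1 (k j) x ^ 6 <= cube_decay d 0 (k j)).
    { intros j x. apply Rle_trans with (1 := walk1_pow6 (k j) x). right.
      unfold cube_decay. f_equal. f_equal. simpl. field. lra. }
    apply Rmult_le_compat_r; [lra|]. repeat apply Rplus_le_compat; apply H.
  - rewrite E_S by lia. rewrite lsum_seq_double.
    rewrite (lsum_ext _ _ (fun c => 2 * E (2 * d) n (prod6 d (if (c <? 6)%nat then bump k c else k) z))).
    2:{ intros c. rewrite <- E_plus, <- E_scal. apply E_ext. intros w _. now apply prod6_step. }
    apply Rle_trans with (lsum (seq 0 d) (fun c =>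
      2 * cube_decay6 d n (if (c <? 6)%nat then bump k c else k)) / INR (2 * d)).
    + assert (0 < INR (2 * d)) by (apply lt_0_INR; lia).
      apply Rmult_le_compat_r; [left; now apply Rinv_0_lt_compat|]. apply lsum_le. intros c.
      apply Rmult_le_compat_l; [lra|apply IH].
    + replace d with (6 + (d - 6))%nat at 1 by lia. rewrite seq_app, lsum_app.
      rewrite (lsum_ext_in (seq (0 + 6) (d - 6)) _ (fun _ => 2 * cube_decay6 d n k)).
      2:{ intros c Hc. apply in_seq in Hc. destruct (Nat.ltb_spec c 6); [lia|reflexivity]. }
      rewrite lsum_const, length_seq, minus_INR, mult_INR by assumption.
      cbn [seq]. rewrite !lsum_cons, lsum_nil. unfold cube_decay6, bump. cbn [Nat.ltb Nat.leb Nat.eqb].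
      pose proof (fun j => cube_decay_S d n (k j) Hd0) as B.
      pose proof (B 0%nat). pose proof (B 1%nat). pose proof (B 2%nat).
      pose proof (B 3%nat). pose proof (B 4%nat). pose proof (B 5%nat).
      eapply Rle_trans; [|apply Rmult_le_compat_r; [lra|repeat apply Rplus_le_compat; eassumption]].
      right. simpl (INR 2). simpl (INR 6). field. lra.
Qed.

Definition heat (d n : nat) (z : point) : R :=
  E (2 * d) n (fun w => if point_eq_dec (disp d w) z then 1 else 0).

Lemma heat_nonneg d n z : (0 < d)%nat -> 0 <= heat d n z.
Proof.
  intros Hd. apply E_nonneg; [lia|]. intros w _. destruct point_eq_dec; lra.
Qed.

(** Comparing only the first six coordinates with those of [z] can only raise the probability. *)
Lemma heat_bound d n z : (6 <= d)%nat -> heat d n z <= (8 * INR d) ^ 3 * / (INR n + 1) ^ 3.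
Proof.
  intros Hd. pose proof (INR_dim_ge_6 d Hd) as HD.
  apply Rle_trans with (E (2 * d) n (prod6 d (fun _ => 0%nat) (fun j => coord j z))).
  - apply E_le; [lia|]. intros w _. unfold prod6. cbv zeta.
    destruct point_eq_dec as [->|_].
    + rewrite !Z.sub_diag. simpl. lra.
    + repeat apply Rmult_le_pos; apply walk1_nonneg.
  - eapply Rle_trans; [apply E_prod6_le; assumption|].
    match goal with |- ?X <= _ => replace X with (cube_decay d n 0) by (unfold cube_decay6; field) end.
    unfold cube_decay. pose proof (pos_INR n).
    rewrite <- !pow_inv, <- Rpow_mult_distr. apply pow_incr. split.
    + left. apply Rinv_0_lt_compat. simpl (INR 0).
      assert (0 <= INR n / (8 * INR d)) by
        (apply Rmult_le_pos; [lra|left; apply Rinv_0_lt_compat; lra]). lra.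
    + replace (8 * INR d * / (INR n + 1)) with (/ ((INR n + 1) / (8 * INR d))) by (field; lra).
      apply Rinv_le_contravar.
      * apply Rdiv_lt_0_compat; lra.
      * simpl (INR 0). unfold Rdiv. rewrite Rmult_plus_distr_r.
        assert (/ (8 * INR d) <= 1) by (rewrite <- Rinv_1; apply Rinv_le_contravar; lra). lra.
Qed.

(** Chapman-Kolmogorov; the reflection of [v] accounts for the plus sign in [vadd x (disp d v)]. *)
Lemma heat_convolution d c t x : (0 < d)%nat -> length x = d ->
  E (2 * d) c (fun v => heat d t (vadd x (disp d v))) = heat d (t + c) x.
Proof.
  intros Hd Hx. rewrite <- (E_flip d c) by assumption. unfold heat at 1.
  rewrite E_swap. unfold heat. rewrite E_app by lia.
  apply E_ext. intros w _. apply E_ext. intros v _. rewrite disp_flip, disp_app.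
  destruct (point_eq_dec (disp d w) (vadd x (vopp (disp d v)))) as [H1|H1];
  destruct (point_eq_dec (vadd (disp d w) (disp d v)) x) as [H2|H2]; try reflexivity; exfalso.
  - apply H2. rewrite H1, <- vadd_assoc, (vadd_comm (vopp _)), (vadd_vopp_r d), (vadd_origin_r d);
      auto with len.
  - apply H1. rewrite <- H2. symmetry. apply (vadd_vopp_cancel d); auto with len.
Qed.

Lemma heat_vopp d n z : (0 < d)%nat -> heat d n (vopp z) = heat d n z.
Proof.
  intros Hd. unfold heat. rewrite <- E_flip by assumption.
  apply E_ext. intros w _. rewrite disp_flip.
  destruct (point_eq_dec (vopp (disp d w)) (vopp z)) as [H1|H1];
  destruct (point_eq_dec (disp d w) z) as [H2|H2]; try reflexivity; exfalso.
  - apply H2. now rewrite <- (vopp_involutive (disp d w)), H1, vopp_involutive.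
  - apply H1. now f_equal.
Qed.

Lemma coord_disp_le d j w : (Z.abs (coord j (disp d w)) <= Z.of_nat (length w))%Z.
Proof.
  destruct (Nat.lt_ge_cases j d) as [Hj|Hj].
  - induction w as [|i w IH].
    + simpl. rewrite coord_origin. simpl. lia.
    + rewrite coord_disp_cons by assumption. cbn [length].
      destruct (Nat.eqb _ _), (Nat.even i); lia.
  - unfold coord. rewrite nth_overflow by now rewrite length_disp. lia.
Qed.

Lemma heat_support d n j z : (0 < d)%nat -> (Z.of_nat n < Z.abs (coord j z))%Z -> heat d n z = 0.
Proof.
  intros Hd H. unfold heat. transitivity (E (2 * d) n (fun _ => 0)); [|apply E_const; lia].
  apply E_ext. intros w Hw. destruct point_eq_dec as [<-|]; [|reflexivity].
  pose proof (coord_disp_le d j w). lia.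
Qed.

(** * Truncated Green function along a walk *)

Lemma sum_inv_cube_le n s : 1 <= s -> lsum (seq 0 n) (fun t => / (INR t + s) ^ 3) <= 2 / s ^ 2.
Proof.
  intros Hs. apply Rle_trans with (2 / s ^ 2 - 2 / (INR n + s) ^ 2).
  - induction n as [|n IH].
    + cbn [seq]. rewrite lsum_nil. right. simpl. field. lra.
    + rewrite lsum_seq_S, S_INR. cbn [Nat.add]. pose proof (pos_INR n).
      set (x := INR n + s) in *. replace (INR n + 1 + s) with (x + 1) by (unfold x; ring).
      assert (1 <= x) by (unfold x; lra).
      assert (/ x ^ 3 <= 2 / x ^ 2 - 2 / (x + 1) ^ 2); [|lra].
      replace (2 / x ^ 2 - 2 / (x + 1) ^ 2) with (2 * x * (2 * x + 1) * / (x ^ 3 * (x + 1) ^ 2))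
        by (field; lra).
      replace (/ x ^ 3) with ((x + 1) ^ 2 * / (x ^ 3 * (x + 1) ^ 2)) by (field; lra).
      apply Rmult_le_compat_r; [|nra]. left. apply Rinv_0_lt_compat.
      apply Rmult_lt_0_compat; apply pow_lt; lra.
  - pose proof (pos_INR n).
    assert (0 < 2 / (INR n + s) ^ 2) by (apply Rdiv_lt_0_compat; [lra|apply pow_lt; lra]). lra.
Qed.

Lemma sum_inv_square_le n s : 1 <= s -> lsum (seq 0 n) (fun t => / (INR t + s) ^ 2) <= 2 / s.
Proof.
  intros Hs. apply Rle_trans with (2 / s - 2 / (INR n + s)).
  - induction n as [|n IH].
    + cbn [seq]. rewrite lsum_nil. right. simpl. field. lra.
    + rewrite lsum_seq_S, S_INR. cbn [Nat.add]. pose proof (pos_INR n).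
      set (x := INR n + s) in *. replace (INR n + 1 + s) with (x + 1) by (unfold x; ring).
      assert (1 <= x) by (unfold x; lra).
      assert (/ x ^ 2 <= 2 / x - 2 / (x + 1)); [|lra].
      replace (2 / x - 2 / (x + 1)) with (2 * x * / (x ^ 2 * (x + 1))) by (field; lra).
      replace (/ x ^ 2) with ((x + 1) * / (x ^ 2 * (x + 1))) by (field; lra).
      apply Rmult_le_compat_r; [|nra]. left. apply Rinv_0_lt_compat.
      apply Rmult_lt_0_compat; [apply pow_lt|]; lra.
  - pose proof (pos_INR n).
    assert (0 < 2 / (INR n + s)) by (apply Rdiv_lt_0_compat; lra). lra.
Qed.

Definition green (d m : nat) (z : point) : R := lsum (seq 0 (S m)) (fun t => heat d t z).

(** The constant of [heat_bound] times the 2 of [sum_inv_cube_le]. *)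
Definition cgreen (d : nat) : R := 2 * (8 * INR d) ^ 3.

Lemma cgreen_pos d : (6 <= d)%nat -> 0 < cgreen d.
Proof.
  intros Hd. apply (le_INR 6) in Hd. simpl in Hd. unfold cgreen.
  assert (0 < (8 * INR d) ^ 3) by (apply pow_lt; lra). lra.
Qed.

Lemma green_nonneg d m z : (0 < d)%nat -> 0 <= green d m z.
Proof. intros Hd. apply lsum_nonneg. intros. now apply heat_nonneg. Qed.

Lemma green_vopp d m z : (0 < d)%nat -> green d m (vopp z) = green d m z.
Proof. intros Hd. apply lsum_ext. intros. now apply heat_vopp. Qed.

(** Averaging over [c] steps deletes the first [c] terms of the Green sum. The decay is thus one in
    time, uniform in the starting point [x], and two walks can be handled without any decay of the
    Green function in space. *)
Lemma E_green d m c x : (0 < d)%nat -> length x = d ->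
  E (2 * d) c (fun v => green d m (vadd x (disp d v)))
  = lsum (seq 0 (S m)) (fun t => heat d (t + c) x).
Proof.
  intros Hd Hx. unfold green. rewrite E_lsum. apply lsum_ext. intros t.
  now apply heat_convolution.
Qed.

Lemma sum_heat_le d m c x : (6 <= d)%nat ->
  lsum (seq 0 m) (fun t => heat d (t + c) x) <= cgreen d / (INR c + 1) ^ 2.
Proof.
  intros Hd.
  pose proof (INR_dim_ge_6 d Hd) as HD.
  pose proof (pos_INR c).
  apply Rle_trans with (lsum (seq 0 m) (fun t => (8 * INR d) ^ 3 * / (INR t + (INR c + 1)) ^ 3)).
  - apply lsum_le. intros t. rewrite <- Rplus_assoc, <- plus_INR. now apply heat_bound.
  - rewrite lsum_scal. unfold cgreen.
    replace (2 * (8 * INR d) ^ 3 / (INR c + 1) ^ 2) with ((8 * INR d) ^ 3 * (2 / (INR c + 1) ^ 2))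
      by (field; lra).
    apply Rmult_le_compat_l; [apply pow_le; lra|]. apply sum_inv_cube_le. lra.
Qed.

Lemma E_green_le d m c x : (6 <= d)%nat -> length x = d ->
  E (2 * d) c (fun v => green d m (vadd x (disp d v))) <= cgreen d / (INR c + 1) ^ 2.
Proof.
  intros Hd Hx. rewrite E_green by (lia || assumption). now apply sum_heat_le.
Qed.

(** * Second moment of the mutual Green energy of two walks *)

Definition harmonic (n : nat) : R := lsum (seq 0 n) (fun i => / (INR i + 1)).

Definition root8 (x : R) : R := sqrt (sqrt (sqrt x)).

Lemma root8_pow x : 0 <= x -> root8 x ^ 8 = x.
Proof.
  intros Hx. unfold root8.
  replace (sqrt (sqrt (sqrt x)) ^ 8) with (((sqrt (sqrt (sqrt x)) ^ 2) ^ 2) ^ 2) by ring.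
  rewrite !pow2_sqrt; try apply sqrt_pos; auto.
Qed.

Lemma root8_pos x : 0 <= root8 x.
Proof. apply sqrt_pos. Qed.

Lemma root8_le x y : x <= y -> root8 x <= root8 y.
Proof. intros H. unfold root8. now repeat apply sqrt_le_1_alt. Qed.

Lemma root8_ge_1 x : 1 <= x -> 1 <= root8 x.
Proof.
  intros H. apply root8_le in H. unfold root8 in H at 1. now rewrite !sqrt_1 in H.
Qed.

(** An eighth root replaces the logarithm: its cube is still below the square root, which is all
    that the second moment needs. For consecutive integers [a^8 - b^8 = 1], and each of the eight
    terms of [(a^8 - b^8) / (a - b)] is at most [a^8]. *)
Lemma harmonic_le_root8 n : harmonic n <= 8 * root8 (INR n).
Proof.
  unfold harmonic. induction n as [|n IH].
  - cbn [seq]. rewrite lsum_nil. pose proof (root8_pos (INR 0)). lra.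
  - rewrite lsum_seq_S. cbn [Nat.add]. rewrite <- S_INR.
    pose proof (pos_INR n) as Hn.
    set (a := root8 (INR (S n))) in *. set (b := root8 (INR n)) in *.
    assert (Ha8 : a ^ 8 = INR n + 1) by (unfold a; rewrite root8_pow, S_INR; lra || apply pos_INR).
    assert (Hb8 : b ^ 8 = INR n) by (apply root8_pow; assumption).
    assert (Hb : 0 <= b) by apply root8_pos.
    assert (Hba : b <= a) by (apply root8_le; rewrite S_INR; lra).
    assert (Ha1 : 1 <= a) by (apply root8_ge_1; rewrite S_INR; lra).
    assert (Hbk : forall j, b ^ j <= a ^ j) by (intros; apply pow_incr; lra).
    assert (Hk : forall i j, a ^ i * b ^ j <= a ^ (i + j)).
    { intros i j. rewrite pow_add. apply Rmult_le_compat_l; [apply pow_le; lra|apply Hbk]. }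
    assert (H1 : 1 <= (a - b) * (8 * a ^ 8)).
    { replace 1 with ((a - b) * (a ^ 7 + a ^ 6 * b ^ 1 + a ^ 5 * b ^ 2 + a ^ 4 * b ^ 3
          + a ^ 3 * b ^ 4 + a ^ 2 * b ^ 5 + a ^ 1 * b ^ 6 + a ^ 0 * b ^ 7)) at 1
        by (transitivity (a ^ 8 - b ^ 8); [ring|lra]).
      apply Rmult_le_compat_l; [lra|].
      pose proof (Hk 6%nat 1%nat). pose proof (Hk 5%nat 2%nat). pose proof (Hk 4%nat 3%nat).
      pose proof (Hk 3%nat 4%nat). pose proof (Hk 2%nat 5%nat). pose proof (Hk 1%nat 6%nat).
      pose proof (Hk 0%nat 7%nat). cbn [Nat.add] in *.
      assert (a ^ 7 <= a ^ 8).
      { change (a ^ 8) with (a * a ^ 7). assert (0 <= a ^ 7) by (apply pow_le; lra). nra. }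
      lra. }
    rewrite S_INR. rewrite Ha8 in H1.
    assert (/ (INR n + 1) <= 8 * (a - b)).
    { apply Rmult_le_reg_r with (INR n + 1); [lra|]. rewrite Rinv_l by lra. lra. }
    lra.
Qed.

Lemma lsum_seq_mono n m f : (forall i, 0 <= f i) -> (n <= m)%nat ->
  lsum (seq 0 n) f <= lsum (seq 0 m) f.
Proof.
  intros Hf H. replace m with (n + (m - n))%nat by lia. rewrite seq_app, lsum_app.
  pose proof (lsum_nonneg (seq (0 + n) (m - n)) f Hf). lra.
Qed.

Lemma sum_shifted_le n a h : (forall i, 0 <= h i) ->
  lsum (seq 0 n) (fun a' => if (a <=? a')%nat then h (a' - a)%nat else 0) <= lsum (seq 0 n) h.
Proof.
  intros Hh. destruct (Nat.le_gt_cases a n) as [Ha|Ha].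
  - replace (seq 0 n) with (seq 0 a ++ seq (0 + a) (n - a)) at 1
      by (rewrite <- seq_app; f_equal; lia).
    rewrite lsum_app, lsum_seq_shift_add.
    rewrite (lsum_ext_in (seq 0 a) _ (fun _ => 0)).
    2:{ intros i Hi. apply in_seq in Hi. destruct (Nat.leb_spec a i); [lia|reflexivity]. }
    rewrite lsum_const, Rmult_0_r, Rplus_0_l.
    rewrite (lsum_ext _ _ h).
    + apply lsum_seq_mono; [assumption|lia].
    + intros i. destruct (Nat.leb_spec a (i + a)); [|lia]. f_equal. lia.
  - rewrite (lsum_ext_in (seq 0 n) _ (fun _ => 0)).
    + rewrite lsum_const, Rmult_0_r. now apply lsum_nonneg.
    + intros i Hi. apply in_seq in Hi. destruct (Nat.leb_spec a i); [lia|reflexivity].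
Qed.

(** The distance of [a] and [a']: one of the two truncated differences is 0. *)
Definition gap (a a' : nat) : nat := (a - a' + (a' - a))%nat.

(** Change of variables from a pair to its distance and its minimum, which is at most two-to-one. *)
Lemma sum_gap_min_le n (f : nat -> nat -> R) : (forall c s, 0 <= f c s) ->
  lsum (seq 0 n) (fun a => lsum (seq 0 n) (fun a' => f (gap a a') (Nat.min a a')))
  <= 2 * lsum (seq 0 n) (fun s => lsum (seq 0 n) (fun c => f c s)).
Proof.
  intros Hf. set (T := lsum (seq 0 n) (fun s => lsum (seq 0 n) (fun c => f c s))).
  set (h := fun a a' : nat => if (a <=? a')%nat then f (a' - a)%nat a else 0).
  apply Rle_trans with (lsum (seq 0 n) (fun a => lsum (seq 0 n) (fun a' => h a a'))
                        + lsum (seq 0 n) (fun a => lsum (seq 0 n) (fun a' => h a' a))).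
  - rewrite <- lsum_plus. apply lsum_le. intros a. rewrite <- lsum_plus. apply lsum_le.
    intros a'. unfold h, gap.
    destruct (Nat.leb_spec a a') as [H|H], (Nat.leb_spec a' a) as [H'|H']; try lia.
    + replace a' with a by lia. rewrite Nat.min_id, Nat.sub_diag. simpl.
      pose proof (Hf 0%nat a). lra.
    + rewrite Nat.min_l by lia. replace (a - a' + (a' - a))%nat with (a' - a)%nat by lia. lra.
    + rewrite Nat.min_r by lia. replace (a - a' + (a' - a))%nat with (a - a')%nat by lia. lra.
  - rewrite (lsum_swap _ _ (fun a a' => h a' a)).
    assert (lsum (seq 0 n) (fun a => lsum (seq 0 n) (fun a' => h a a')) <= T); [|lra].
    apply lsum_le. intros a. unfold h. apply (sum_shifted_le n a (fun c => f c a)). intros. apply Hf.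
Qed.

(** The common bound, up to a constant, for the correlation of two Green values at the time pairs
    [(a, b)] and [(a', b')]: [c] and [e] are the gaps within the two walks, [s] is the sum of the
    two earlier times. *)
Definition kappa (c e s : nat) : R := / ((INR c + 1) * (INR e + 1) * (INR s + 1) ^ 2).

Lemma kappa_pos c e s : 0 < kappa c e s.
Proof.
  unfold kappa. pose proof (pos_INR c). pose proof (pos_INR e). pose proof (pos_INR s).
  apply Rinv_0_lt_compat. repeat apply Rmult_lt_0_compat; lra.
Qed.

(** Each gap gives a harmonic sum. Of the two minima, summing over one turns the inverse square into
    an inverse, and summing over the other gives the third harmonic factor. The 8 collects two
    foldings of pairs and the 2 of [sum_inv_square_le]. *)
Lemma sum_kappa_le n :
  lsum (seq 0 n) (fun a => lsum (seq 0 n) (fun a' => lsum (seq 0 n) (fun b => lsum (seq 0 n)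
    (fun b' => kappa (gap a a') (gap b b') (Nat.min a a' + Nat.min b b')))))
  <= 8 * harmonic n ^ 3.
Proof.
  set (f := fun c s => lsum (seq 0 n) (fun b => lsum (seq 0 n)
    (fun b' => kappa c (gap b b') (s + Nat.min b b')))).
  assert (Hf : forall c s, 0 <= f c s).
  { intros. apply lsum_nonneg. intros. apply lsum_nonneg. intros. left. apply kappa_pos. }
  apply Rle_trans with (1 := sum_gap_min_le n f Hf).
  apply Rle_trans with (2 * lsum (seq 0 n) (fun s => lsum (seq 0 n) (fun c =>
    2 * lsum (seq 0 n) (fun s' => lsum (seq 0 n) (fun e => kappa c e (s + s')))))).
  - apply Rmult_le_compat_l; [lra|]. apply lsum_le. intros s. apply lsum_le. intros c.
    apply (sum_gap_min_le n (fun e s' => kappa c e (s + s'))). intros. left. apply kappa_pos.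
  - apply Rle_trans with (2 * lsum (seq 0 n) (fun s => lsum (seq 0 n) (fun c =>
      2 * (/ (INR c + 1) * harmonic n * (2 * / (INR s + 1)))))).
    + apply Rmult_le_compat_l; [lra|]. apply lsum_le. intros s. apply lsum_le. intros c.
      apply Rmult_le_compat_l; [lra|]. pose proof (pos_INR c). pose proof (pos_INR s).
      rewrite (lsum_ext _ _ (fun s' => / (INR c + 1) * harmonic n * / (INR s' + (INR s + 1)) ^ 2)).
      * rewrite lsum_scal. apply Rmult_le_compat_l.
        -- apply Rmult_le_pos; [left; apply Rinv_0_lt_compat; lra|].
           apply lsum_nonneg. intros i. pose proof (pos_INR i). left. apply Rinv_0_lt_compat. lra.
        -- apply sum_inv_square_le. lra.
      * intros s'. unfold harmonic. rewrite <- lsum_scal, <- lsum_scal_r.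
        apply lsum_ext. intros e. unfold kappa. rewrite plus_INR.
        pose proof (pos_INR e). pose proof (pos_INR s'). 
        replace (INR s + INR s' + 1) with (INR s' + (INR s + 1)) by ring. field. lra.
    + right.
      rewrite (lsum_ext _ _ (fun s => (4 * harmonic n * harmonic n) * / (INR s + 1))).
      * rewrite lsum_scal. unfold harmonic at 3. fold (harmonic n). unfold harmonic. ring.
      * intros s. unfold harmonic at 3. rewrite <- !lsum_scal.  rewrite <- lsum_scal_r.
        apply lsum_ext. intros c. ring.
Qed.

Lemma E2_firstn K k l a b F : (0 < K)%nat -> (a <= k)%nat -> (b <= l)%nat ->
  E K k (fun u => E K l (fun v => F (firstn a u) (firstn b v)))
  = E K a (fun u => E K b (fun v => F u v)).
Proof.
  intros HK Ha Hb.
  rewrite (E_ext K k _ (fun u => E K b (fun v => F (firstn a u) v))).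
  - now rewrite (E_firstn K k a (fun u => E K b (fun v => F u v))).
  - intros u _. now rewrite (E_firstn K l b (fun v => F (firstn a u) v)).
Qed.

(** The Green energy between the ranges of two walks started at the origin, up to a reflection
    of the second one. *)
Definition mutual_green (d m k l : nat) (u v : list nat) : R :=
  lsum (seq 0 (S k)) (fun a => lsum (seq 0 (S l)) (fun b =>
    green d m (vadd (disp d (firstn a u)) (disp d (firstn b v))))).

Section TwoWalks.
Variables d m : nat.
Hypothesis Hd : (6 <= d)%nat.

Let K := (2 * d)%nat.
Let g := green d m.
Let N (c : nat) := cgreen d / (INR c + 1) ^ 2.

Let HK : (0 < K)%nat.
Proof. unfold K. lia. Qed.

Let Hg z : 0 <= g z.
Proof. apply green_nonneg. lia. Qed.

Let HN c : 0 <= N c.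
Proof.
  unfold N. pose proof (pos_INR c). apply Rmult_le_pos; [left; now apply cgreen_pos|].
  left. apply Rinv_0_lt_compat. apply pow_lt. lra.
Qed.

Let E2_green a b z : length z = d ->
  E K a (fun u => E K b (fun v => g (vadd z (vadd (disp d u) (disp d v))))) <= N (a + b).
Proof.
  intros Hz. rewrite (E_ext K a _ (fun u => E K b (fun v => g (vadd z (disp d (u ++ v)))))).
  - rewrite <- (E_app K a b (fun w => g (vadd z (disp d w)))) by exact HK. now apply E_green_le.
  - intros u _. apply E_ext. intros v _. now rewrite disp_app.
Qed.

(** The second Green value is later in both walks. Given the first [a] and [b] steps it is averaged
    over fresh increments, with a bound uniform in the base point, so the two factors decouple. *)
Lemma two_walks_nested a b c e :
  E K (a + c) (fun u => E K (b + e) (fun v =>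
    g (vadd (disp d (firstn a u)) (disp d (firstn b v))) * g (vadd (disp d u) (disp d v))))
  <= N (a + b) * N (c + e).
Proof.
  rewrite E_app by exact HK.
  rewrite (E_ext K a _ (fun u => E K b (fun v => E K c (fun u' => E K e (fun v' =>
    g (vadd (disp d u) (disp d v))
    * g (vadd (vadd (disp d u) (disp d v)) (vadd (disp d u') (disp d v')))))))).
  - apply Rle_trans with (E K a (fun u => E K b (fun v =>
      g (vadd (disp d u) (disp d v)) * N (c + e)))).
    + apply E_le; [exact HK|]. intros u _. apply E_le; [exact HK|]. intros v _.
      rewrite (E_ext K c _ (fun u' => g (vadd (disp d u) (disp d v)) * E K e (fun v' =>
        g (vadd (vadd (disp d u) (disp d v)) (vadd (disp d u') (disp d v'))))))
        by (intros; now rewrite E_scal).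
      rewrite E_scal. apply Rmult_le_compat_l; [apply Hg|]. apply E2_green. auto with len.
    + rewrite (E_ext K a _ (fun u => E K b (fun v => g (vadd (disp d u) (disp d v))) * N (c + e)))
        by (intros; now rewrite E_scal_r).
      rewrite E_scal_r. apply Rmult_le_compat_r; [apply HN|].
      rewrite (E_ext K a _ (fun u => E K b (fun v =>
        g (vadd (origin d) (vadd (disp d u) (disp d v)))))).
      * apply E2_green. auto with len.
      * intros u _. apply E_ext. intros v _. rewrite (vadd_origin_l d); auto with len.
  - intros u Hu. rewrite E_swap, E_app by exact HK. apply E_ext. intros v Hv.
    rewrite E_swap. apply E_ext. intros u' _. apply E_ext. intros v' _.
    rewrite !firstn_app, Hu, Hv, !Nat.sub_diag, !firstn_O, !app_nil_r, !firstn_all2 by lia.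
    rewrite !disp_app. f_equal. f_equal.
    rewrite !vadd_assoc. f_equal. rewrite <- !vadd_assoc. f_equal. apply vadd_comm.
Qed.

(** Each Green value is later in one walk and earlier in the other. Given the common past, one
    depends only on the new steps of [v] and the other only on those of [u], so they are
    conditionally independent. Either one may be bounded uniformly, hence two estimates. *)
Lemma two_walks_crossing a b c e :
  E K (a + c) (fun u => E K (b + e) (fun v =>
    g (vadd (disp d (firstn a u)) (disp d v)) * g (vadd (disp d u) (disp d (firstn b v)))))
  <= N c * N (a + b + e) /\
  E K (a + c) (fun u => E K (b + e) (fun v =>
    g (vadd (disp d (firstn a u)) (disp d v)) * g (vadd (disp d u) (disp d (firstn b v)))))
  <= N e * N (a + b + c).
Proof.
  rewrite E_app by exact HK.
  rewrite (E_ext K a _ (fun u => E K b (fun v =>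
    E K e (fun v' => g (vadd (vadd (disp d u) (disp d v)) (disp d v')))
    * E K c (fun u' => g (vadd (vadd (disp d u) (disp d v)) (disp d u')))))).
  - assert (HA : forall c, E K a (fun u => E K b (fun v =>
      E K c (fun u' => g (vadd (vadd (disp d u) (disp d v)) (disp d u'))))) <= N (a + b + c)).
    { clear c. intros c. rewrite (E_ext K a _ (fun u => E K b (fun v => E K c (fun v' =>
        g (vadd (origin d) (disp d (u ++ v ++ v'))))))).
      - rewrite <- Nat.add_assoc.
        rewrite (E_ext K a _ (fun u => E K (b + c) (fun v => g (vadd (origin d) (disp d (u ++ v))))))
          by (intros u _; now rewrite (E_app K b c (fun v => g (vadd (origin d) (disp d (u ++ v))))) by exact HK).
        rewrite <- (E_app K a (b + c) (fun w => g (vadd (origin d) (disp d w)))) by exact HK.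
        apply E_green_le; [assumption|apply length_origin].
      - intros u _. apply E_ext. intros v _. apply E_ext. intros v' _.
        rewrite (vadd_origin_l d) by auto with len. now rewrite !disp_app, vadd_assoc. }
    assert (HB : forall c z, length z = d -> E K c (fun v => g (vadd z (disp d v))) <= N c)
      by (intros; now apply E_green_le).
    assert (HP : forall c z, 0 <= E K c (fun v => g (vadd z (disp d v))))
      by (intros; now apply E_nonneg).
    split.
    + apply Rle_trans with (2 := Rmult_le_compat_l _ _ _ (HN c) (HA e)).
      rewrite <- E_scal. apply E_le; [exact HK|]. intros u _.
      rewrite <- E_scal. apply E_le; [exact HK|]. intros v _.
      rewrite Rmult_comm. apply Rmult_le_compat_r; [apply HP|]. apply HB. auto with len.
    + apply Rle_trans with (2 := Rmult_le_compat_l _ _ _ (HN e) (HA c)).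
      rewrite <- E_scal. apply E_le; [exact HK|]. intros u _.
      rewrite <- E_scal. apply E_le; [exact HK|]. intros v _.
      apply Rmult_le_compat_r; [apply HP|]. apply HB. auto with len.
  - intros u Hu. rewrite E_swap, E_app by exact HK. apply E_ext. intros v Hv.
    rewrite <- E_scal_r. apply E_ext. intros v' _. rewrite <- E_scal.
    apply E_ext. intros u' _.
    rewrite !firstn_app, Hu, Hv, !Nat.sub_diag, !firstn_O, !app_nil_r, !firstn_all2 by lia.
    rewrite !disp_app, !vadd_assoc. f_equal. f_equal. rewrite <- !vadd_assoc. f_equal. apply vadd_comm.
Qed.

(** Because [(x + y + 1)^2] dominates [(x + 1) (y + 1)]. *)
Lemma nested_le_kappa a b c e : N (a + b) * N (c + e) <= cgreen d ^ 2 * kappa c e (a + b).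
Proof.
  unfold N, kappa. rewrite (plus_INR c e).
  pose proof (pos_INR (a + b)). pose proof (pos_INR c). pose proof (pos_INR e).
  set (s := INR (a + b)) in *. set (x := INR c) in *. set (y := INR e) in *.
  replace (cgreen d / (s + 1) ^ 2 * (cgreen d / (x + y + 1) ^ 2))
    with (cgreen d ^ 2 * / ((x + y + 1) ^ 2 * (s + 1) ^ 2)) by (field; lra).
  apply Rmult_le_compat_l; [apply pow2_ge_0|].
  assert (0 < (s + 1) ^ 2) by (apply pow_lt; lra).
  apply Rinv_le_contravar; [repeat apply Rmult_lt_0_compat; lra|].
  apply Rmult_le_compat_r; [lra|]. nra.
Qed.

(* The geometric mean of the two bounds. *)
Lemma crossing_le_kappa T a b c e : 0 <= T ->
  T <= N c * N (a + b + e) -> T <= N e * N (a + b + c) ->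
  T <= cgreen d ^ 2 * kappa c e (a + b).
Proof.
  intros HT H1 H2. pose proof (Rmult_le_compat _ _ _ _ HT HT H1 H2) as H.
  unfold N, kappa in *. rewrite !(plus_INR (a + b)) in H.
  pose proof (pos_INR (a + b)). pose proof (pos_INR c). pose proof (pos_INR e).
  set (s := INR (a + b)) in *. set (x := INR c) in *. set (y := INR e) in *.
  pose proof (cgreen_pos d Hd) as HC. set (C := cgreen d) in *.
  apply Rsqr_incr_0_var.
  2:{ apply Rmult_le_pos; [apply pow2_ge_0|]. left. apply Rinv_0_lt_compat.
      repeat apply Rmult_lt_0_compat; lra. }
  unfold Rsqr. apply Rle_trans with (1 := H).
  replace (C / (x + 1) ^ 2 * (C / (s + y + 1) ^ 2) * (C / (y + 1) ^ 2 * (C / (s + x + 1) ^ 2)))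
    with (C ^ 4 * / ((x + 1) ^ 2 * (y + 1) ^ 2 * ((s + y + 1) * (s + x + 1)) ^ 2)) by (field; lra).
  replace (C ^ 2 * / ((x + 1) * (y + 1) * (s + 1) ^ 2) * (C ^ 2 * / ((x + 1) * (y + 1) * (s + 1) ^ 2)))
    with (C ^ 4 * / ((x + 1) ^ 2 * (y + 1) ^ 2 * ((s + 1) * (s + 1)) ^ 2)) by (field; lra).
  apply Rmult_le_compat_l; [apply pow_le; lra|].
  assert (0 < (x + 1) ^ 2 * (y + 1) ^ 2) by (apply Rmult_lt_0_compat; apply pow_lt; lra).
  apply Rinv_le_contravar.
  - apply Rmult_lt_0_compat; [assumption|]. apply pow_lt. nra.
  - apply Rmult_le_compat_l; [lra|]. apply pow_incr. split; nra.
Qed.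

Lemma two_walks_pair k l a a' b b' :
  (a <= k)%nat -> (a' <= k)%nat -> (b <= l)%nat -> (b' <= l)%nat ->
  E K k (fun u => E K l (fun v =>
    g (vadd (disp d (firstn a u)) (disp d (firstn b v)))
    * g (vadd (disp d (firstn a' u)) (disp d (firstn b' v)))))
  <= cgreen d ^ 2 * kappa (gap a a') (gap b b') (Nat.min a a' + Nat.min b b').
Proof.
  (* Exchanging the two Green factors reduces everything to [a <= a']; the order of [b] and [b']
     then decides between the nested and the crossing case. *)
  assert (W : forall a a' b b', (a <= a')%nat -> (a' <= k)%nat -> (b <= l)%nat -> (b' <= l)%nat ->
    E K k (fun u => E K l (fun v =>
      g (vadd (disp d (firstn a u)) (disp d (firstn b v)))
      * g (vadd (disp d (firstn a' u)) (disp d (firstn b' v)))))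
    <= cgreen d ^ 2 * kappa (gap a a') (gap b b') (Nat.min a a' + Nat.min b b')).
  { clear a a' b b'. intros a a' b b' Ha Ha' Hb Hb'. rewrite (Nat.min_l a a') by assumption.
    replace (gap a a') with (a' - a)%nat by (unfold gap; lia).
    destruct (Nat.le_ge_cases b b') as [H|H].
    - rewrite (Nat.min_l b b') by assumption. replace (gap b b') with (b' - b)%nat by (unfold gap; lia).
      apply Rle_trans with (2 := nested_le_kappa a b (a' - a) (b' - b)).
      apply Rle_trans with (2 := two_walks_nested a b (a' - a) (b' - b)).
      replace (a + (a' - a))%nat with a' by lia. replace (b + (b' - b))%nat with b' by lia.
      rewrite <- (E2_firstn K k l a' b') by (assumption || exact HK).
      right. apply E_ext. intros u _. apply E_ext. intros v _.
      rewrite !firstn_firstn, !Nat.min_l by assumption. reflexivity.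
    - rewrite (Nat.min_r b b') by assumption. replace (gap b b') with (b - b')%nat by (unfold gap; lia).
      destruct (two_walks_crossing a b' (a' - a) (b - b')) as [H1 H2].
      replace (a + (a' - a))%nat with a' in H1, H2 by lia.
      replace (b' + (b - b'))%nat with b in H1, H2 by lia.
      rewrite <- (E2_firstn K k l a' b) in H1, H2 by (assumption || exact HK).
      match type of H1 with ?X <= _ => match goal with |- ?Y <= _ => replace Y with X end end.
      + apply crossing_le_kappa; [|assumption..].
        apply E_nonneg; [exact HK|]. intros u _. apply E_nonneg; [exact HK|]. intros v _.
        apply Rmult_le_pos; apply Hg.
      + apply E_ext. intros u _. apply E_ext. intros v _.
        rewrite !firstn_firstn, !Nat.min_l by assumption. reflexivity. }
  intros Ha Ha' Hb Hb'. destruct (Nat.le_ge_cases a a') as [H|H]; [now apply W|].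
  rewrite (Nat.min_comm a), (Nat.min_comm b).
  replace (gap a a') with (gap a' a) by (unfold gap; lia).
  replace (gap b b') with (gap b' b) by (unfold gap; lia).
  apply Rle_trans with (2 := W a' a b' b H Ha Hb' Hb).
  right. apply E_ext. intros u _. apply E_ext. intros v _. apply Rmult_comm.
Qed.

Lemma mutual_green_second_moment k l :
  E K k (fun u => E K l (fun v => mutual_green d m k l u v ^ 2))
  <= 4096 * cgreen d ^ 2 * sqrt (INR (k + l + 1)).
Proof.
  set (n := (k + l + 1)%nat).
  set (p := fun a b u v => g (vadd (disp d (firstn a u)) (disp d (firstn b v)))).
  assert (Hp : forall u v, mutual_green d m k l u v ^ 2
    = lsum (seq 0 (S k)) (fun a => lsum (seq 0 (S k)) (fun a' => lsum (seq 0 (S l)) (fun b =>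
        lsum (seq 0 (S l)) (fun b' => p a b u v * p a' b' u v))))).
  { intros u v. rewrite <- Rsqr_pow2. unfold Rsqr, mutual_green. rewrite lsum_mul.
    apply lsum_ext. intros a. apply lsum_ext. intros a'. apply lsum_mul. }
  rewrite (E_ext K k _ (fun u => lsum (seq 0 (S k)) (fun a => lsum (seq 0 (S k)) (fun a' =>
    lsum (seq 0 (S l)) (fun b => lsum (seq 0 (S l)) (fun b' =>
      E K l (fun v => p a b u v * p a' b' u v))))))).
  2:{ intros u _. rewrite (E_ext K l _ _ (fun v _ => Hp u v)).
      rewrite E_lsum. apply lsum_ext. intros a. rewrite E_lsum. apply lsum_ext. intros a'.
      rewrite E_lsum. apply lsum_ext. intros b. now rewrite E_lsum. }
  rewrite E_lsum.
  apply Rle_trans with (lsum (seq 0 (S k)) (fun a => lsum (seq 0 (S k)) (fun a' =>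
    lsum (seq 0 (S l)) (fun b => lsum (seq 0 (S l)) (fun b' =>
      cgreen d ^ 2 * kappa (gap a a') (gap b b') (Nat.min a a' + Nat.min b b')))))).
  - apply lsum_le_in. intros a Ha. apply in_seq in Ha. rewrite E_lsum.
    apply lsum_le_in. intros a' Ha'. apply in_seq in Ha'. rewrite E_lsum.
    apply lsum_le_in. intros b Hb. apply in_seq in Hb. rewrite E_lsum.
    apply lsum_le_in. intros b' Hb'. apply in_seq in Hb'.
    apply two_walks_pair; lia.
  - apply Rle_trans with (cgreen d ^ 2 * (8 * harmonic n ^ 3)).
    + apply Rle_trans with (2 := Rmult_le_compat_l _ _ _ (pow2_ge_0 (cgreen d)) (sum_kappa_le n)).
      assert (Hnn : forall (j : nat) (F : nat -> R), (forall i, 0 <= F i) ->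
        0 <= lsum (seq 0 j) F) by (intros; now apply lsum_nonneg).
      rewrite <- lsum_scal.
      assert (HKp : forall a a' b b', 0 <= cgreen d ^ 2 * kappa (gap a a') (gap b b') (Nat.min a a' + Nat.min b b')).
      { intros. apply Rmult_le_pos; [apply pow2_ge_0|left; apply kappa_pos]. }
      eapply Rle_trans; [apply (lsum_seq_mono (S k) n); [|unfold n; lia]|].
      { intros a. repeat (apply Hnn; intros). apply HKp. }
      apply lsum_le. intros a. rewrite <- lsum_scal.
      eapply Rle_trans; [apply (lsum_seq_mono (S k) n); [|unfold n; lia]|].
      { intros a'. repeat (apply Hnn; intros). apply HKp. }
      apply lsum_le. intros a'. rewrite <- lsum_scal.
      eapply Rle_trans; [apply (lsum_seq_mono (S l) n); [|unfold n; lia]|].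
      { intros b. repeat (apply Hnn; intros). apply HKp. }
      apply lsum_le. intros b. rewrite <- lsum_scal.
      apply (lsum_seq_mono (S l) n); [|unfold n; lia]. intros. apply HKp.
    (* With [r] the eighth root, [r^3 <= r^4], and [r^4] is the square root of [n]; the constant is
       [4096 = 8 * 8^3]. *)
    + assert (Hn1 : 1 <= INR n) by (apply (le_INR 1); unfold n; lia).
      pose proof (harmonic_le_root8 n) as Hh.
      assert (H0 : 0 <= harmonic n).
      { apply lsum_nonneg. intros i. left. apply Rinv_0_lt_compat. pose proof (pos_INR i). lra. }
      pose proof (root8_ge_1 _ Hn1) as Hr.
      assert (H3 : harmonic n ^ 3 <= (8 * root8 (INR n)) ^ 3) by (apply pow_incr; lra).
      assert (H4 : sqrt (INR n) = root8 (INR n) ^ 4).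
      { unfold root8. replace (sqrt (sqrt (sqrt (INR n))) ^ 4)
          with ((sqrt (sqrt (sqrt (INR n))) ^ 2) ^ 2) by ring.
        now rewrite !pow2_sqrt by apply sqrt_pos. }
      rewrite H4. set (r := root8 (INR n)) in *.
      assert (H5 : r ^ 3 <= r ^ 4).
      { change (r ^ 4) with (r * r ^ 3). assert (0 <= r ^ 3) by (apply pow_le; lra). nra. }
      rewrite (Rmult_comm 4096), Rmult_assoc. apply Rmult_le_compat_l; [apply pow2_ge_0|].
      replace ((8 * r) ^ 3) with (512 * r ^ 3) in H3 by ring. lra.
Qed.

End TwoWalks.

(** * Subadditivity of the capacity and its defect *)

Definition ind (b : bool) : R := if b then 1 else 0.

Lemma ind_bounds b : 0 <= ind b <= 1.
Proof. destruct b; simpl; lra. Qed.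

Definition avoids (A : list point) (l : list point) : bool :=
  forallb (fun y => negb (memb y A)) l.

Lemma no_return_by_E d A x m :
  no_return_by d A x m = E (2 * d) m (fun w => ind (avoids A (tl (path d x w)))).
Proof. unfold no_return_by. now rewrite prob_E. Qed.

Lemma no_return_by_bounds d A x m : (0 < d)%nat -> 0 <= no_return_by d A x m <= 1.
Proof.
  intros Hd. rewrite no_return_by_E. split.
  - apply E_nonneg; [lia|]. intros. apply ind_bounds.
  - rewrite <- (E_const (2 * d) m 1) by lia. apply E_le; [lia|]. intros. apply ind_bounds.
Qed.

Lemma path_snoc d x w i : exists y, path d x (w ++ [i]) = path d x w ++ [y].
Proof.
  revert x. induction w as [|j w IH]; intros x.
  - eexists. simpl. reflexivity.
  - destruct (IH (vadd x (step d j))) as [y Hy]. exists y. simpl. now rewrite Hy.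
Qed.

Lemma no_return_by_decreasing d A x : (0 < d)%nat -> Un_decreasing (no_return_by d A x).
Proof.
  intros Hd m. rewrite !no_return_by_E, E_S_last by lia. apply E_le; [lia|]. intros w _.
  apply Rle_trans with (lsum (seq 0 (2 * d)) (fun _ => ind (avoids A (tl (path d x w)))) / INR (2 * d)).
  - assert (HI : 0 < INR (2 * d)) by (apply lt_0_INR; lia).
    unfold Rdiv. apply Rmult_le_compat_r; [left; now apply Rinv_0_lt_compat|].
    apply lsum_le. intros i. destruct (path_snoc d x w i) as [y Hy]. rewrite Hy.
    destruct (path_cons d x w) as [l Hl]. rewrite Hl. cbn [tl app]. unfold avoids.
    rewrite forallb_app. destruct (forallb _ l); simpl; [|lra].
    match goal with |- ind ?b <= _ => pose proof (ind_bounds b) end. lra.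
  - rewrite lsum_const, length_seq. right. field. apply not_0_INR. lia.
Qed.

(** The sequence decreases and is bounded below, so the [epsilon] in [escape] picks a genuine
    limit. *)
Lemma escape_cv d A x : (0 < d)%nat -> Un_cv (no_return_by d A x) (escape d A x).
Proof.
  intros Hd. unfold escape. apply epsilon_spec.
  destruct (decreasing_cv (no_return_by d A x)) as [l Hl].
  - now apply no_return_by_decreasing.
  - exists 0. intros y [m ->]. unfold opp_seq. pose proof (no_return_by_bounds d A x m Hd). lra.
  - now exists l.
Qed.

(** The capacity at horizon [m]. Set inequalities are proved here, where each probability is a
    finite count, and pass to [Cap] by [Cap_cv]. *)
Definition Capm (d : nat) (A : list point) (m : nat) : R :=
  lsum (nodup point_eq_dec A) (fun x => no_return_by d A x m).

Lemma Cap_cv d A : (0 < d)%nat -> Un_cv (Capm d A) (Cap d A).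
Proof.
  intros Hd. unfold Capm, Cap. apply (lsum_Un_cv _ (fun m x => no_return_by d A x m)).
  intros x _. now apply escape_cv.
Qed.

Lemma memb_spec y A : memb y A = true <-> In y A.
Proof. unfold memb. destruct in_dec; split; congruence || auto. Qed.

Lemma memb_ext y A B : (In y A <-> In y B) -> memb y A = memb y B.
Proof. unfold memb. intros H. do 2 destruct in_dec; tauto. Qed.

Lemma no_return_by_ext d A B x m : (forall y, In y A <-> In y B) ->
  no_return_by d A x m = no_return_by d B x m.
Proof.
  intros H. rewrite !no_return_by_E. apply E_ext. intros w _. f_equal. unfold avoids.
  induction (tl (path d x w)) as [|y l IH]; [reflexivity|]. simpl. rewrite IH.
  now rewrite (memb_ext y A B).
Qed.

Lemma Capm_ext d A B m : (forall y, In y A <-> In y B) -> Capm d A m = Capm d B m.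
Proof.
  intros H. unfold Capm. rewrite (lsum_perm (nodup point_eq_dec A) (nodup point_eq_dec B)).
  - apply lsum_ext. intros x. now apply no_return_by_ext.
  - apply NoDup_Permutation; try apply NoDup_nodup. intros x. rewrite !nodup_In. apply H.
Qed.

Lemma avoids_translate d y A l : length y = d -> (forall z, In z A -> length z = d) ->
  (forall z, In z l -> length z = d) -> avoids (map (vadd y) A) (map (vadd y) l) = avoids A l.
Proof.
  intros Hy HA. induction l as [|z l IH]; intros Hl; [reflexivity|].
  unfold avoids in *. simpl. rewrite IH by (intros; apply Hl; now right). f_equal. f_equal.
  apply Bool.eq_true_iff_eq. rewrite !memb_spec, in_map_iff. split.
  - intros [x [Hx HxA]]. apply (vadd_cancel_l d) in Hx; auto; [now subst|]. apply Hl. now left.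
  - intros Hz. now exists z.
Qed.

Lemma tl_map_eq {A B : Type} (f : A -> B) l : tl (map f l) = map f (tl l).
Proof. now destruct l. Qed.

Lemma Capm_translate d y A m : length y = d -> (forall z, In z A -> length z = d) ->
  Capm d (map (vadd y) A) m = Capm d A m.
Proof.
  intros Hy HA. unfold Capm.
  rewrite (lsum_perm (nodup point_eq_dec (map (vadd y) A)) (map (vadd y) (nodup point_eq_dec A))).
  - rewrite lsum_map. apply lsum_ext_in. intros x Hx. apply nodup_In in Hx. apply HA in Hx.
    rewrite !no_return_by_E. apply E_ext. intros w _. f_equal.
    rewrite path_translate by assumption. rewrite (tl_map_eq (vadd y)). apply (avoids_translate d); auto.
    intros z Hz. apply (path_length_points d x w); [assumption|].
    destruct (path_cons d x w) as [l Hl]. rewrite Hl in *. now right.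
  - apply NoDup_Permutation; [apply NoDup_nodup| |].
    + apply NoDup_map_NoDup_ForallPairs; [|apply NoDup_nodup].
      intros a b Ha Hb. apply nodup_In in Ha. apply nodup_In in Hb.
      apply (vadd_cancel_l d); auto.
    + intros x. rewrite nodup_In, !in_map_iff.
      split; intros [z [Hz HzA]]; exists z; split; auto; now apply nodup_In in HzA || apply nodup_In.
Qed.

Lemma lsum_nodup_incl (A U : list point) f : NoDup U -> incl A U ->
  lsum (nodup point_eq_dec A) f = lsum U (fun x => ind (memb x A) * f x).
Proof.
  intros HU HA. unfold ind. rewrite <- (lsum_filter (fun x => memb x A)). apply lsum_perm.
  apply NoDup_Permutation; [apply NoDup_nodup|now apply NoDup_filter|].
  intros x. rewrite nodup_In, filter_In, memb_spec. split; [auto|tauto].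
Qed.

Lemma lsum_nodup_le (A : list point) f : (forall x, 0 <= f x) ->
  lsum (nodup point_eq_dec A) f <= lsum A f.
Proof.
  intros Hf. induction A as [|a A IH]; [apply Rle_refl|].
  simpl. rewrite lsum_cons. destruct in_dec.
  - pose proof (Hf a). lra.
  - rewrite lsum_cons. lra.
Qed.

Lemma no_return_by_app_l d A B x m : (0 < d)%nat ->
  no_return_by d (A ++ B) x m <= no_return_by d A x m.
Proof.
  intros Hd. rewrite !no_return_by_E. apply E_le; [lia|]. intros w _.
  destruct (avoids (A ++ B) _) eqn:HAB; [|simpl; apply ind_bounds].
  replace (avoids A (tl (path d x w))) with true; [lra|]. symmetry.
  unfold avoids in *. rewrite forallb_forall in *. intros y Hy. specialize (HAB y Hy).
  rewrite Bool.negb_true_iff in *. destruct (memb y A) eqn:Hm; [|reflexivity].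
  apply memb_spec in Hm. rewrite <- HAB. symmetry. apply memb_spec. apply in_or_app. now left.
Qed.

Definition green1 (d m : nat) (z : point) : R := lsum (seq 1 m) (fun t => heat d t z).

Lemma green1_nonneg d m z : (0 < d)%nat -> 0 <= green1 d m z.
Proof. intros Hd. apply lsum_nonneg. intros. now apply heat_nonneg. Qed.

Lemma green_green1 d m z : green d m z = heat d 0 z + green1 d m z.
Proof. reflexivity. Qed.

Lemma eq_vadd_iff d x y z : length x = d -> length y = d -> length z = d ->
  vadd x z = y <-> z = vadd y (vopp x).
Proof.
  intros Hx Hy Hz. split.
  - intros <-. rewrite (vadd_comm x). symmetry. now apply (vadd_vopp_cancel d).
  - intros ->. rewrite vadd_comm, <- vadd_assoc, (vadd_comm (vopp x)), (vadd_vopp_r d),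
      (vadd_origin_r d); auto.
Qed.

Lemma tl_path_eq d x w : length x = d ->
  tl (path d x w) = map (fun k => vadd x (disp d (firstn k w))) (seq 1 (length w)).
Proof. intros Hx. rewrite path_eq by assumption. reflexivity. Qed.

(** Union bound over the points of [B] and the times 1 to [m]. Time 0 is left out because a return
    only counts from time 1 on, hence [green1]. *)
Lemma hit_le_green1 d x B m : (0 < d)%nat -> length x = d -> (forall y, In y B -> length y = d) ->
  E (2 * d) m (fun w => 1 - ind (avoids B (tl (path d x w))))
  <= lsum B (fun y => green1 d m (vadd y (vopp x))).
Proof.
  intros Hd Hx HB.
  apply Rle_trans with (E (2 * d) m (fun w => lsum B (fun y => lsum (seq 1 m) (fun t =>
    if point_eq_dec (disp d (firstn t w)) (vadd y (vopp x)) then 1 else 0)))).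
  - apply E_le; [lia|]. intros w Hw.
    assert (Hnn : 0 <= lsum B (fun y => lsum (seq 1 m) (fun t =>
      if point_eq_dec (disp d (firstn t w)) (vadd y (vopp x)) then 1 else 0))).
    { apply lsum_nonneg. intros y. apply lsum_nonneg. intros t. destruct point_eq_dec; lra. }
    destruct (avoids B (tl (path d x w))) eqn:Hav; simpl; [lra|].
    unfold avoids in Hav. apply Bool.not_true_iff_false in Hav. rewrite forallb_forall in Hav.
    assert (Hex : exists t y, In t (seq 1 m) /\ In y B /\ disp d (firstn t w) = vadd y (vopp x)).
    { apply NNPP. intros Hno. apply Hav. intros z Hz. rewrite Bool.negb_true_iff.
      destruct (memb z B) eqn:Hm; [|reflexivity]. exfalso. apply memb_spec in Hm. apply Hno.
      rewrite tl_path_eq in Hz by assumption. apply in_map_iff in Hz.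
      destruct Hz as [t [Ht Hin]]. rewrite Hw in Hin. exists t, z. repeat split; auto.
      apply (eq_vadd_iff d); auto with len. }
    destruct Hex as [t [y [Ht [Hy Heq]]]]. rewrite Rminus_0_r.
    refine (Rle_trans _ _ _ _ (lsum_single_le B _ y _ Hy)).
    2:{ intros y'. apply lsum_nonneg. intros t'. destruct point_eq_dec; lra. }
    refine (Rle_trans _ _ _ _ (lsum_single_le (seq 1 m) _ t _ Ht)).
    2:{ intros t'. destruct point_eq_dec; lra. }
    destruct point_eq_dec; [lra|contradiction].
  - rewrite E_lsum. apply lsum_le. intros y. rewrite E_lsum. unfold green1.
    right. apply lsum_ext_in. intros t Ht. apply in_seq in Ht. unfold heat.
    apply (E_firstn (2 * d) m t (fun w => if point_eq_dec (disp d w) (vadd y (vopp x)) then 1 else 0));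
      lia.
Qed.

Lemma avoids_app A B l : avoids (A ++ B) l = andb (avoids A l) (avoids B l).
Proof.
  apply Bool.eq_true_iff_eq. rewrite Bool.andb_true_iff. unfold avoids. rewrite !forallb_forall.
  assert (H : forall y, negb (memb y (A ++ B)) = true <->
            negb (memb y A) = true /\ negb (memb y B) = true).
  { intros y. rewrite !Bool.negb_true_iff, <- !Bool.not_true_iff_false, !memb_spec, in_app_iff. tauto. }
  split.
  - intros HAB. split; intros y Hy; apply (H y); auto.
  - intros [HA HB] y Hy. apply H. auto.
Qed.

Lemma no_return_by_app_diff d A B x m : (0 < d)%nat -> length x = d ->
  (forall y, In y B -> length y = d) ->
  no_return_by d A x m - no_return_by d (A ++ B) x m
  <= lsum B (fun y => green1 d m (vadd y (vopp x))).
Proof.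
  intros Hd Hx HB. apply Rle_trans with (2 := hit_le_green1 d x B m Hd Hx HB).
  rewrite !no_return_by_E, <- E_minus. apply E_le; [lia|]. intros w _.
  rewrite avoids_app. destruct (avoids A _), (avoids B _); simpl; lra.
Qed.

(** Enlarging a set lowers each probability of no return, and every point of the union is counted in
    [A] or in [B]. *)
Lemma Capm_app_le d A B m : (0 < d)%nat -> Capm d (A ++ B) m <= Capm d A m + Capm d B m.
Proof.
  intros Hd. set (U := nodup point_eq_dec (A ++ B)). unfold Capm.
  assert (HU : NoDup U) by apply NoDup_nodup.
  assert (HA : incl A U) by (intros x Hx; apply nodup_In, in_or_app; auto).
  assert (HB : incl B U) by (intros x Hx; apply nodup_In, in_or_app; auto).
  rewrite (lsum_nodup_incl A U) by assumption. rewrite (lsum_nodup_incl B U) by assumption.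
  fold U. rewrite <- lsum_plus. apply lsum_le_in. intros x Hx. apply nodup_In in Hx.
  pose proof (no_return_by_app_l d A B x m Hd) as H1.
  pose proof (no_return_by_app_l d B A x m Hd) as H2.
  rewrite (no_return_by_ext d (B ++ A) (A ++ B)) in H2 by (intros; rewrite !in_app_iff; tauto).
  pose proof (no_return_by_bounds d A x m Hd). pose proof (no_return_by_bounds d B x m Hd).
  apply in_app_or in Hx. destruct Hx as [Hx|Hx]; apply memb_spec in Hx; rewrite Hx; simpl;
    match goal with |- context [ind ?b] => pose proof (ind_bounds b) end; nra.
Qed.

Lemma heat_0 d z : heat d 0 z = if point_eq_dec (origin d) z then 1 else 0.
Proof. unfold heat. now rewrite E_0. Qed.

(** Positive times of the Green function pay for the escape probability lost at points of [A] and at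
    points of [B], once each. Points common to both sets are counted twice on the left, and time 0
    pays for them. *)
Lemma Capm_app_ge d A B m : (0 < d)%nat ->
  (forall y, In y A -> length y = d) -> (forall y, In y B -> length y = d) ->
  Capm d A m + Capm d B m - Capm d (A ++ B) m
  <= 2 * lsum A (fun x => lsum B (fun y => green d m (vadd y (vopp x)))).
Proof.
  intros Hd LA LB.
  set (h := fun x => no_return_by d (A ++ B) x m).
  assert (H1 : lsum (nodup point_eq_dec A) (fun x => no_return_by d A x m - h x)
    <= lsum A (fun x => lsum B (fun y => green1 d m (vadd y (vopp x))))).
  { eapply Rle_trans; [|apply lsum_nodup_le].
    - apply lsum_le_in. intros x Hx. apply nodup_In in Hx. apply no_return_by_app_diff; auto.
    - intros x. apply lsum_nonneg. intros. now apply green1_nonneg. }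
  assert (H2 : lsum (nodup point_eq_dec B) (fun x => no_return_by d B x m - h x)
    <= lsum A (fun x => lsum B (fun y => green1 d m (vadd y (vopp x))))).
  { rewrite lsum_swap.
    eapply Rle_trans; [|apply lsum_nodup_le].
    - apply lsum_le_in. intros x Hx. apply nodup_In in Hx. unfold h.
      rewrite (no_return_by_ext d (A ++ B) (B ++ A)) by (intros; rewrite !in_app_iff; tauto).
      eapply Rle_trans; [apply no_return_by_app_diff; auto|].
      right. apply lsum_ext_in. intros y Hy. unfold green1. apply lsum_ext. intros t.
      rewrite <- heat_vopp by assumption. f_equal. rewrite vopp_vadd, vopp_involutive. apply vadd_comm.
    - intros x. apply lsum_nonneg. intros. now apply green1_nonneg. }
  assert (H3 : lsum (nodup point_eq_dec A) (fun x => ind (memb x B) * h x)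
    <= lsum A (fun x => lsum B (fun y => heat d 0 (vadd y (vopp x))))).
  { eapply Rle_trans; [|apply lsum_nodup_le].
    - apply lsum_le_in. intros x Hx. apply nodup_In in Hx.
      pose proof (no_return_by_bounds d (A ++ B) x m Hd) as Hb. fold (h x) in Hb.
      destruct (memb x B) eqn:Hm; simpl.
      + apply memb_spec in Hm.
        refine (Rle_trans _ _ _ _ (lsum_single_le B _ x _ Hm)).
        * rewrite heat_0, (vadd_vopp_r d) by auto. destruct point_eq_dec; [lra|contradiction].
        * intros. now apply heat_nonneg.
      + rewrite Rmult_0_l. apply lsum_nonneg. intros. now apply heat_nonneg.
    - intros x. apply lsum_nonneg. intros. now apply heat_nonneg. }
  assert (H4 : lsum (nodup point_eq_dec A) h + lsum (nodup point_eq_dec B) h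
    <= Capm d (A ++ B) m + lsum (nodup point_eq_dec A) (fun x => ind (memb x B) * h x)).
  { set (U := nodup point_eq_dec (A ++ B)).
    assert (HU : NoDup U) by apply NoDup_nodup.
    assert (HA : incl A U) by (intros x Hx; apply nodup_In, in_or_app; auto).
    assert (HB : incl B U) by (intros x Hx; apply nodup_In, in_or_app; auto).
    rewrite !(lsum_nodup_incl A U) by assumption. rewrite (lsum_nodup_incl B U) by assumption.
    unfold Capm. fold U. rewrite <- !lsum_plus. apply lsum_le_in. intros x Hx.
    pose proof (no_return_by_bounds d (A ++ B) x m Hd) as Hb. fold (h x) in Hb. fold (h x).
    destruct (memb x A), (memb x B); simpl; lra. }
  rewrite lsum_minus in H1, H2. unfold Capm at 1 2.
  rewrite (lsum_ext A (fun x => lsum B (fun y => green d m (vadd y (vopp x))))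
    (fun x => lsum B (fun y => heat d 0 (vadd y (vopp x))) + lsum B (fun y => green1 d m (vadd y (vopp x))))).
  - rewrite lsum_plus.
    assert (0 <= lsum A (fun x => lsum B (fun y => heat d 0 (vadd y (vopp x))))).
    { apply lsum_nonneg. intros. apply lsum_nonneg. intros. now apply heat_nonneg. }
    lra.
  - intros x. now rewrite <- lsum_plus.
Qed.

Lemma Capm_bounds d A m : (0 < d)%nat -> 0 <= Capm d A m <= INR (length A).
Proof.
  intros Hd. unfold Capm. split.
  - apply lsum_nonneg. intros. now apply no_return_by_bounds.
  - apply Rle_trans with (lsum A (fun x => no_return_by d A x m)).
    + apply lsum_nodup_le. intros. now apply no_return_by_bounds.
    + rewrite <- (Rmult_1_r (INR _)), <- lsum_const. apply lsum_le. intros.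
      now apply no_return_by_bounds.
Qed.

Lemma Un_cv_le_const u l c : Un_cv u l -> (forall n, u n <= c) -> l <= c.
Proof.
  intros Hu H. apply Rnot_lt_le. intros Hl. destruct (Hu (l - c)) as [N HN]; [lra|].
  specialize (HN N (le_n N)). unfold Rdist in HN. apply Rabs_def2 in HN. specialize (H N). lra.
Qed.

Lemma Un_cv_ge_const u l c : Un_cv u l -> (forall n, c <= u n) -> c <= l.
Proof.
  intros Hu H. apply Rnot_lt_le. intros Hl. destruct (Hu (c - l)) as [N HN]; [lra|].
  specialize (HN N (le_n N)). unfold Rdist in HN. apply Rabs_def2 in HN. specialize (H N). lra.
Qed.

Lemma cap_range_bounds d w : (0 < d)%nat -> 0 <= cap_range d w <= INR (S (length w)).
Proof.
  intros Hd. unfold cap_range. pose proof (Cap_cv d (path d (origin d) w) Hd) as H. split.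
  - apply (Un_cv_ge_const _ _ _ H). intros. now apply Capm_bounds.
  - apply (Un_cv_le_const _ _ _ H). intros n. rewrite <- (length_path d (origin d)).
    now apply Capm_bounds.
Qed.

(** * Cutting a path in two and the second moment of the defect *)

Lemma lsum_seq_reverse k f : lsum (seq 0 (S k)) f = lsum (seq 0 (S k)) (fun a => f (k - a)%nat).
Proof.
  revert f. induction k as [|k IH]; intros f; [reflexivity|].
  change (seq 0 (S (S k))) with (0%nat :: seq 1 (S k)) at 1.
  rewrite lsum_cons, lsum_seq_shift, IH, (lsum_seq_S 0 (S k)). cbn [Nat.add].
  rewrite Nat.sub_diag, Rplus_comm. f_equal. apply lsum_ext_in. intros a Ha.
  apply in_seq in Ha. f_equal. lia.
Qed.

Definition capm_range (d m : nat) (w : list nat) : R := Capm d (path d (origin d) w) m.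

Lemma path_app_set d u v y :
  In y (path d (origin d) (u ++ v))
  <-> In y (path d (origin d) u ++ path d (disp d u) v).
Proof.
  rewrite path_app by auto with len. rewrite vadd_origin_l by auto with len.
  rewrite !in_app_iff. split.
  - intros [H|H]; [now left|]. right. destruct (path_cons d (disp d u) v) as [l Hl].
    rewrite Hl in *. now right.
  - intros [H|H]; [now left|]. destruct (path_cons d (disp d u) v) as [l Hl].
    rewrite Hl in *. destruct H as [H|H]; [left|now right]. subst y.
    rewrite path_eq by auto with len. apply in_map_iff. exists (length u).
    rewrite firstn_all. split; [apply vadd_origin_l; auto with len|]. apply in_seq. lia.
Qed.

Lemma capm_range_shift d m x w : length x = d -> Capm d (path d x w) m = capm_range d m w.
Proof.
  intros Hx. unfold capm_range. rewrite <- (Capm_translate d x (path d (origin d) w)).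
  - now rewrite <- path_translate, vadd_origin_r by auto with len.
  - assumption.
  - intros z Hz. apply (path_length_points d (origin d) w); auto with len.
Qed.

Lemma capm_range_app_le d m u v : (0 < d)%nat ->
  capm_range d m (u ++ v) <= capm_range d m u + capm_range d m v.
Proof.
  intros Hd. unfold capm_range at 1. rewrite (Capm_ext d _ _ m (path_app_set d u v)).
  eapply Rle_trans; [apply Capm_app_le; assumption|].
  rewrite (capm_range_shift d m (disp d u)) by auto with len. unfold capm_range. lra.
Qed.

Lemma vadd_vopp_skipn d u k :
  vadd (disp d u) (vopp (disp d (firstn k u))) = disp d (skipn k u).
Proof.
  rewrite <- (firstn_skipn k u) at 1. rewrite disp_app, (vadd_comm (disp d (firstn k u))).
  apply (vadd_vopp_cancel d); auto with len.
Qed.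

Definition chim (d m : nat) (u v : list nat) : R :=
  capm_range d m u + capm_range d m v - capm_range d m (u ++ v).

Lemma chim_nonneg d m u v : (0 < d)%nat -> 0 <= chim d m u v.
Proof. intros Hd. unfold chim. pose proof (capm_range_app_le d m u v Hd). lra. Qed.

(** The difference between a point after the cut and a point before it is the displacement of the
    last steps of [u] followed by the first steps of [v]. Reading [u] backwards makes both pieces
    walks from the cut, and both displacements enter with a plus sign. *)
Lemma chim_le d m u v : (0 < d)%nat ->
  chim d m u v <= 2 * mutual_green d m (length u) (length v) (rev u) v.
Proof.
  intros Hd. unfold chim. unfold capm_range at 3. rewrite (Capm_ext d _ _ m (path_app_set d u v)).
  rewrite <- (capm_range_shift d m (disp d u) v) by auto with len. unfold capm_range.
  eapply Rle_trans; [apply Capm_app_ge; [assumption|..]|].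
  - intros y. apply path_length_points. auto with len.
  - intros y. apply path_length_points. auto with len.
  - right. f_equal. rewrite !path_eq by auto with len. rewrite lsum_map, lsum_seq_reverse.
    apply lsum_ext_in. intros a Ha. apply in_seq in Ha. rewrite lsum_map. apply lsum_ext.
    intros b. f_equal. rewrite vadd_origin_l by auto with len.
    rewrite <- vadd_assoc, (vadd_comm (disp d (firstn b v))), vadd_assoc.
    rewrite vadd_vopp_skipn, firstn_rev. now rewrite disp_rev.
Qed.

Definition chi (d : nat) (u v : list nat) : R :=
  cap_range d u + cap_range d v - cap_range d (u ++ v).

Lemma chi_cv d u v : (0 < d)%nat -> Un_cv (fun m => chim d m u v) (chi d u v).
Proof.
  intros Hd. unfold chi, chim.
  apply (CV_minus (fun m => capm_range d m u + capm_range d m v) (fun m => capm_range d m (u ++ v))).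
  - apply (CV_plus (fun m => capm_range d m u) (fun m => capm_range d m v)); now apply Cap_cv.
  - now apply Cap_cv.
Qed.

(** The bound at horizon [m] does not depend on [m] and survives the limit. The constant is
    [4 * 4096], with 4 the square of the 2 in [chim_le]. *)
Lemma chi_second_moment d k l : (6 <= d)%nat ->
  E (2 * d) k (fun u => E (2 * d) l (fun v => chi d u v ^ 2))
  <= 16384 * cgreen d ^ 2 * sqrt (INR (k + l + 1)).
Proof.
  intros Hd. assert (Hd0 : (0 < d)%nat) by lia.
  apply (Un_cv_le_const (fun m => E (2 * d) k (fun u => E (2 * d) l (fun v => chim d m u v ^ 2)))).
  - apply (E_Un_cv _ _ (fun m u => E (2 * d) l (fun v => chim d m u v ^ 2))).
    intros u _. apply (E_Un_cv _ _ (fun m v => chim d m u v ^ 2)).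
    intros v _. pose proof (chi_cv d u v Hd0) as H.
    pose proof (CV_mult _ _ _ _ H H) as H2. rewrite <- Rsqr_pow2. intros e He.
    destruct (H2 e He) as [n0 Hn0]. exists n0. intros n Hn. rewrite <- Rsqr_pow2. now apply Hn0.
  - intros m.
    apply Rle_trans with (E (2 * d) k (fun u => E (2 * d) l (fun v =>
      4 * mutual_green d m k l (rev u) v ^ 2))).
    + apply E_le; [lia|]. intros u Hu. apply E_le; [lia|]. intros v Hv.
      pose proof (chim_le d m u v Hd0) as H1. pose proof (chim_nonneg d m u v Hd0) as H2.
      rewrite Hu, Hv in H1. set (S0 := mutual_green _ _ _ _ _ _) in *.
      replace (4 * S0 ^ 2) with ((2 * S0) ^ 2) by ring. apply pow_incr. lra.
    + rewrite (E_rev (2 * d) k (fun u => E (2 * d) l (fun v => 4 * mutual_green d m k l u v ^ 2)))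
        by lia.
      rewrite (E_ext _ _ _ (fun u => 4 * E (2 * d) l (fun v => mutual_green d m k l u v ^ 2)))
        by (intros; now rewrite E_scal).
      rewrite E_scal. pose proof (mutual_green_second_moment d m Hd k l). lra.
Qed.

(** * Nearly additive variances *)

Definition norm2 (K n : nat) (F : list nat -> R) : R := sqrt (E K n (fun w => F w ^ 2)).

Lemma E_sq_nonneg K n F : (0 < K)%nat -> 0 <= E K n (fun w => F w ^ 2).
Proof. intros HK. apply E_nonneg; [assumption|]. intros. apply pow2_ge_0. Qed.

Lemma norm2_pos K n F : 0 <= norm2 K n F.
Proof. apply sqrt_pos. Qed.

Lemma norm2_sq K n F : (0 < K)%nat -> norm2 K n F ^ 2 = E K n (fun w => F w ^ 2).
Proof. intros HK. apply pow2_sqrt. now apply E_sq_nonneg. Qed.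

Lemma norm2_ext K n F G : (forall w, length w = n -> F w = G w) -> norm2 K n F = norm2 K n G.
Proof. intros H. unfold norm2. f_equal. apply E_ext. intros w Hw. now rewrite H. Qed.

Lemma norm2_triangle K n F G : (0 < K)%nat ->
  norm2 K n (fun w => F w + G w) <= norm2 K n F + norm2 K n G.
Proof. intros HK. now apply E_minkowski. Qed.

Lemma norm2_opp K n F : norm2 K n (fun w => - F w) = norm2 K n F.
Proof. unfold norm2. f_equal. apply E_ext. intros. ring. Qed.

Lemma norm2_minus_abs K n F G : (0 < K)%nat ->
  Rabs (norm2 K n F - norm2 K n G) <= norm2 K n (fun w => F w - G w).
Proof.
  intros HK.
  pose proof (norm2_triangle K n (fun w => F w - G w) G HK) as H1.
  pose proof (norm2_triangle K n (fun w => - (F w - G w)) F HK) as H2.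
  rewrite norm2_opp in H2.
  rewrite (norm2_ext K n _ F) in H1 by (intros; ring).
  rewrite (norm2_ext K n _ G) in H2 by (intros; ring).
  apply Rabs_le. lra.
Qed.

Lemma E_split K n k F : (0 < K)%nat -> (k <= n)%nat ->
  E K n (fun w => F (firstn k w) (skipn k w)) = E K k (fun u => E K (n - k) (fun v => F u v)).
Proof.
  intros HK Hk. replace n with (k + (n - k))%nat at 1 by lia. rewrite E_app by assumption.
  apply E_ext. intros u Hu. apply E_ext. intros v _.
  rewrite firstn_app, skipn_app, Hu, Nat.sub_diag. rewrite firstn_O, app_nil_r.
  rewrite firstn_all2, skipn_all2 by lia. reflexivity.
Qed.

(** Independence factors the cross term, which vanishes with the mean of [F]. *)
Lemma E_sum_sq K k l F G : (0 < K)%nat -> E K k F = 0 ->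
  E K k (fun u => E K l (fun v => (F u + G v) ^ 2))
  = E K k (fun u => F u ^ 2) + E K l (fun v => G v ^ 2).
Proof.
  intros HK HF.
  rewrite (E_ext K k _ (fun u => F u ^ 2 + (F u * (2 * E K l G) + E K l (fun v => G v ^ 2)))).
  - rewrite !E_plus, E_scal_r, HF, E_const by assumption. ring.
  - intros u _. rewrite (E_ext K l _ (fun v => F u ^ 2 + (2 * F u * G v + G v ^ 2))) by (intros; ring).
    rewrite !E_plus, E_scal, E_const by assumption. ring.
Qed.

Definition root4 (x : R) : R := sqrt (sqrt x).

Lemma root4_sq x : root4 x ^ 2 = sqrt x.
Proof. unfold root4. apply pow2_sqrt, sqrt_pos. Qed.

Lemma root4_le x y : x <= y -> root4 x <= root4 y.
Proof. intros H. unfold root4. now repeat apply sqrt_le_1_alt. Qed.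

Lemma root4_pos x : 0 < x -> 0 < root4 x.
Proof. intros H. unfold root4. now repeat apply sqrt_lt_R0. Qed.

Lemma root4_mult x y : 0 <= x -> 0 <= y -> root4 (x * y) = root4 x * root4 y.
Proof.
  intros Hx Hy. unfold root4. rewrite sqrt_mult by assumption.
  now rewrite sqrt_mult by apply sqrt_pos.
Qed.

Lemma root4_1 : root4 1 = 1.
Proof. unfold root4. now rewrite !sqrt_1. Qed.

Lemma root4_2_gt_1 : 1 < root4 2.
Proof.
  rewrite <- root4_1. unfold root4. apply sqrt_lt_1_alt. split; [apply sqrt_pos|].
  apply sqrt_lt_1_alt. lra.
Qed.

Lemma root4_unbounded M : exists N, forall n, (N <= n)%nat -> M <= root4 (INR n).
Proof.
  destruct (INR_unbounded (Rmax M 0 ^ 4)) as [N HN]. exists N. intros n Hn.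
  apply Rle_trans with (Rmax M 0); [apply Rmax_l|].
  replace (Rmax M 0) with (root4 (Rmax M 0 ^ 4)).
  - apply root4_le. apply le_INR in Hn. lra.
  - pose proof (Rmax_r M 0). unfold root4.
    replace (Rmax M 0 ^ 4) with ((Rmax M 0 ^ 2) ^ 2) by ring.
    rewrite !sqrt_pow2; try apply pow2_ge_0; auto.
Qed.

(** The Euclidean norm of a pair is 1-Lipschitz in its first entry. *)
Lemma sqrt_add_sq_lipschitz a b c : 0 <= a -> 0 <= b ->
  Rabs (sqrt (a ^ 2 + c ^ 2) - sqrt (b ^ 2 + c ^ 2)) <= Rabs (a - b).
Proof.
  intros Ha Hb.
  assert (W : forall x y, 0 <= x -> 0 <= y -> sqrt (x ^ 2 + c ^ 2) <= sqrt (y ^ 2 + c ^ 2) + Rabs (x - y)).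
  { intros x y Hx Hy. pose proof (sqrt_pos (y ^ 2 + c ^ 2)) as Hs. pose proof (Rabs_pos (x - y)) as Hr.
    rewrite <- (sqrt_pow2 (sqrt (y ^ 2 + c ^ 2) + Rabs (x - y))) by lra.
    apply sqrt_le_1_alt.
    assert (H1 : sqrt (y ^ 2 + c ^ 2) ^ 2 = y ^ 2 + c ^ 2) by (apply pow2_sqrt; nra).
    assert (H2 : y <= sqrt (y ^ 2 + c ^ 2)).
    { rewrite <- (sqrt_pow2 y) at 1 by assumption. apply sqrt_le_1_alt. nra. }
    assert (H3 : Rabs (x - y) ^ 2 = (x - y) ^ 2) by (rewrite <- !Rsqr_pow2; symmetry; apply Rsqr_abs).
    pose proof (Rle_abs (x - y)). nra. }
  pose proof (W a b Ha Hb). pose proof (W b a Hb Ha) as H2. rewrite (Rabs_minus_sym b a) in H2.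
  apply Rabs_le. lra.
Qed.

Section NearlyAdditive.
Variable s : nat -> R.
Variable C : R.
Hypothesis s_pos : forall n, 0 <= s n.
Hypothesis s_add : forall k l, (1 <= k + l)%nat ->
  Rabs (s (k + l)%nat - sqrt (s k ^ 2 + s l ^ 2)) <= C * root4 (INR (k + l)).

Let theta := root4 2.
Let u n := s n / sqrt (INR n).

Let INR1 n : (1 <= n)%nat -> 1 <= INR n.
Proof. intros H. now apply (le_INR 1). Qed.

Let C_nonneg : 0 <= C.
Proof.
  pose proof (s_add 1 0 (le_n 1)) as H. rewrite Nat.add_0_r in H.
  pose proof (Rabs_pos (s 1 - sqrt (s 1 ^ 2 + s 0 ^ 2))).
  change (INR 1) with 1 in H. rewrite root4_1 in H. lra.
Qed.

Let sqrt_root4 x : 0 < x -> root4 x / sqrt x = / root4 x.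
Proof.
  intros Hx. pose proof (root4_pos x Hx). rewrite <- root4_sq. field. lra.
Qed.

(** Adding blocks of length [n] one at a time. The error is linear in [N], which is harmless since
    [N] will stay fixed while [n] grows. *)
Lemma nearly_additive_mult N n : (1 <= N)%nat -> (1 <= n)%nat ->
  Rabs (s (N * n)%nat - sqrt (INR N) * s n) <= INR N * C * root4 (INR (N * n)).
Proof.
  intros HN Hn. pose proof C_nonneg as HC. induction N as [|N IH]; [lia|].
  destruct (Nat.eq_dec N 0) as [->|HN0].
  - rewrite Nat.mul_1_l. change (INR 1) with 1. rewrite sqrt_1.
    replace (s n - 1 * s n) with 0 by ring. rewrite Rabs_R0.
    assert (0 <= root4 (INR n)) by apply sqrt_pos. nra.
  - specialize (IH ltac:(lia)).
    replace (S N * n)%nat with (N * n + n)%nat by lia.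
    pose proof (s_add (N * n) n ltac:(lia)) as H1.
    pose proof (sqrt_add_sq_lipschitz (s (N * n)%nat) (sqrt (INR N) * s n) (s n) (s_pos _)
      (Rmult_le_pos _ _ (sqrt_pos _) (s_pos n))) as H2.
    replace (sqrt ((sqrt (INR N) * s n) ^ 2 + s n ^ 2)) with (sqrt (INR (S N)) * s n) in H2.
    + assert (H3 : root4 (INR (N * n)) <= root4 (INR (N * n + n))) by (apply root4_le, le_INR; lia).
      rewrite S_INR in *. pose proof (pos_INR N).
      replace (s (N * n + n)%nat - sqrt (INR N + 1) * s n)
        with ((s (N * n + n)%nat - sqrt (s (N * n)%nat ^ 2 + s n ^ 2))
              + (sqrt (s (N * n)%nat ^ 2 + s n ^ 2) - sqrt (INR N + 1) * s n)) by ring.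
      eapply Rle_trans; [apply Rabs_triang|].
      assert (INR N * C * root4 (INR (N * n)) <= INR N * C * root4 (INR (N * n + n)))
        by (apply Rmult_le_compat_l; nra). lra.
    + rewrite Rpow_mult_distr, pow2_sqrt by apply pos_INR.
      replace (INR N * s n ^ 2 + s n ^ 2) with (INR (S N) * s n ^ 2) by (rewrite S_INR; ring).
      rewrite sqrt_mult; [|apply pos_INR|apply pow2_ge_0]. now rewrite sqrt_pow2.
Qed.

Lemma ratio_mult N n : (1 <= N)%nat -> (1 <= n)%nat ->
  Rabs (u (N * n)%nat - u n) <= INR N * C / root4 (INR (N * n)).
Proof.
  intros HN Hn. pose proof (nearly_additive_mult N n HN Hn) as H. unfold u.
  rewrite mult_INR in *. pose proof (INR1 N HN). pose proof (INR1 n Hn).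
  set (x := INR N * INR n) in *. assert (Hx : 0 < x) by (unfold x; nra).
  assert (Hs : 0 < sqrt x) by now apply sqrt_lt_R0.
  replace (s (N * n)%nat / sqrt x - s n / sqrt (INR n))
    with ((s (N * n)%nat - sqrt (INR N) * s n) * / sqrt x).
  - rewrite Rabs_mult, (Rabs_pos_eq (/ sqrt x)) by (left; now apply Rinv_0_lt_compat).
    unfold Rdiv. rewrite <- sqrt_root4 by assumption. unfold Rdiv. rewrite <- Rmult_assoc.
    apply Rmult_le_compat_r; [left; now apply Rinv_0_lt_compat|exact H].
  - unfold x in *. rewrite sqrt_mult in * by lra.
    assert (0 < sqrt (INR N)) by (apply sqrt_lt_R0; lra).
    assert (0 < sqrt (INR n)) by (apply sqrt_lt_R0; lra). field. lra.
Qed.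

Lemma ratio_double n : (1 <= n)%nat -> Rabs (u (2 * n)%nat - u n) <= C / root4 (INR (2 * n)).
Proof.
  intros Hn. pose proof (s_add n n ltac:(lia)) as H. replace (n + n)%nat with (2 * n)%nat in H by lia.
  replace (sqrt (s n ^ 2 + s n ^ 2)) with (sqrt 2 * s n) in H.
  - unfold u. pose proof (INR1 n Hn). rewrite mult_INR in *. change (INR 2) with 2 in *.
    set (x := 2 * INR n) in *. assert (Hx : 0 < x) by (unfold x; lra).
    assert (Hs : 0 < sqrt x) by now apply sqrt_lt_R0.
    replace (s (2 * n)%nat / sqrt x - s n / sqrt (INR n))
      with ((s (2 * n)%nat - sqrt 2 * s n) * / sqrt x).
    + rewrite Rabs_mult, (Rabs_pos_eq (/ sqrt x)) by (left; now apply Rinv_0_lt_compat).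
      unfold Rdiv. rewrite <- sqrt_root4 by assumption. unfold Rdiv. rewrite <- Rmult_assoc.
      apply Rmult_le_compat_r; [left; now apply Rinv_0_lt_compat|exact H].
    + unfold x in *. rewrite sqrt_mult in * by lra.
      assert (0 < sqrt 2) by (apply sqrt_lt_R0; lra).
      assert (0 < sqrt (INR n)) by (apply sqrt_lt_R0; lra). field. lra.
  - replace (s n ^ 2 + s n ^ 2) with (2 * s n ^ 2) by ring.
    rewrite sqrt_mult; [|lra|apply pow2_ge_0]. now rewrite sqrt_pow2.
Qed.

(** The sum of the geometric series [C / theta^j] over [j >= 1], the errors of successive
    doublings. *)
Let C1 := C / (theta - 1).

Let C1_nonneg : 0 <= C1.
Proof.
  pose proof root4_2_gt_1. pose proof C_nonneg. unfold C1, theta.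
  apply Rmult_le_pos; [assumption|]. left. apply Rinv_0_lt_compat. lra.
Qed.

Lemma root4_pow2_mult j n : root4 (INR (2 ^ j * n)) = theta ^ j * root4 (INR n).
Proof.
  induction j as [|j IH].
  - rewrite Nat.mul_1_l. simpl. ring.
  - replace (2 ^ S j * n)%nat with (2 * (2 ^ j * n))%nat by (simpl; lia).
    rewrite mult_INR, root4_mult by (apply pos_INR). rewrite IH.
    change (INR 2) with 2. unfold theta. simpl pow. ring.
Qed.

Lemma ratio_pow2 j n : (1 <= n)%nat ->
  Rabs (u (2 ^ j * n)%nat - u n) <= C1 / root4 (INR n) * (1 - / theta ^ j).
Proof.
  intros Hn. pose proof root4_2_gt_1 as Ht. fold theta in Ht.
  pose proof (INR1 n Hn). assert (Hr : 0 < root4 (INR n)) by (apply root4_pos; lra).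
  induction j as [|j IH].
  - rewrite Nat.mul_1_l, Rminus_diag, Rabs_R0. simpl. rewrite Rinv_1. lra.
  - replace (2 ^ S j * n)%nat with (2 * (2 ^ j * n))%nat by (simpl; lia).
    assert (Hpos : (1 <= 2 ^ j * n)%nat).
    { assert (2 ^ j <> 0)%nat by (apply Nat.pow_nonzero; lia). nia. }
    pose proof (ratio_double _ Hpos) as H1.
    replace (2 * (2 ^ j * n))%nat with (2 ^ S j * n)%nat in * by (simpl; lia).
    rewrite root4_pow2_mult in H1.
    assert (Htj : 0 < theta ^ j) by (apply pow_lt; lra).
    replace (u (2 ^ S j * n)%nat - u n)
      with ((u (2 ^ S j * n)%nat - u (2 ^ j * n)%nat) + (u (2 ^ j * n)%nat - u n)) by ring.
    eapply Rle_trans; [apply Rabs_triang|].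
    replace (C1 / root4 (INR n) * (1 - / theta ^ S j))
      with (C / (theta ^ S j * root4 (INR n)) + C1 / root4 (INR n) * (1 - / theta ^ j)); [lra|].
    unfold C1. simpl. field. repeat split; lra.
Qed.

(** The ratios at [n] and [m] are compared through the common multiple [2^j m n]. The doublings cost
    at most the two terms on the right, whatever [j] is. The multiplications by [m] and by [n] come
    after the doublings, and their cost vanishes as [j] grows. *)
Lemma ratio_diff n m : (1 <= n)%nat -> (1 <= m)%nat ->
  Rabs (u n - u m) <= C1 / root4 (INR n) + C1 / root4 (INR m).
Proof.
  intros Hn Hm. pose proof root4_2_gt_1 as Ht. fold theta in Ht.
  pose proof (INR1 n Hn). assert (Hrn : 0 < root4 (INR n)) by (apply root4_pos; lra).
  pose proof (INR1 m Hm). assert (Hrm : 0 < root4 (INR m)) by (apply root4_pos; lra).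
  pose proof C_nonneg as HC. pose proof C1_nonneg as HC1.
  apply le_epsilon. intros e He.
  (* The two multiplication errors together are at most [c / theta^j]; [j] is chosen to bring this
     below [e]. *)
  set (c := INR m * C / root4 (INR n) + INR n * C / root4 (INR m) + 1).
  assert (Hc : 0 < c).
  { unfold c. assert (0 <= INR m * C / root4 (INR n)) by
      (apply Rdiv_le_0_compat; nra).
    assert (0 <= INR n * C / root4 (INR m)) by
      (apply Rdiv_le_0_compat; nra). lra. }
  assert (Hinv : Rabs (/ theta) < 1).
  { rewrite Rabs_pos_eq by (left; apply Rinv_0_lt_compat; lra).
    rewrite <- Rinv_1. apply Rinv_lt_contravar; lra. }
  destruct (pow_lt_1_zero (/ theta) Hinv (e / c)) as [j Hj]; [now apply Rdiv_lt_0_compat|].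
  specialize (Hj j (le_n j)). rewrite pow_inv in Hj.
  assert (Htj : 0 < theta ^ j) by (apply pow_lt; lra).
  rewrite Rabs_pos_eq in Hj by (left; now apply Rinv_0_lt_compat).
  assert (Hj' : c * / theta ^ j <= e).
  { apply Rmult_lt_compat_l with (r := c) in Hj; [|assumption].
    replace (c * (e / c)) with e in Hj by (field; lra). lra. }
  assert (P2 : (1 <= 2 ^ j)%nat) by (assert (2 ^ j <> 0)%nat by (apply Nat.pow_nonzero; lia); lia).
  pose proof (ratio_pow2 j n Hn) as A1. pose proof (ratio_pow2 j m Hm) as A2.
  pose proof (ratio_mult m (2 ^ j * n) Hm ltac:(nia)) as A3.
  pose proof (ratio_mult n (2 ^ j * m) Hn ltac:(nia)) as A4.
  replace (n * (2 ^ j * m))%nat with (m * (2 ^ j * n))%nat in A4 by lia.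
  assert (B3 : INR m * C / root4 (INR (m * (2 ^ j * n))) <= INR m * C / root4 (INR n) * / theta ^ j).
  { replace (INR m * C / root4 (INR n) * / theta ^ j) with (INR m * C * / root4 (INR (2 ^ j * n)))
      by (rewrite root4_pow2_mult; field; lra).
    apply Rmult_le_compat_l; [nra|]. apply Rinv_le_contravar.
    - rewrite root4_pow2_mult. nra.
    - apply root4_le, le_INR. nia. }
  assert (B4 : INR n * C / root4 (INR (m * (2 ^ j * n))) <= INR n * C / root4 (INR m) * / theta ^ j).
  { replace (INR n * C / root4 (INR m) * / theta ^ j) with (INR n * C * / root4 (INR (2 ^ j * m)))
      by (rewrite root4_pow2_mult; field; lra).
    apply Rmult_le_compat_l; [nra|]. apply Rinv_le_contravar.
    - rewrite root4_pow2_mult. nra.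
    - apply root4_le, le_INR. nia. }
  assert (D1 : C1 / root4 (INR n) * (1 - / theta ^ j) <= C1 / root4 (INR n)).
  { assert (0 <= C1 / root4 (INR n)) by (apply Rdiv_le_0_compat; lra).
    pose proof (Rinv_0_lt_compat _ Htj). nra. }
  assert (D2 : C1 / root4 (INR m) * (1 - / theta ^ j) <= C1 / root4 (INR m)).
  { assert (0 <= C1 / root4 (INR m)) by (apply Rdiv_le_0_compat; lra).
    pose proof (Rinv_0_lt_compat _ Htj). nra. }
  pose proof (Rinv_0_lt_compat _ Htj) as Hti.
  assert (Hce : INR m * C / root4 (INR n) * / theta ^ j + INR n * C / root4 (INR m) * / theta ^ j <= e).
  { unfold c in Hj'. lra. }
  set (un := u n) in *. set (um := u m) in *. set (u1 := u (2 ^ j * n)%nat) in *.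
  set (u2 := u (2 ^ j * m)%nat) in *. set (u3 := u (m * (2 ^ j * n))%nat) in *.
  apply Rabs_le_bounds in A1, A2, A3, A4. apply Rabs_le. lra.
Qed.

Lemma nearly_additive_limit :
  exists sigma, 0 <= sigma /\
    forall n, (1 <= n)%nat -> Rabs (s n / sqrt (INR n) - sigma) <= C1 / root4 (INR n).
Proof.
  pose proof C1_nonneg as HC1.
  assert (Hsmall : forall e, 0 < e -> exists N, (1 <= N)%nat /\
    forall n, (N <= n)%nat -> C1 / root4 (INR n) < e).
  { intros e He. destruct (root4_unbounded (C1 / e + 1)) as [N HN].
    exists (Nat.max 1 N). split; [lia|]. intros n Hn. specialize (HN n ltac:(lia)).
    assert (0 <= C1 / e) by (apply Rdiv_le_0_compat; lra).
    apply Rmult_lt_reg_r with (root4 (INR n)); [lra|].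
    unfold Rdiv. rewrite Rmult_assoc, Rinv_l by lra.
    apply Rlt_le_trans with (e * (C1 / e + 1)); [|apply Rmult_le_compat_l; lra].
    replace (e * (C1 / e + 1)) with (C1 + e) by (field; lra). lra. }
  destruct (Rcomplete.R_complete u) as [sigma Hs].
  - intros e He. destruct (Hsmall (e / 2)) as [N [HN1 HN]]; [lra|]. exists N.
    intros n m Hn Hm. unfold Rdist. pose proof (ratio_diff n m ltac:(lia) ltac:(lia)).
    pose proof (HN n Hn). pose proof (HN m Hm). lra.
  - exists sigma. split.
    + apply (Un_cv_ge_const (fun n => u n) sigma 0 Hs). intros n. unfold u.
      destruct (Rle_lt_or_eq_dec 0 (sqrt (INR n)) (sqrt_pos _)) as [H|H].
      * apply Rmult_le_pos; [apply s_pos|]. left. now apply Rinv_0_lt_compat.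
      * rewrite <- H. unfold Rdiv. rewrite Rinv_0, Rmult_0_r. lra.
    + intros n Hn. fold (u n). apply le_epsilon. intros e He.
      destruct (Hsmall (e / 2)) as [N [HN1 HN]]; [lra|].
      destruct (Hs (e / 2)) as [N' HN']; [lra|].
      pose proof (HN' (Nat.max N N') ltac:(lia)) as H1. pose proof (HN (Nat.max N N') ltac:(lia)) as H2.
      pose proof (ratio_diff n (Nat.max N N') Hn ltac:(lia)) as H3. unfold Rdist in H1.
      replace (u n - sigma) with ((u n - u (Nat.max N N')) + (u (Nat.max N N') - sigma)) by ring.
      eapply Rle_trans; [apply Rabs_triang|]. lra.
Qed.

End NearlyAdditive.

(** * Variance of the capacity and the dyadic decomposition *)

Definition centered (d : nat) (w : list nat) : R := cap_range d w - mean_cap_range d (length w).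

Lemma mean_cap_range_E d n : mean_cap_range d n = E (2 * d) n (cap_range d).
Proof. reflexivity. Qed.

Lemma mean_cap_range_bounds d n : (0 < d)%nat -> 0 <= mean_cap_range d n <= INR (S n).
Proof.
  intros Hd. rewrite mean_cap_range_E. split.
  - apply E_nonneg; [lia|]. intros. now apply cap_range_bounds.
  - rewrite <- (E_const (2 * d) n (INR (S n))) by lia. apply E_le; [lia|]. intros w <-.
    now apply cap_range_bounds.
Qed.

Lemma centered_bound d w : (0 < d)%nat -> Rabs (centered d w) <= INR (S (length w)).
Proof.
  intros Hd. unfold centered. pose proof (cap_range_bounds d w Hd).
  pose proof (mean_cap_range_bounds d (length w) Hd). apply Rabs_le. lra.
Qed.

Lemma E_centered d n : (0 < d)%nat -> E (2 * d) n (centered d) = 0.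
Proof.
  intros Hd. rewrite (E_ext _ _ _ (fun w => cap_range d w - mean_cap_range d n))
    by (intros w <-; reflexivity).
  rewrite E_minus, E_const, mean_cap_range_E by lia. ring.
Qed.

Definition chi_mean (d k l : nat) : R :=
  mean_cap_range d k + mean_cap_range d l - mean_cap_range d (k + l).

Lemma E_chi d k l : (0 < d)%nat ->
  E (2 * d) k (fun u => E (2 * d) l (fun v => chi d u v)) = chi_mean d k l.
Proof.
  intros Hd. unfold chi_mean. rewrite !mean_cap_range_E, E_app by lia.
  rewrite (E_ext _ _ (fun u => E (2 * d) l (fun v => chi d u v))
    (fun u => cap_range d u + E (2 * d) l (cap_range d) - E (2 * d) l (fun v => cap_range d (u ++ v)))).
  - rewrite E_minus, E_plus, E_const by lia. reflexivity.
  - intros u _. unfold chi. rewrite E_minus, E_plus, E_const by lia. reflexivity.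
Qed.

Lemma centered_app d u v :
  centered d (u ++ v)
  = centered d u + centered d v - (chi d u v - chi_mean d (length u) (length v)).
Proof. unfold centered, chi, chi_mean. rewrite length_app. ring. Qed.

(** [182^2] exceeds [2 * 16384]; the 2 absorbs the passage from [n + 1] to [n] under the square
    root. *)
Definition cchi (d : nat) : R := 182 * cgreen d.

(** A variance is at most the second moment. *)
Lemma chi_norm d n k : (6 <= d)%nat -> (1 <= n)%nat -> (k <= n)%nat ->
  norm2 (2 * d) n (fun w => chi d (firstn k w) (skipn k w) - chi_mean d k (n - k))
  <= cchi d * root4 (INR n).
Proof.
  intros Hd Hn Hk. pose proof (cgreen_pos d Hd) as Hg. unfold norm2.
  assert (Hn1 : 1 <= INR n) by now apply (le_INR 1).
  assert (Hr : 0 < root4 (INR n)) by (apply root4_pos; lra).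
  rewrite <- (sqrt_pow2 (cchi d * root4 (INR n))) by (unfold cchi; nra).
  apply sqrt_le_1_alt.
  rewrite (E_split (2 * d) n k (fun u v => (chi d u v - chi_mean d k (n - k)) ^ 2)) by lia.
  set (c := chi_mean d k (n - k)).
  rewrite (E_ext _ _ _ (fun u => E (2 * d) (n - k) (fun v => chi d u v ^ 2)
     + (-2 * c * E (2 * d) (n - k) (fun v => chi d u v) + c ^ 2))).
  - rewrite !E_plus, E_scal, E_const, E_chi by lia. fold c.
    pose proof (chi_second_moment d k (n - k) Hd) as H. replace (k + (n - k) + 1)%nat with (S n) in H by lia.
    rewrite Rpow_mult_distr, root4_sq. unfold cchi.
    assert (Hs : sqrt (INR (S n)) <= 2 * sqrt (INR n)).
    { replace 2 with (sqrt 4) by (rewrite <- (sqrt_pow2 2) by lra; f_equal; ring).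
      rewrite <- sqrt_mult by lra. apply sqrt_le_1_alt. rewrite S_INR. lra. }
    pose proof (pow2_ge_0 c). pose proof (sqrt_pos (INR n)).
    assert (0 <= cgreen d ^ 2) by apply pow2_ge_0. nra.
  - intros u _. rewrite (E_ext _ _ _ (fun v => chi d u v ^ 2 + (-2 * c * chi d u v + c ^ 2)))
      by (intros; ring).
    now rewrite !E_plus, E_scal, E_const by lia.
Qed.

Definition sd (d n : nat) : R := norm2 (2 * d) n (centered d).

(** The sum of the centred capacities of the two pieces has exactly the norm under the square root,
    by independence. It differs from the centred capacity of the whole path by the centred
    defect. *)
Lemma sd_nearly_additive d k l : (6 <= d)%nat -> (1 <= k + l)%nat ->
  Rabs (sd d (k + l) - sqrt (sd d k ^ 2 + sd d l ^ 2)) <= cchi d * root4 (INR (k + l)).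
Proof.
  intros Hd Hn. set (n := (k + l)%nat) in *.
  set (A := fun w => centered d (firstn k w) + centered d (skipn k w)).
  replace (sqrt (sd d k ^ 2 + sd d l ^ 2)) with (norm2 (2 * d) n A).
  - eapply Rle_trans; [apply norm2_minus_abs; lia|].
    apply Rle_trans with (2 := chi_norm d n k Hd Hn ltac:(unfold n; lia)).
    rewrite <- (norm2_opp _ _ (fun w => chi d _ _ - _)). right. apply norm2_ext. intros w Hw.
    rewrite <- (firstn_skipn k w) at 1. rewrite centered_app. unfold A.
    rewrite length_firstn, length_skipn, Hw. rewrite Nat.min_l by (unfold n; lia). ring.
  - unfold norm2, A.
    rewrite (E_split (2 * d) n k (fun u v => (centered d u + centered d v) ^ 2)) by (unfold n; lia).
    replace (n - k)%nat with l by (unfold n; lia).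
    rewrite E_sum_sq by (lia || now apply E_centered; lia). unfold sd.
    now rewrite !norm2_sq by lia.
Qed.

(** The sum of the centred capacities of the [2^L] pieces left after [L] halvings, which are
    independent. The binary recursion lets every statement about it be proved by splitting a word
    once. *)
Fixpoint tree (d L : nat) (w : list nat) : R :=
  match L with
  | O => centered d w
  | S L' => tree d L' (firstn (length w / 2) w) + tree d L' (skipn (length w / 2) w)
  end.

Fixpoint tree_var (d L n : nat) : R :=
  match L with
  | O => sd d n ^ 2
  | S L' => tree_var d L' (n / 2) + tree_var d L' (n - n / 2)
  end.

Lemma half_le n : (n / 2 <= n)%nat.
Proof. apply Nat.Div0.div_le_upper_bound; lia. Qed.

Lemma half_bounds n : (2 * (n / 2) <= n <= 2 * (n / 2) + 1)%nat.
Proof. pose proof (Nat.div_mod_eq n 2). pose proof (Nat.mod_upper_bound n 2). lia. Qed.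

Lemma E_tree_S d L n (F : R -> R) : (0 < d)%nat ->
  E (2 * d) n (fun w => F (tree d (S L) w))
  = E (2 * d) (n / 2) (fun u => E (2 * d) (n - n / 2) (fun v => F (tree d L u + tree d L v))).
Proof.
  intros Hd. rewrite <- (E_split (2 * d) n (n / 2) (fun u v => F (tree d L u + tree d L v)))
    by (lia || apply half_le).
  apply E_ext. intros w Hw. cbn [tree]. now rewrite Hw.
Qed.

Lemma E_tree d L n : (0 < d)%nat -> E (2 * d) n (tree d L) = 0.
Proof.
  intros Hd. revert n. induction L as [|L IH]; intros n.
  - now apply E_centered.
  - eapply eq_trans; [exact (E_tree_S d L n (fun x => x) Hd)|]. cbv beta.
    rewrite (E_ext _ _ _ (tree d L)); [apply IH|]. intros u _.
    rewrite E_plus, E_const, IH by lia. ring.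
Qed.

Lemma E_tree_sq d L n : (0 < d)%nat -> E (2 * d) n (fun w => tree d L w ^ 2) = tree_var d L n.
Proof.
  intros Hd. revert n. induction L as [|L IH]; intros n.
  - cbn [tree tree_var]. unfold sd. now rewrite norm2_sq by lia.
  - rewrite (E_tree_S d L n (fun x => x ^ 2)) by assumption.
    rewrite E_sum_sq by (lia || now apply E_tree). cbn [tree_var]. now rewrite !IH.
Qed.

(** Measured against the square root of the length, the errors of the two halves do not grow when
    they are combined, and each level adds only its own cut. Cuts are dearest at the smallest
    pieces, so the levels sum to a geometric series. *)
Lemma tree_dist d L b n : (6 <= d)%nat -> (1 <= b)%nat -> (b * 2 ^ L <= n)%nat ->
  norm2 (2 * d) n (fun w => centered d w - tree d L w)
  <= cchi d / (root4 2 - 1) / root4 (INR b) * (1 - / root4 2 ^ L) * sqrt (INR n).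
Proof.
  intros Hd Hb. pose proof root4_2_gt_1 as Ht. set (t := root4 2) in *.
  assert (Hb1 : 1 <= INR b) by now apply (le_INR 1).
  assert (Hrb : 0 < root4 (INR b)) by (apply root4_pos; lra).
  assert (HC : 0 < cchi d) by (pose proof (cgreen_pos d Hd); unfold cchi; lra).
  assert (Hd0 : (0 < d)%nat) by lia.
  revert n. induction L as [|L IH]; intros n Hn.
  - rewrite (norm2_ext _ _ _ (fun _ => 0)) by (intros; simpl; ring).
    unfold norm2. rewrite E_const by lia. replace (0 ^ 2) with 0 by ring. rewrite sqrt_0.
    right. simpl. rewrite Rinv_1. ring.
  - assert (P2 : (2 ^ L <> 0)%nat) by (apply Nat.pow_nonzero; lia).
    rewrite Nat.pow_succ_r' in Hn. pose proof (half_bounds n) as Hh.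
    set (k := (n / 2)%nat) in *. set (l := (n - k)%nat).
    assert (Hk : (b * 2 ^ L <= k)%nat) by nia. assert (Hl : (b * 2 ^ L <= l)%nat) by (unfold l; nia).
    pose proof (IH k Hk) as Ik. pose proof (IH l Hl) as Il.
    set (al := cchi d / (t - 1) / root4 (INR b) * (1 - / t ^ L)) in *.
    set (D := fun w => centered d w - tree d L w) in *.
    assert (Htl : 1 <= t ^ L) by (apply pow_R1_Rle; lra).
    assert (Hal : 0 <= al).
    { unfold al. apply Rmult_le_pos.
      - apply Rmult_le_pos; [apply Rmult_le_pos|]; try lra; left; apply Rinv_0_lt_compat; lra.
      - assert (/ t ^ L <= 1) by (rewrite <- Rinv_1; apply Rinv_le_contravar; lra). lra. }
    assert (Hn1 : (1 <= n)%nat) by nia. assert (HnR : 1 <= INR n) by now apply (le_INR 1).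
    set (A := fun w => D (firstn k w) + D (skipn k w)).
    set (G := fun w => - (chi d (firstn k w) (skipn k w) - chi_mean d k l)).
    rewrite (norm2_ext _ _ _ (fun w => A w + G w)).
    2:{ intros w Hw. unfold A, G, D. rewrite <- (firstn_skipn k w) at 1. rewrite centered_app.
        cbn [tree]. rewrite Hw. fold k. rewrite length_firstn, length_skipn, Hw.
        rewrite Nat.min_l by lia. fold l. ring. }
    eapply Rle_trans; [apply norm2_triangle; lia|].
    (* The errors of the halves are independent and centred, so squares add:
       [al^2 k + al^2 l = al^2 n]. *)
    assert (HA : norm2 (2 * d) n A <= al * sqrt (INR n)).
    { unfold norm2, A. rewrite (E_split (2 * d) n k (fun u v => (D u + D v) ^ 2)) by lia. fold l.
      rewrite E_sum_sq; [|lia|].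
      2:{ unfold D. rewrite E_minus, E_centered, E_tree by assumption. ring. }
      rewrite <- !norm2_sq by lia.
      rewrite <- (sqrt_pow2 (al * sqrt (INR n))) by (apply Rmult_le_pos; [lra|apply sqrt_pos]).
      apply sqrt_le_1_alt. rewrite Rpow_mult_distr, pow2_sqrt by lra.
      assert (Sq : forall j x, 0 <= x -> x <= al * sqrt (INR j) -> x ^ 2 <= al ^ 2 * INR j).
      { intros j x Hx H. rewrite <- (pow2_sqrt (INR j)) by apply pos_INR.
        rewrite <- Rpow_mult_distr. apply pow_incr. lra. }
      pose proof (Sq _ _ (norm2_pos _ _ _) Ik). pose proof (Sq _ _ (norm2_pos _ _ _) Il).
      assert (INR n = INR k + INR l) by (rewrite <- plus_INR; f_equal; unfold l; lia).
      nra. }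
    (* Since [n >= b 2^(L+1)], the quotient of the fourth root of [n] by its square root is at most
       [1 / (t^(L+1) root4 b)]. *)
    assert (HG : norm2 (2 * d) n G <= cchi d / (t ^ S L * root4 (INR b)) * sqrt (INR n)).
    { unfold G. rewrite norm2_opp. eapply Rle_trans; [apply chi_norm; lia|].
      rewrite <- root4_sq. assert (Hrn : 0 < root4 (INR n)) by (apply root4_pos; lra).
      assert (Hle : t ^ S L * root4 (INR b) <= root4 (INR n)).
      { unfold t. rewrite <- root4_pow2_mult. apply root4_le, le_INR. simpl. lia. }
      assert (0 < t ^ S L) by (apply pow_lt; lra).
      replace (cchi d * root4 (INR n)) with (cchi d / root4 (INR n) * root4 (INR n) ^ 2) by (field; lra).
      apply Rmult_le_compat_r; [apply pow2_ge_0|]. apply Rmult_le_compat_l; [lra|].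
      apply Rinv_le_contravar; [nra|assumption]. }
    replace (cchi d / (t - 1) / root4 (INR b) * (1 - / t ^ S L))
      with (al + cchi d / (t ^ S L * root4 (INR b))); [lra|].
    unfold al. simpl. field. repeat split; lra.
Qed.

(** For a sum of independent parts, [E[T f(x + T)]] splits over the parts, and the other parts only
    shift [x]; hence the bound is uniform in [x] and the errors add over the [2^L] leaves. At a
    leaf, bounded by [c + 1], a Taylor expansion leaves two errors of size [M (c + 1)^3]. *)
Lemma tree_stein d L c n (f f' : R -> R) M x : (0 < d)%nat -> 0 <= M ->
  (forall y h, Rabs (f (y + h) - f y - h * f' y) <= M * h ^ 2) ->
  (forall y h, Rabs (f' (y + h) - f' y) <= M * Rabs h) ->
  (n <= c * 2 ^ L)%nat ->
  Rabs (E (2 * d) n (fun w => tree d L w * f (x + tree d L w))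
        - tree_var d L n * E (2 * d) n (fun w => f' (x + tree d L w)))
  <= INR (2 ^ L) * (2 * M * (INR c + 1) ^ 3).
Proof.
  intros Hd HM Hf Hf'. revert n x. induction L as [|L IH]; intros n x Hn.
  - cbn [tree tree_var]. unfold sd. rewrite norm2_sq by lia.
    set (X := centered d). set (v := E (2 * d) n (fun w => X w ^ 2)).
    rewrite Nat.mul_1_r in Hn. apply le_INR in Hn. set (B := INR c + 1).
    assert (HB : forall w, length w = n -> Rabs (X w) <= B).
    { intros w Hw. unfold B. pose proof (centered_bound d w Hd) as H. rewrite Hw, S_INR in H.
      unfold X. lra. }
    assert (HB0 : 1 <= B) by (unfold B; pose proof (pos_INR c); lra).
    assert (Hv : 0 <= v <= B ^ 2).
    { split; [apply E_sq_nonneg; lia|].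
      rewrite <- (E_const (2 * d) n (B ^ 2)) by lia. apply E_le; [lia|]. intros w Hw.
      rewrite <- (Rsqr_pow2 (X w)), Rsqr_abs, Rsqr_pow2. apply pow_incr. split; [apply Rabs_pos|auto]. }
    (* The mean of [X] is 0, so the term [X f(x)] may be subtracted; the next one, [X^2 f'(x)],
       averages to [v f'(x)]. *)
    replace (E (2 * d) n (fun w => X w * f (x + X w)))
      with (E (2 * d) n (fun w => X w * (f (x + X w) - f x - X w * f' x)) + v * f' x).
    2:{ unfold v. rewrite <- E_scal_r, <- E_plus.
        replace (E (2 * d) n (fun w => X w * f (x + X w)))
          with (E (2 * d) n (fun w => X w * f (x + X w)) - E (2 * d) n X * f x)
          by (unfold X; rewrite E_centered by assumption; ring).
        rewrite <- E_scal_r, <- E_minus. apply E_ext. intros. ring. }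
    replace (E (2 * d) n (fun w => f' (x + X w)))
      with (E (2 * d) n (fun w => f' (x + X w) - f' x) + f' x)
      by (rewrite E_minus, E_const by lia; ring).
    assert (H1 : Rabs (E (2 * d) n (fun w => X w * (f (x + X w) - f x - X w * f' x))) <= M * B ^ 3).
    { apply E_Rabs_le; [lia|]. intros w Hw. rewrite Rabs_mult. specialize (HB w Hw).
      specialize (Hf x (X w)). rewrite <- (Rsqr_pow2 (X w)), Rsqr_abs, Rsqr_pow2 in Hf.
      pose proof (Rabs_pos (X w)) as Hp. set (a := Rabs (X w)) in *.
      apply Rle_trans with (a * (M * a ^ 2)); [now apply Rmult_le_compat_l|].
      replace (a * (M * a ^ 2)) with (M * a ^ 3) by ring.
      apply Rmult_le_compat_l; [assumption|]. apply pow_incr. lra. }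
    assert (H2 : Rabs (E (2 * d) n (fun w => f' (x + X w) - f' x)) <= M * B).
    { apply E_Rabs_le; [lia|]. intros w Hw. specialize (HB w Hw). specialize (Hf' x (X w)).
      eapply Rle_trans; [exact Hf'|]. now apply Rmult_le_compat_l. }
    set (e1 := E (2 * d) n (fun w => X w * (f (x + X w) - f x - X w * f' x))) in *.
    set (e2 := E (2 * d) n (fun w => f' (x + X w) - f' x)) in *.
    replace (e1 + v * f' x - v * (e2 + f' x)) with (e1 - v * e2) by ring.
    assert (H3 : Rabs (v * e2) <= B ^ 2 * (M * B)).
    { rewrite Rabs_mult, (Rabs_pos_eq v) by lra. apply Rmult_le_compat; try lra. apply Rabs_pos. }
    unfold Rminus at 1. eapply Rle_trans; [apply Rabs_triang|]. rewrite Rabs_Ropp.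
    change (INR (2 ^ 0)) with 1. fold B. lra.
  - rewrite (E_tree_S d L n (fun y => y * f (x + y))), (E_tree_S d L n (fun y => f' (x + y)))
      by assumption.
    cbn [tree_var]. rewrite Nat.pow_succ_r' in Hn. pose proof (half_bounds n) as Hh.
    set (k := (n / 2)%nat) in *. set (l := (n - k)%nat).
    set (T := tree d L) in *. set (K := (2 * d)%nat) in *.
    set (vk := tree_var d L k). set (vl := tree_var d L l).
    set (e := INR (2 ^ L) * (2 * M * (INR c + 1) ^ 3)) in *.
    assert (Hk : forall y, Rabs (E K k (fun u => T u * f (y + T u)) - vk * E K k (fun u => f' (y + T u))) <= e)
      by (intros y; apply IH; nia).
    assert (Hl : forall y, Rabs (E K l (fun u => T u * f (y + T u)) - vl * E K l (fun u => f' (y + T u))) <= e)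
      by (intros y; apply IH; unfold l; nia).
    (* In each summand the other half is frozen and added to [x], where the induction hypothesis
       applies. *)
    replace (E K k (fun u => E K l (fun v => (T u + T v) * f (x + (T u + T v))))
       - (vk + vl) * E K k (fun u => E K l (fun v => f' (x + (T u + T v)))))
      with (E K l (fun v => E K k (fun u => T u * f (x + T v + T u)) - vk * E K k (fun u => f' (x + T v + T u)))
          + E K k (fun u => E K l (fun v => T v * f (x + T u + T v)) - vl * E K l (fun v => f' (x + T u + T v)))).
    + eapply Rle_trans; [apply Rabs_triang|].
      assert (B1 : Rabs (E K l (fun v => E K k (fun u => T u * f (x + T v + T u))
         - vk * E K k (fun u => f' (x + T v + T u)))) <= e).
      { apply E_Rabs_le; [unfold K; lia|]. intros v _. apply Hk. }
      assert (B2 : Rabs (E K k (fun u => E K l (fun v => T v * f (x + T u + T v))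
         - vl * E K l (fun v => f' (x + T u + T v)))) <= e).
      { apply E_Rabs_le; [unfold K; lia|]. intros v _. apply Hl. }
      replace (INR (2 ^ S L) * (2 * M * (INR c + 1) ^ 3)) with (2 * e); [lra|].
      unfold e. rewrite Nat.pow_succ_r', mult_INR. change (INR 2) with 2. ring.
    + rewrite !E_minus, !E_scal.
      rewrite (E_swap K l k (fun v u => T u * f (x + T v + T u))).
      rewrite (E_swap K l k (fun v u => f' (x + T v + T u))).
      rewrite (E_ext K k (fun u => E K l (fun v => (T u + T v) * f (x + (T u + T v))))
        (fun u => E K l (fun v => T u * f (x + T v + T u)) + E K l (fun v => T v * f (x + T u + T v)))).
      * rewrite E_plus.
        rewrite (E_ext K k (fun u => E K l (fun v => f' (x + T v + T u)))
          (fun u => E K l (fun v => f' (x + (T u + T v)))))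
          by (intros; apply E_ext; intros; f_equal; ring).
        rewrite (E_ext K k (fun u => E K l (fun v => f' (x + T u + T v)))
          (fun u => E K l (fun v => f' (x + (T u + T v)))))
          by (intros; apply E_ext; intros; f_equal; ring).
        ring.
      * intros u _. rewrite <- E_plus. apply E_ext. intros v _.
        replace (x + T v + T u) with (x + (T u + T v)) by ring.
        replace (x + T u + T v) with (x + (T u + T v)) by ring. ring.
Qed.

(** * Positivity of the limiting variance *)

(** A walk needs at least [j] steps to reach a point with a coordinate of size [j], so decay in time
    gives decay in space. The resulting inverse square is cruder than the true rate but enough
    here. *)
Lemma sum_heat_le_support d m c j i z : (6 <= d)%nat -> (Z.of_nat j <= Z.abs (coord i z))%Z ->
  lsum (seq 0 m) (fun t => heat d (t + c) z) <= cgreen d / (INR (Nat.max c j) + 1) ^ 2.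
Proof.
  intros Hd Hz. destruct (Nat.le_ge_cases j c) as [H|H].
  - rewrite Nat.max_l by assumption. now apply sum_heat_le.
  - rewrite Nat.max_r by assumption.
    apply Rle_trans with (2 := sum_heat_le d m j z Hd).
    apply Rle_trans with (2 := sum_shifted_le m (j - c) (fun t => heat d (t + j) z)
      (fun t => heat_nonneg d (t + j) z ltac:(lia))).
    apply lsum_le. intros t. destruct (Nat.leb_spec (j - c) t).
    + replace (t - (j - c) + j)%nat with (t + c)%nat by lia. lra.
    + rewrite (heat_support d (t + c) i) by lia. lra.
Qed.

Lemma inv_max_sq_le a b : / (INR (Nat.max a b) + 1) ^ 2 <= 4 * / (INR a + (INR b + 1)) ^ 2.
Proof.
  pose proof (pos_INR a). pose proof (pos_INR b).
  assert (INR a <= INR (Nat.max a b)) by (apply le_INR; lia).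
  assert (INR b <= INR (Nat.max a b)) by (apply le_INR; lia).
  set (x := INR (Nat.max a b)) in *.
  replace (4 * / (INR a + (INR b + 1)) ^ 2) with (/ ((INR a + (INR b + 1)) / 2) ^ 2) by (field; lra).
  apply Rinv_le_contravar; [apply pow_lt; lra|]. apply pow_incr. lra.
Qed.

Lemma sum_inv_gap_sq_le n j s : 1 <= s -> (j < n)%nat ->
  lsum (seq 0 n) (fun i => / (INR (gap i j) + s) ^ 2) <= 4 / s.
Proof.
  intros Hs Hj. set (h := fun c => / (INR c + s) ^ 2).
  assert (Hh : forall c, 0 <= h c).
  { intros c. left. apply Rinv_0_lt_compat. apply pow_lt. pose proof (pos_INR c). lra. }
  pose proof (sum_inv_square_le n s Hs) as Hsum. fold h in Hsum.
  apply Rle_trans with (lsum (seq 0 n) (fun i => if (j <=? i)%nat then h (i - j)%nat else 0)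
    + lsum (seq 0 n) (fun i => if (i <=? j)%nat then h (j - i)%nat else 0)).
  - rewrite <- lsum_plus. apply lsum_le. intros i. fold (h (gap i j)). unfold gap.
    destruct (Nat.leb_spec j i), (Nat.leb_spec i j); try lia.
    + pose proof (Hh (i - j)%nat). pose proof (Hh (j - i)%nat). replace i with j by lia.
      rewrite !Nat.sub_diag. simpl. pose proof (Hh 0%nat). lra.
    + replace (i - j + (j - i))%nat with (i - j)%nat by lia. lra.
    + replace (i - j + (j - i))%nat with (j - i)%nat by lia. lra.
  - pose proof (sum_shifted_le n j h Hh) as H1.
    assert (H2 : lsum (seq 0 n) (fun i => if (i <=? j)%nat then h (j - i)%nat else 0)
                 <= lsum (seq 0 n) h).
    { destruct n as [|n]; [lia|]. rewrite lsum_seq_reverse.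
      apply Rle_trans with (2 := sum_shifted_le (S n) (n - j) h Hh).
      apply lsum_le_in. intros i Hi. apply in_seq in Hi.
      destruct (Nat.leb_spec (n - i) j), (Nat.leb_spec (n - j) i); try lia; try lra.
      replace (j - (n - i))%nat with (i - (n - j))%nat by lia. lra. }
    replace (4 / s) with (2 / s + 2 / s) by (field; lra). lra.
Qed.

Lemma firstn_repeat {A : Type} (a : A) k n : firstn k (repeat a n) = repeat a (Nat.min k n).
Proof.
  revert n. induction k as [|k IH]; intros [|n]; try reflexivity. simpl. now rewrite IH.
Qed.

Lemma E_point K n w0 F : length w0 = n -> (forall i, In i w0 -> (i < K)%nat) ->
  E K n (fun w => ind (if list_eq_dec Nat.eq_dec w w0 then true else false) * F w)
  = F w0 / INR (K ^ n).
Proof.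
  (* Only a letter of [w0] shows that [K] is positive, so the empty word is treated apart. *)
  intros Hn Hi. destruct n as [|n].
  { destruct w0; [|discriminate]. rewrite E_0. destruct list_eq_dec; [|contradiction]. simpl. field. }
  assert (HK : (0 < K)%nat) by (destruct w0 as [|i w0]; [discriminate|]; specialize (Hi i (or_introl eq_refl)); lia).
  revert w0 F Hn Hi. induction (S n) as [|k IH]; intros w0 F Hn Hi.
  - destruct w0; [|discriminate]. rewrite E_0. destruct list_eq_dec; [|contradiction]. simpl. field.
  - destruct w0 as [|i0 w0]; [discriminate|]. injection Hn as Hn. rewrite E_S by assumption.
    rewrite (lsum_ext_in (seq 0 K) _ (fun i => ind (if Nat.eq_dec i i0 then true else false)
      * (F (i0 :: w0) / INR (K ^ k)))).
    + rewrite lsum_scal_r.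
      assert (Hs : lsum (seq 0 K) (fun i => ind (if Nat.eq_dec i i0 then true else false)) = 1).
      { specialize (Hi i0 (or_introl eq_refl)). replace K with (i0 + S (K - i0 - 1))%nat by lia.
        rewrite seq_app, lsum_app. cbn [Nat.add seq]. rewrite lsum_cons.
        rewrite (lsum_ext_in (seq 0 i0) _ (fun _ => 0)), (lsum_ext_in (seq (S i0) (K - i0 - 1)) _ (fun _ => 0)).
        - rewrite !lsum_const. destruct Nat.eq_dec; [simpl; ring|contradiction].
        - intros i Hin. apply in_seq in Hin. destruct Nat.eq_dec; [lia|reflexivity].
        - intros i Hin. apply in_seq in Hin. destruct Nat.eq_dec; [lia|reflexivity]. }
      rewrite Hs. cbn [Nat.pow]. rewrite mult_INR. field. split; apply not_0_INR; [|lia].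
      apply Nat.pow_nonzero. lia.
    + intros i Hin. destruct (Nat.eq_dec i i0) as [->|Hne].
      * cbn [ind]. rewrite Rmult_1_l. rewrite <- (IH w0 (fun w => F (i0 :: w))); auto.
        -- apply E_ext. intros w _. f_equal. f_equal.
           destruct (list_eq_dec Nat.eq_dec (i0 :: w) (i0 :: w0)), (list_eq_dec Nat.eq_dec w w0);
             congruence.
        -- intros j Hj. apply Hi. now right.
      * cbn [ind]. rewrite Rmult_0_l. transitivity (E K k (fun _ => 0)); [|now apply E_const].
        apply E_ext. intros w _. destruct list_eq_dec; [congruence|]. simpl. ring.
Qed.

Lemma coord_disp_repeat_even d c j n : (c < d)%nat -> (j < d)%nat ->
  coord j (disp d (repeat (2 * c)%nat n)) = if Nat.eqb j c then Z.of_nat n else 0%Z.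
Proof.
  intros Hc Hj. induction n as [|n IH].
  - simpl. rewrite coord_origin. now destruct Nat.eqb.
  - cbn [repeat]. rewrite coord_disp_cons, IH, div2_even, Nat.even_even by assumption.
    destruct (Nat.eqb j c); lia.
Qed.

Definition segment (d : nat) (x : point) (n : nat) : list point :=
  map (fun j => vadd x (disp d (repeat 0%nat j))) (seq 0 (S n)).

Lemma coord_disp_repeat_0 d j n : (1 < d)%nat -> (j < d)%nat ->
  coord j (disp d (repeat 0%nat n)) = if Nat.eqb j 0 then Z.of_nat n else 0%Z.
Proof. intros Hd Hj. apply (coord_disp_repeat_even d 0); lia. Qed.

Lemma segment_length_points d x n y : length x = d -> In y (segment d x n) -> length y = d.
Proof.
  intros Hx Hy. apply in_map_iff in Hy. destruct Hy as [j [<- _]]. auto with len.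
Qed.

Lemma NoDup_segment d x n : (1 < d)%nat -> length x = d -> NoDup (segment d x n).
Proof.
  intros Hd Hx. apply NoDup_map_NoDup_ForallPairs; [|apply seq_NoDup].
  intros i j _ _ H. apply (f_equal (coord 0)) in H.
  rewrite !(coord_vadd d) in H by auto with len. rewrite !coord_disp_repeat_0 in H by lia.
  cbn [Nat.eqb] in H. lia.
Qed.

(* Force the walk [L] steps away from the segment; from there it hits the segment with
   probability at most 16 C / (L + 1). *)
Lemma no_return_segment_ge d L n x j m : (6 <= d)%nat -> length x = d -> (j <= n)%nat ->
  32 * cgreen d <= INR L + 1 ->
  / (2 * INR ((2 * d) ^ L))
  <= no_return_by d (segment d x n) (vadd x (disp d (repeat 0%nat j))) m.
Proof.
  intros Hd Hx Hj HL. set (z := vadd x (disp d (repeat 0%nat j))). set (A := segment d x n).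
  assert (Hz : length z = d) by (unfold z; auto with len).
  assert (Hd0 : (0 < d)%nat) by lia.
  (* A longer horizon lowers the probability, which makes room for [L] forced steps before the [m]
     free ones. *)
  apply Rle_trans with (no_return_by d A z (L + m)).
  2:{ apply decreasing_prop; [now apply no_return_by_decreasing|lia]. }
  (* The letter 2 is the positive direction of axis 1, orthogonal to the segment, which lies along
     axis 0. The forced word has probability [(2 d)^-L]. *)
  rewrite no_return_by_E, E_app by lia. set (w0 := repeat 2%nat L).
  set (z' := vadd z (disp d w0)). assert (Hz' : length z' = d) by (unfold z'; auto with len).
  apply Rle_trans with (E (2 * d) L (fun u =>
    ind (if list_eq_dec Nat.eq_dec u w0 then true else false)
    * E (2 * d) m (fun v => ind (avoids A (tl (path d z (u ++ v))))))).
  2:{ apply E_le; [lia|]. intros u _.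
      assert (0 <= E (2 * d) m (fun v => ind (avoids A (tl (path d z (u ++ v)))))).
      { apply E_nonneg; [lia|]. intros. apply ind_bounds. }
      destruct list_eq_dec; cbn [ind]; lra. }
  rewrite E_point by (apply repeat_length || (intros i Hi; apply repeat_spec in Hi; lia)).
  assert (HK : 0 < INR ((2 * d) ^ L)) by (apply INR_pow_pos; lia).
  rewrite Rinv_mult. unfold Rdiv. apply Rmult_le_compat_r; [left; now apply Rinv_0_lt_compat|].
  rewrite (E_ext _ _ _ (fun v => 1 - (1 - ind (avoids A (tl (path d z' v)))))).
  - rewrite E_minus, E_const by lia.
    assert (H : E (2 * d) m (fun v => 1 - ind (avoids A (tl (path d z' v)))) <= / 2); [|lra].
    eapply Rle_trans; [apply hit_le_green1; auto; intros y; now apply segment_length_points|].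
    unfold A, segment. rewrite lsum_map.
    (* The point of index [i] is at distance [|i - j|] along axis 0 and [L] along axis 1; the larger
       of the two feeds [sum_heat_le_support]. *)
    apply Rle_trans with (lsum (seq 0 (S n)) (fun i => (4 * cgreen d) * / (INR (gap i j) + (INR L + 1)) ^ 2)).
    + apply lsum_le_in. intros i Hi. apply in_seq in Hi.
      set (y := vadd (vadd x (disp d (repeat 0%nat i))) (vopp z')).
      assert (Hy0 : coord 0 y = (Z.of_nat i - Z.of_nat j)%Z).
      { unfold y, z', z, w0. rewrite !(coord_vadd d) by (rewrite ?length_vopp; auto 10 with len).
        rewrite coord_vopp. rewrite !(coord_vadd d) by auto with len.
        rewrite !coord_disp_repeat_0 by lia.
        change 2%nat with (2 * 1)%nat. rewrite coord_disp_repeat_even by lia. simpl. lia. }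
      assert (Hy1 : coord 1 y = (- Z.of_nat L)%Z).
      { unfold y, z', z, w0. rewrite !(coord_vadd d) by (rewrite ?length_vopp; auto 10 with len).
        rewrite coord_vopp. rewrite !(coord_vadd d) by auto with len.
        rewrite !coord_disp_repeat_0 by lia.
        change 2%nat with (2 * 1)%nat. rewrite coord_disp_repeat_even by lia. simpl. lia. }
      assert (Hmax : exists c, (Z.of_nat (Nat.max (gap i j) L) <= Z.abs (coord c y))%Z).
      { destruct (Nat.le_ge_cases (gap i j) L); [exists 1%nat|exists 0%nat].
        - rewrite Hy1. lia.
        - rewrite Hy0. unfold gap in *. lia. }
      destruct Hmax as [c Hc].
      apply Rle_trans with (green d m y).
      { rewrite green_green1. pose proof (heat_nonneg d 0 y Hd0). lra. }
      unfold green. rewrite (lsum_ext _ _ (fun t => heat d (t + 0) y)) by (intros; f_equal; lia).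
      eapply Rle_trans; [apply (sum_heat_le_support d (S m) 0 _ c y Hd Hc)|].
      rewrite Nat.max_0_l. rewrite (Rmult_comm 4), Rmult_assoc. unfold Rdiv.
      apply Rmult_le_compat_l; [left; now apply cgreen_pos|]. apply inv_max_sq_le.
    + rewrite lsum_scal. pose proof (pos_INR L). pose proof (cgreen_pos d Hd).
      apply Rle_trans with (4 * cgreen d * (4 / (INR L + 1))).
      * apply Rmult_le_compat_l; [lra|]. apply sum_inv_gap_sq_le; [lra|lia].
      * apply Rmult_le_reg_r with (INR L + 1); [lra|].
        replace (4 * cgreen d * (4 / (INR L + 1)) * (INR L + 1)) with (16 * cgreen d) by (field; lra).
        lra.
  - intros v _. rewrite path_app by assumption. fold z'.
    destruct (path_cons d z w0) as [l Hl]. pose proof (tl_path_eq d z w0 Hz) as Ht.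
    rewrite Hl in *. cbn [app tl] in *. subst l. unfold avoids. rewrite forallb_app.
    rewrite (proj2 (forallb_forall _ (map _ _))); [simpl; lra|].
    intros y Hy. apply in_map_iff in Hy. destruct Hy as [i [<- Hi]]. apply in_seq in Hi.
    unfold w0 in *. rewrite repeat_length in Hi. rewrite negb_true_iff, <- not_true_iff_false, memb_spec.
    intros Hin. apply in_map_iff in Hin. destruct Hin as [i' [Heq _]].
    rewrite firstn_repeat in Heq. apply (f_equal (coord 1)) in Heq. unfold z in Heq.
    rewrite !(coord_vadd d) in Heq by auto with len.
    rewrite !coord_disp_repeat_0 in Heq by lia. change 2%nat with (2 * 1)%nat in Heq.
    rewrite coord_disp_repeat_even in Heq by lia. simpl in Heq. lia.
Qed.

Lemma Capm_segment_ge d L n x m : (6 <= d)%nat -> length x = d ->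
  32 * cgreen d <= INR L + 1 ->
  INR (S n) * / (2 * INR ((2 * d) ^ L)) <= Capm d (segment d x n) m.
Proof.
  intros Hd Hx HL. unfold Capm. rewrite nodup_fixed_point by (apply NoDup_segment; lia || assumption).
  replace (S n) with (length (segment d x n)) by (unfold segment; now rewrite length_map, length_seq).
  rewrite <- lsum_const. apply lsum_le_in. intros y Hy. apply in_map_iff in Hy.
  destruct Hy as [j [<- Hj]]. apply in_seq in Hj. apply no_return_segment_ge; auto. lia.
Qed.

(** * Replacing a zigzag by a straight excursion *)

Fixpoint zigzag (n : nat) : list nat :=
  match n with
  | O => []
  | S n' => 0%nat :: 1%nat :: zigzag n'
  end.

(** It has the length of [zigzag n] and the same end point, so exchanging the two leaves the rest of
    a path in place. It visits a segment of [n + 1] points, the zigzag at most two. *)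
Definition excursion (n : nat) : list nat := repeat 0%nat n ++ repeat 1%nat n.

Lemma length_zigzag n : length (zigzag n) = (2 * n)%nat.
Proof. induction n as [|n IH]; simpl in *; lia. Qed.

Lemma length_excursion n : length (excursion n) = (2 * n)%nat.
Proof. unfold excursion. rewrite length_app, !repeat_length. lia. Qed.

Lemma step_1 d : step d 1 = vopp (step d 0).
Proof. now rewrite <- step_flip. Qed.

Lemma disp_repeat_1 d n : disp d (repeat 1%nat n) = vopp (disp d (repeat 0%nat n)).
Proof. rewrite <- disp_flip. f_equal. induction n as [|n IH]; simpl; [reflexivity|now rewrite IH]. Qed.

Lemma disp_excursion d n : disp d (excursion n) = origin d.
Proof. unfold excursion. rewrite disp_app, disp_repeat_1. apply vadd_vopp_r. auto with len. Qed.

Lemma disp_zigzag d n : disp d (zigzag n) = origin d.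
Proof.
  induction n as [|n IH]; [reflexivity|]. cbn [zigzag disp]. rewrite IH, vadd_assoc, step_1.
  rewrite (vadd_vopp_r d) by auto with len. apply vadd_origin_r. auto with len.
Qed.

Lemma path_zigzag_incl d x n : length x = d ->
  incl (path d x (zigzag n)) [x; vadd x (step d 0)].
Proof.
  intros Hx. induction n as [|n IH]; intros y Hy.
  - destruct Hy as [<-|[]]. now left.
  - cbn [zigzag path] in Hy. destruct Hy as [<-|[<-|Hy]]; [now left|right; now left|].
    rewrite <- vadd_assoc, step_1, (vadd_vopp_r d), (vadd_origin_r d) in Hy by auto with len.
    now apply IH.
Qed.

Lemma path_app_set_gen d x u v y : length x = d ->
  In y (path d x (u ++ v)) <-> In y (path d x u) \/ In y (path d (vadd x (disp d u)) v).
Proof.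
  intros Hx. rewrite path_app by assumption. rewrite in_app_iff.
  destruct (path_cons d (vadd x (disp d u)) v) as [l Hl]. rewrite Hl. cbn [tl]. split.
  - intros [H|H]; [now left|right; now right].
  - intros [H|[<-|H]]; [now left| |now right]. left.
    rewrite path_eq by assumption. apply in_map_iff. exists (length u).
    rewrite firstn_all. split; [reflexivity|]. apply in_seq. lia.
Qed.

Lemma path_excursion_set d x n y : length x = d ->
  In y (path d x (excursion n)) <-> In y (segment d x n).
Proof.
  intros Hx. unfold excursion. rewrite path_app_set_gen by assumption.
  rewrite !path_eq by auto with len. rewrite !repeat_length. unfold segment. rewrite !in_map_iff.
  split.
  - intros [[j [<- Hj]]|[j [<- Hj]]]; apply in_seq in Hj; rewrite firstn_repeat, Nat.min_l by lia.
    + exists j. split; [reflexivity|apply in_seq; lia].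
    + exists (n - j)%nat. split; [|apply in_seq; lia].
      rewrite disp_repeat_1. replace n with (n - j + j)%nat at 2 by lia.
      rewrite repeat_app, disp_app, <- !vadd_assoc, (vadd_vopp_r d), (vadd_origin_r d) by auto with len.
      reflexivity.
  - intros [j [<- Hj]]. left. exists j. apply in_seq in Hj.
    rewrite firstn_repeat, Nat.min_l by lia. split; [reflexivity|apply in_seq; lia].
Qed.

Lemma zigzag_letters n i : In i (zigzag n) -> (i < 2)%nat.
Proof. induction n as [|n IH]; simpl; [tauto|]. intros [<-|[<-|H]]; lia || auto. Qed.

Lemma excursion_letters n i : In i (excursion n) -> (i < 2)%nat.
Proof.
  unfold excursion. rewrite in_app_iff. intros [H|H]; apply repeat_spec in H; lia.
Qed.

(** Decay in time along the walk and decay in space at its start combine into a bound independent of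
    the length [k]. *)
Lemma sum_green_walk_le d m k i j z : (6 <= d)%nat -> length z = d ->
  (Z.of_nat j <= Z.abs (coord i z))%Z ->
  E (2 * d) k (fun u => lsum (seq 0 (S k)) (fun a => green d m (vadd z (disp d (firstn a u)))))
  <= 8 * cgreen d * / (INR j + 1).
Proof.
  intros Hd Hz Hj. rewrite E_lsum. pose proof (pos_INR j).
  apply Rle_trans with (lsum (seq 0 (S k)) (fun a => 4 * cgreen d * / (INR a + (INR j + 1)) ^ 2)).
  - apply lsum_le_in. intros a Ha. apply in_seq in Ha.
    rewrite (E_firstn (2 * d) k a (fun u => green d m (vadd z (disp d u)))) by lia.
    rewrite E_green by (lia || assumption).
    eapply Rle_trans; [apply (sum_heat_le_support d (S m) a j i z Hd Hj)|].
    rewrite (Rmult_comm 4), Rmult_assoc. apply Rmult_le_compat_l; [left; now apply cgreen_pos|].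
    apply inv_max_sq_le.
  - rewrite lsum_scal. pose proof (cgreen_pos d Hd).
    replace (8 * cgreen d * / (INR j + 1)) with (4 * cgreen d * (2 / (INR j + 1))) by (field; lra).
    apply Rmult_le_compat_l; [lra|]. apply sum_inv_square_le. lra.
Qed.

(** The Green energy between the segment and the rest of the path, seen from the foot of the
    excursion: [u] is the past read backwards and [v] the future. *)
Definition segment_green (d m N : nat) (u v : list nat) : R :=
  lsum (seq 0 (S N)) (fun j =>
    lsum (seq 0 (S (length u))) (fun a =>
      green d m (vadd (disp d (repeat 0%nat j)) (disp d (firstn a u))))
    + lsum (seq 0 (S (length v))) (fun b =>
      green d m (vadd (vopp (disp d (repeat 0%nat j))) (disp d (firstn b v))))).

(** Let [R] be the rest of the path. Adding the segment to [R] loses at most twice the mutual Green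
    energy, whereas adding the zigzag gains at most 2, as it visits at most two points. *)
Lemma excursion_gain d m N u v : (0 < d)%nat ->
  Capm d (segment d (disp d u) N) m - 2 - 2 * segment_green d m N (rev u) v
  <= capm_range d m (u ++ excursion N ++ v) - capm_range d m (u ++ zigzag N ++ v).
Proof.
  intros Hd. set (x := disp d u). assert (Hx : length x = d) by (unfold x; auto with len).
  set (R := path d (origin d) u ++ path d x v).
  assert (Hset : forall w y, disp d w = origin d ->
    In y (path d (origin d) (u ++ w ++ v)) <-> In y (R ++ path d x w)).
  { intros w y Hw. rewrite path_app_set, in_app_iff. fold x. rewrite path_app_set_gen by assumption.
    rewrite Hw, vadd_origin_r by assumption. unfold R. rewrite !in_app_iff. tauto. }
  assert (HR : forall y, In y R -> length y = d).
  { intros y Hy. apply in_app_or in Hy.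
    destruct Hy as [Hy|Hy]; apply path_length_points in Hy; auto with len. }
  unfold capm_range.
  rewrite (Capm_ext d (path d (origin d) (u ++ excursion N ++ v)) (R ++ segment d x N)).
  2:{ intros y. rewrite Hset by apply disp_excursion. rewrite !in_app_iff.
      now rewrite path_excursion_set. }
  rewrite (Capm_ext d (path d (origin d) (u ++ zigzag N ++ v)) (R ++ path d x (zigzag N)))
    by (intros y; apply Hset, disp_zigzag).
  pose proof (Capm_app_le d R (path d x (zigzag N)) m Hd) as H1.
  assert (H2 : Capm d (path d x (zigzag N)) m <= 2).
  { unfold Capm. set (l := nodup point_eq_dec (path d x (zigzag N))).
    apply Rle_trans with (INR (length l) * 1).
    - rewrite <- lsum_const. apply lsum_le. intros. now apply no_return_by_bounds.
    - rewrite Rmult_1_r. apply (le_INR _ 2).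
      apply (NoDup_incl_length (l' := [x; vadd x (step d 0)])); [apply NoDup_nodup|].
      intros y Hy. apply nodup_In in Hy. now apply (path_zigzag_incl d x N). }
  pose proof (Capm_app_ge d R (segment d x N) m Hd HR
    (fun y => segment_length_points d x N y Hx)) as H3.
  enough (H4 : lsum R (fun z => lsum (segment d x N) (fun y => green d m (vadd y (vopp z))))
    = segment_green d m N (rev u) v).
  { assert (H5 : Capm d R m + Capm d (segment d x N) m - Capm d (R ++ segment d x N) m
      <= 2 * segment_green d m N (rev u) v) by (rewrite <- H4; exact H3). lra. }
  rewrite lsum_swap. unfold segment, segment_green. rewrite lsum_map. apply lsum_ext. intros j.
  unfold R. rewrite lsum_app, !path_eq, !lsum_map, length_rev by auto with len. f_equal.
  - rewrite lsum_seq_reverse. apply lsum_ext_in. intros a Ha. f_equal.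
    rewrite vadd_origin_l by auto with len.
    rewrite (vadd_comm x), <- vadd_assoc. unfold x. rewrite vadd_vopp_skipn, firstn_rev, disp_rev.
    reflexivity.
  - apply lsum_ext. intros b. rewrite <- green_vopp by assumption. f_equal.
    rewrite !vopp_vadd, !vopp_involutive.
    rewrite (vadd_comm (vopp x)), <- vadd_assoc. f_equal.
    rewrite vadd_assoc, (vadd_comm (vopp x)), (vadd_vopp_r d), (vadd_origin_l d) by auto with len.
    reflexivity.
Qed.

(** The interaction grows only like a harmonic sum in [N], while the capacity of the segment grows
    linearly. *)
Lemma E_segment_green_le d m N k l : (6 <= d)%nat ->
  E (2 * d) k (fun u => E (2 * d) l (fun v => segment_green d m N (rev u) v))
  <= 16 * cgreen d * harmonic (S N).
Proof.
  intros Hd. rewrite (E_rev (2 * d) k (fun u => E (2 * d) l (fun v => segment_green d m N u v))) by lia.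
  rewrite (E_ext _ _ _ (fun u => lsum (seq 0 (S N)) (fun j =>
    lsum (seq 0 (S k)) (fun a => green d m (vadd (disp d (repeat 0%nat j)) (disp d (firstn a u))))
    + E (2 * d) l (fun v => lsum (seq 0 (S l)) (fun b =>
        green d m (vadd (vopp (disp d (repeat 0%nat j))) (disp d (firstn b v)))))))).
  - rewrite E_lsum. unfold harmonic. rewrite <- lsum_scal. apply lsum_le. intros j.
    rewrite E_plus, E_const by lia.
    replace (16 * cgreen d * / (INR j + 1))
      with (8 * cgreen d * / (INR j + 1) + 8 * cgreen d * / (INR j + 1)) by ring.
    apply Rplus_le_compat; apply (sum_green_walk_le d m _ 0); auto with len.
    + rewrite coord_disp_repeat_0 by lia. simpl. lia.
    + rewrite length_vopp. auto with len.
    + rewrite coord_vopp, coord_disp_repeat_0 by lia. simpl. lia.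
  - intros u Hu. rewrite (E_ext _ l _ (fun v => lsum (seq 0 (S N)) (fun j =>
      lsum (seq 0 (S k)) (fun a => green d m (vadd (disp d (repeat 0%nat j)) (disp d (firstn a u))))
      + lsum (seq 0 (S l)) (fun b =>
        green d m (vadd (vopp (disp d (repeat 0%nat j))) (disp d (firstn b v))))))).
    + rewrite E_lsum. apply lsum_ext. intros j. now rewrite E_plus, E_const by lia.
    + intros v Hv. unfold segment_green. now rewrite Hu, Hv.
Qed.

Lemma excursion_mean_gain d : (6 <= d)%nat ->
  exists N, (1 <= N)%nat /\ forall k l,
    1 <= E (2 * d) k (fun u => E (2 * d) l (fun v =>
           cap_range d (u ++ excursion N ++ v) - cap_range d (u ++ zigzag N ++ v))).
Proof.
  intros Hd. pose proof (cgreen_pos d Hd) as HC.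
  destruct (INR_unbounded (32 * cgreen d)) as [L HL].
  set (c0 := / (2 * INR ((2 * d) ^ L))).
  assert (Hc0 : 0 < c0).
  { apply Rinv_0_lt_compat. pose proof (INR_pow_pos (2 * d) L ltac:(lia)). lra. }
  (* With [y] the eighth root of [N + 1], the loss is at most [2 + 256 cgreen y], where
     [256 = 2 * 16 * 8]. For [y >= r] the gain [c0 y^8] exceeds it by 1. *)
  set (r := (3 + 256 * cgreen d) / c0 + 1).
  assert (Hr : 1 < r) by (assert (0 < (3 + 256 * cgreen d) / c0) by (apply Rdiv_lt_0_compat; lra); unfold r; lra).
  destruct (INR_unbounded (r ^ 8)) as [N HN].
  assert (Hr8 : 1 < r ^ 8) by (apply Rlt_pow_R1; [lra|lia]).
  exists N. assert (HN1 : (1 <= N)%nat) by (destruct N; [simpl in HN; lra|lia]).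
  split; [assumption|]. intros k l.
  apply (Un_cv_ge_const (fun m => E (2 * d) k (fun u => E (2 * d) l (fun v =>
    capm_range d m (u ++ excursion N ++ v) - capm_range d m (u ++ zigzag N ++ v))))).
  { apply (E_Un_cv _ _ (fun m u => E (2 * d) l (fun v =>
      capm_range d m (u ++ excursion N ++ v) - capm_range d m (u ++ zigzag N ++ v)))).
    intros u _. apply (E_Un_cv _ _ (fun m v =>
      capm_range d m (u ++ excursion N ++ v) - capm_range d m (u ++ zigzag N ++ v))).
    intros v _. apply (CV_minus (fun m => capm_range d m _) (fun m => capm_range d m _));
      apply Cap_cv; lia. }
  intros m.
  apply Rle_trans with (E (2 * d) k (fun u => E (2 * d) l (fun v =>
    (INR (S N) * c0 - 2) - 2 * segment_green d m N (rev u) v))).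
  - rewrite (E_ext _ _ _ (fun u => (INR (S N) * c0 - 2)
       - 2 * E (2 * d) l (fun v => segment_green d m N (rev u) v)))
      by (intros; now rewrite E_minus, E_const, E_scal by lia).
    rewrite E_minus, E_const, E_scal by lia.
    pose proof (E_segment_green_le d m N k l Hd) as H1.
    pose proof (harmonic_le_root8 (S N)) as H2.
    assert (H3 : r <= root8 (INR (S N))).
    { apply Rnot_lt_le. intros Hlt. pose proof (root8_pow (INR (S N)) (pos_INR _)) as H4.
      assert (root8 (INR (S N)) ^ 8 <= r ^ 8) by (apply pow_incr; split; [apply root8_pos|lra]).
      rewrite S_INR in *. lra. }
    pose proof (root8_pow (INR (S N)) (pos_INR _)) as H4. set (y := root8 (INR (S N))) in *.
    assert (H5 : y * y <= y ^ 8).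
    { replace (y ^ 8) with (y * y * y ^ 6) by ring.
      assert (1 <= y ^ 6) by (apply pow_R1_Rle; lra). nra. }
    assert (H6 : 3 + 256 * cgreen d <= c0 * y).
    { apply Rle_trans with (c0 * r); [|apply Rmult_le_compat_l; lra].
      unfold r. replace (c0 * ((3 + 256 * cgreen d) / c0 + 1)) with (3 + 256 * cgreen d + c0)
        by (field; lra). lra. }
    assert (H7 : (3 + 256 * cgreen d) * y <= c0 * y * y) by (apply Rmult_le_compat_r; lra).
    rewrite <- H4.
    assert (H8 : c0 * (y * y) <= c0 * y ^ 8) by (apply Rmult_le_compat_l; lra).
    assert (H9 : 16 * cgreen d * harmonic (S N) <= 16 * cgreen d * (8 * y))
      by (apply Rmult_le_compat_l; lra).
    lra.
  - apply E_le; [lia|]. intros u _. apply E_le; [lia|]. intros v _.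
    pose proof (excursion_gain d m N u v ltac:(lia)) as H1.
    pose proof (Capm_segment_ge d L N (disp d u) m Hd (length_disp d u) ltac:(lra)) as H2.
    fold c0 in H2. lra.
Qed.

(* Summed over consecutive blocks, this test function has a covariance with the capacity of the
   order of the number of blocks, and a variance of the same order. *)
Definition block_test (N : nat) (w : list nat) : R :=
  ind (if list_eq_dec Nat.eq_dec w (excursion N) then true else false)
  - ind (if list_eq_dec Nat.eq_dec w (zigzag N) then true else false).

Fixpoint block_test_sum (N Q : nat) (w : list nat) : R :=
  match Q with
  | O => 0
  | S Q' => block_test N (firstn (2 * N) w) + block_test_sum N Q' (skipn (2 * N) w)
  end.

(** Testing against a block measures the effect on [F] of the exchange of zigzag and excursion,
    weighted by the probability of one word. *)
Lemma E_block_test d N F : (0 < d)%nat ->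
  E (2 * d) (2 * N) (fun w => block_test N w * F w)
  = (F (excursion N) - F (zigzag N)) / INR ((2 * d) ^ (2 * N)).
Proof.
  intros Hd. unfold block_test.
  rewrite (E_ext _ _ _ (fun w =>
    ind (if list_eq_dec Nat.eq_dec w (excursion N) then true else false) * F w
    - ind (if list_eq_dec Nat.eq_dec w (zigzag N) then true else false) * F w)) by (intros; ring).
  rewrite E_minus, !E_point.
  - unfold Rdiv. ring.
  - apply length_zigzag.
  - intros i Hi. apply zigzag_letters in Hi. lia.
  - apply length_excursion.
  - intros i Hi. apply excursion_letters in Hi. lia.
Qed.

Lemma E_block_test_0 d N : (0 < d)%nat -> E (2 * d) (2 * N) (block_test N) = 0.
Proof.
  intros Hd. rewrite (E_ext _ _ _ (fun w => block_test N w * 1)) by (intros; ring).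
  rewrite (E_block_test d N (fun _ => 1)) by assumption. unfold Rdiv. ring.
Qed.

Lemma E_block_test_sq d N : (0 < d)%nat ->
  E (2 * d) (2 * N) (fun w => block_test N w ^ 2) <= 2 / INR ((2 * d) ^ (2 * N)).
Proof.
  intros Hd. rewrite (E_ext _ _ _ (fun w => block_test N w * block_test N w)) by (intros; ring).
  rewrite E_block_test by assumption. unfold Rdiv. apply Rmult_le_compat_r.
  - left. apply Rinv_0_lt_compat. apply INR_pow_pos. lia.
  - unfold block_test. repeat match goal with |- context [ind ?b] => generalize (ind_bounds b); generalize (ind b); intros end. lra.
Qed.

Lemma E_block_test_sum_sq d N Q : (0 < d)%nat ->
  E (2 * d) (Q * (2 * N)) (fun w => block_test_sum N Q w ^ 2) <= INR Q * (2 / INR ((2 * d) ^ (2 * N))).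
Proof.
  intros Hd. induction Q as [|Q IH].
  - cbn [block_test_sum]. rewrite E_const by lia. change (INR 0) with 0. rewrite Rmult_0_l. lra.
  - change (S Q * (2 * N))%nat with (2 * N + Q * (2 * N))%nat. cbn [block_test_sum].
    rewrite (E_split (2 * d) _ (2 * N) (fun u v => (block_test N u + block_test_sum N Q v) ^ 2)) by lia.
    replace (2 * N + Q * (2 * N) - 2 * N)%nat with (Q * (2 * N))%nat by lia.
    rewrite E_sum_sq by (lia || now apply E_block_test_0). rewrite S_INR.
    pose proof (E_block_test_sq d N Hd). lra.
Qed.

(** Each block contributes at least the probability of one word. The free prefix [u] carries the
    induction: once a block has been accounted for, it joins the prefix and the next block is
    tested. *)
Lemma E_centered_block_test_sum d N : (0 < d)%nat ->
  (forall k l, 1 <= E (2 * d) k (fun u => E (2 * d) l (fun v =>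
     cap_range d (u ++ excursion N ++ v) - cap_range d (u ++ zigzag N ++ v)))) ->
  forall Q k, INR Q / INR ((2 * d) ^ (2 * N))
    <= E (2 * d) k (fun u => E (2 * d) (Q * (2 * N)) (fun v => centered d (u ++ v) * block_test_sum N Q v)).
Proof.
  intros Hd H Q. set (p := INR ((2 * d) ^ (2 * N))).
  assert (Hp : 0 < p) by (apply INR_pow_pos; lia).
  induction Q as [|Q IH]; intros k.
  - cbn [block_test_sum]. rewrite (E_ext _ _ _ (fun _ => 0)).
    + rewrite E_const by lia. change (INR 0) with 0. unfold Rdiv. lra.
    + intros u _. rewrite (E_ext _ _ _ (fun _ => 0)) by (intros; ring). apply E_const. lia.
  - change (S Q * (2 * N))%nat with (2 * N + Q * (2 * N))%nat. cbn [block_test_sum].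
    rewrite (E_ext _ k _ (fun u => E (2 * d) (2 * N) (fun b => E (2 * d) (Q * (2 * N)) (fun v =>
      centered d (u ++ b ++ v) * (block_test N b + block_test_sum N Q v))))).
    + rewrite (E_ext _ k _ (fun u =>
        E (2 * d) (Q * (2 * N)) (fun v => E (2 * d) (2 * N) (fun b => block_test N b * centered d (u ++ b ++ v)))
        + E (2 * d) (2 * N) (fun b => E (2 * d) (Q * (2 * N)) (fun v =>
            centered d ((u ++ b) ++ v) * block_test_sum N Q v)))).
      * rewrite E_plus.
        rewrite <- (E_app (2 * d) k (2 * N) (fun w => E (2 * d) (Q * (2 * N)) (fun v =>
            centered d (w ++ v) * block_test_sum N Q v))) by lia.
        specialize (IH (k + 2 * N)%nat). specialize (H k (Q * (2 * N))%nat).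
        rewrite (E_ext _ k (fun u => E (2 * d) (Q * (2 * N)) (fun v =>
          E (2 * d) (2 * N) (fun b => block_test N b * centered d (u ++ b ++ v))))
          (fun u => E (2 * d) (Q * (2 * N)) (fun v =>
          cap_range d (u ++ excursion N ++ v) - cap_range d (u ++ zigzag N ++ v)) * / p)).
        -- rewrite E_scal_r, S_INR. unfold Rdiv in *. rewrite Rmult_plus_distr_r, Rplus_comm.
           apply Rplus_le_compat; [|exact IH]. apply Rmult_le_compat_r; [|exact H].
           left. now apply Rinv_0_lt_compat.
        -- intros u _. rewrite <- E_scal_r. apply E_ext. intros v _.
           rewrite (E_block_test d N (fun b => centered d (u ++ b ++ v))) by assumption.
           (* The two words have the same length, so the subtracted means cancel. *)
           unfold Rdiv. fold p. f_equal. unfold centered.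
           rewrite !length_app, length_excursion, length_zigzag. ring.
      * intros u _. rewrite (E_swap (2 * d) (Q * (2 * N)) (2 * N)), <- E_plus. apply E_ext.
        intros b _. rewrite <- E_plus. apply E_ext. intros v _. rewrite <- app_assoc. ring.
    + intros u _. rewrite E_app by lia. apply E_ext. intros b Hb. apply E_ext. intros v _.
      rewrite firstn_app, skipn_app, Hb, Nat.sub_diag, firstn_O, app_nil_r.
      rewrite firstn_all2, skipn_all2 by lia. reflexivity.
Qed.

(** With [p = (2 d)^(2N)], Cauchy-Schwarz against the block test gives
    [(Q / p)^2 <= sd^2 * 2 Q / p], hence [sd^2 >= Q / (2 p) = n / (4 N p)]. *)
Lemma sd_lower_bound d : (6 <= d)%nat ->
  exists N c, (1 <= N)%nat /\ 0 < c /\ forall Q, (1 <= Q)%nat ->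
    c <= sd d (Q * (2 * N)) / sqrt (INR (Q * (2 * N))).
Proof.
  intros Hd. destruct (excursion_mean_gain d Hd) as [N [HN H]].
  set (p := INR ((2 * d) ^ (2 * N))).
  assert (Hp : 0 < p) by (apply INR_pow_pos; lia).
  assert (HN1 : 1 <= INR N) by now apply (le_INR 1).
  exists N, (sqrt (/ (4 * INR N * p))). split; [assumption|].
  split; [apply sqrt_lt_R0, Rinv_0_lt_compat; nra|].
  intros Q HQ. assert (HQ1 : 1 <= INR Q) by now apply (le_INR 1).
  set (n := (Q * (2 * N))%nat).
  assert (Hn : INR n = INR Q * (2 * INR N)) by (unfold n; rewrite !mult_INR; reflexivity).
  assert (HnR : 0 < INR n) by (rewrite Hn; nra).
  pose proof (E_centered_block_test_sum d N ltac:(lia) H Q 0) as H1. rewrite E_0 in H1. cbn [app] in H1.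
  fold n p in H1.
  pose proof (E_cauchy_schwarz (2 * d) n (centered d) (block_test_sum N Q) ltac:(lia)) as H2.
  cbv beta in H2.
  pose proof (E_block_test_sum_sq d N Q ltac:(lia)) as H3. fold n p in H3.
  rewrite <- norm2_sq in H2 by lia. fold (sd d n) in H2.
  assert (Hs : 0 <= sd d n) by apply norm2_pos.
  assert (Hip : 0 < INR Q / p) by (apply Rdiv_lt_0_compat; lra).
  assert (H4 : (INR Q / p) ^ 2 <= sd d n ^ 2 * (INR Q * (2 / p))).
  { apply Rle_trans with (E (2 * d) n (fun w => centered d w * block_test_sum N Q w) ^ 2).
    - apply pow_incr. lra.
    - eapply Rle_trans; [exact H2|]. apply Rmult_le_compat_l; [apply pow2_ge_0|exact H3]. }
  assert (H5 : INR n * / (4 * INR N * p) <= sd d n ^ 2).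
  { apply Rmult_le_reg_r with (INR Q * (2 / p)).
    - apply Rmult_lt_0_compat; [lra|]. apply Rdiv_lt_0_compat; lra.
    - eapply Rle_trans; [|exact H4]. rewrite Hn. right. field. lra. }
  assert (Hsq : 0 < sqrt (INR n)) by now apply sqrt_lt_R0.
  apply Rmult_le_reg_r with (sqrt (INR n)); [assumption|].
  replace (sd d n / sqrt (INR n) * sqrt (INR n)) with (sd d n) by (field; lra).
  rewrite <- sqrt_mult; [|left; apply Rinv_0_lt_compat; nra|lra].
  rewrite <- (sqrt_pow2 (sd d n)) by assumption. apply sqrt_le_1_alt. lra.
Qed.

(** Along large multiples of [2 N] the ratio stays above [c], while its distance to [sigma] falls
    below [c]; so [sigma] cannot be 0. *)
Lemma sd_limit d : (6 <= d)%nat ->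
  exists sigma, 0 < sigma /\ forall n, (1 <= n)%nat ->
    Rabs (sd d n / sqrt (INR n) - sigma) <= cchi d / (root4 2 - 1) / root4 (INR n).
Proof.
  intros Hd.
  destruct (nearly_additive_limit (sd d) (cchi d) (fun n => norm2_pos _ _ _)
    (fun k l => sd_nearly_additive d k l Hd)) as [sigma [Hs0 Hs]].
  exists sigma. split; [|exact Hs].
  destruct (sd_lower_bound d Hd) as [N [c [HN [Hc Hlow]]]].
  set (C1 := cchi d / (root4 2 - 1)) in *.
  destruct (root4_unbounded (2 * Rabs C1 / c + 1)) as [Q HQ].
  specialize (HQ (S Q * (2 * N))%nat ltac:(nia)). specialize (Hlow (S Q) ltac:(lia)).
  specialize (Hs (S Q * (2 * N))%nat ltac:(nia)).
  set (n := (S Q * (2 * N))%nat) in *.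
  assert (Hpos : 0 <= 2 * Rabs C1 / c).
  { apply Rmult_le_pos; [pose proof (Rabs_pos C1); lra|left; now apply Rinv_0_lt_compat]. }
  assert (Hsmall : C1 / root4 (INR n) < c).
  { apply Rmult_lt_reg_r with (root4 (INR n)); [lra|].
    unfold Rdiv. rewrite Rmult_assoc, Rinv_l, Rmult_1_r by lra.
    apply Rle_lt_trans with (Rabs C1); [apply Rle_abs|].
    apply Rlt_le_trans with (c * (2 * Rabs C1 / c + 1)); [|apply Rmult_le_compat_l; lra].
    replace (c * (2 * Rabs C1 / c + 1)) with (2 * Rabs C1 + c) by (field; lra).
    pose proof (Rabs_pos C1). lra. }
  apply Rabs_le_bounds in Hs. lra.
Qed.

(** * The Gaussian integral and the Stein equation *)

Definition gauss_primitive (x : R) : R := RInt gauss_density 0 x.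

Lemma is_derive_eq (f : R -> R) (x l l' : R) : is_derive f x l -> l = l' -> is_derive f x l'.
Proof. now intros H <-. Qed.

(** [auto_derive] leaves [Derive g x] for functions it cannot look into; a known derivative supplies
    the value. *)
Ltac derive_value H :=
  match type of H with
  | is_derive ?f ?x ?l =>
      match goal with
      | |- context [Derive ?g x] =>
          replace (Derive g x) with l by (symmetry; apply is_derive_unique; exact H)
      end
  end.

Lemma gauss_density_pos (x : R) : 0 < gauss_density x.
Proof. apply exp_pos. Qed.

Lemma is_derive_gauss_density (x : R) : is_derive gauss_density x (- x * gauss_density x).
Proof. unfold gauss_density. auto_derive; [trivial|]. unfold Rdiv. field. Qed.

Lemma continuous_gauss_density (x : R) : continuous gauss_density x.
Proof.
  apply (ex_derive_continuous gauss_density).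
  eexists. apply is_derive_gauss_density.
Qed.

Lemma continuous_ex_RInt (f : R -> R) a b : (forall x, continuous f x) -> ex_RInt f a b.
Proof. intros H. apply (ex_RInt_continuous (V := R_CompleteNormedModule)). intros; apply H. Qed.

Lemma is_derive_primitive (f : R -> R) a (x : R) : (forall y, continuous f y) ->
  is_derive (fun y => RInt f a y) x (f x).
Proof.
  intros H. apply is_derive_RInt with a; [|apply H].
  apply filter_forall. intros y. apply RInt_correct. now apply continuous_ex_RInt.
Qed.

Lemma is_derive_gauss_primitive (x : R) : is_derive gauss_primitive x (gauss_density x).
Proof. apply (is_derive_primitive gauss_density 0). apply continuous_gauss_density. Qed.

Lemma gauss_int0_RInt (x : R) : gauss_int0 x = gauss_primitive x.
Proof.
  unfold gauss_int0, gauss_primitive. destruct Rle_dec.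
  - symmetry. apply RInt_Reals.
  - rewrite <- RInt_Reals. apply (opp_RInt_swap gauss_density x 0).
    apply continuous_ex_RInt, continuous_gauss_density.
Qed.

Lemma gauss_primitive_odd (x : R) : gauss_primitive (- x) = - gauss_primitive x.
Proof.
  unfold gauss_primitive.
  pose proof (RInt_comp_lin gauss_density (-1) 0 0 x) as H.
  replace (-1 * 0 + 0) with 0 in H by ring. replace (-1 * x + 0) with (- x) in H by ring.
  rewrite <- H by (apply continuous_ex_RInt, continuous_gauss_density).
  rewrite (RInt_ext _ (fun y => opp (gauss_density y))).
  - apply (RInt_opp gauss_density). apply continuous_ex_RInt, continuous_gauss_density.
  - intros y _. unfold scal, opp; simpl. unfold mult; simpl.
    replace (gauss_density (-1 * y + 0)) with (gauss_density y); [ring|].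
    unfold gauss_density. f_equal. field.
Qed.

Lemma const_of_zero_derive (f : R -> R) : (forall x, is_derive f x 0) -> forall x, f x = f 0.
Proof.
  intros H x. destruct (MVT_gen f 0 x (fun _ => 0)) as [c [_ Hc]].
  - intros; apply H.
  - intros y _. apply continuity_pt_filterlim. apply (ex_derive_continuous f). eexists; apply H.
  - lra.
Qed.

(* The sum [gauss_primitive x ^ 2 / 2 + RInt (gauss_param x) 0 1] has zero derivative, which
   evaluates the Gaussian integral. *)
Definition gauss_param (x t : R) : R := exp (- (x * x) * (1 + t * t) / 2) / (1 + t * t).

Lemma is_derive_gauss_param (x t : R) :
  is_derive (fun u => gauss_param u t) x (- x * exp (- (x * x) * (1 + t * t) / 2)).
Proof.
  unfold gauss_param. assert (1 + t * t <> 0) by nra. auto_derive; [trivial|]. unfold Rdiv. field. assumption.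
Qed.

Lemma continuous_gauss_param (x t : R) : continuous (gauss_param x) t.
Proof.
  apply (ex_derive_continuous (gauss_param x)). unfold gauss_param. auto_derive. nra.
Qed.

Lemma is_derive_gauss_param_int (x : R) :
  is_derive (fun u => RInt (gauss_param u) 0 1) x (- gauss_density x * gauss_primitive x).
Proof.
  replace (- gauss_density x * gauss_primitive x)
    with (RInt (fun t => Derive (fun u => gauss_param u t) x) 0 1).
  - apply is_derive_RInt_param.
    + apply filter_forall. intros y t _. eexists. apply is_derive_gauss_param.
    + intros t _.
      apply continuity_2d_pt_ext with (fun u v => - u * exp (- (u * u) * (1 + v * v) / 2)).
      { intros u v. symmetry. apply is_derive_unique, is_derive_gauss_param. }
      apply continuity_2d_pt_mult.
      * apply continuity_2d_pt_opp. apply continuity_2d_pt_id1.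
      * apply continuity_1d_2d_pt_comp with (f := exp).
        -- apply derivable_continuous_pt, derivable_pt_exp.
        -- unfold Rdiv. apply continuity_2d_pt_mult; [|apply continuity_2d_pt_const].
           apply continuity_2d_pt_mult.
           ++ apply continuity_2d_pt_opp. apply continuity_2d_pt_mult; apply continuity_2d_pt_id1.
           ++ apply continuity_2d_pt_plus; [apply continuity_2d_pt_const|].
              apply continuity_2d_pt_mult; apply continuity_2d_pt_id2.
    + apply filter_forall. intros y. apply continuous_ex_RInt. apply continuous_gauss_param.
  (* The integrand factors as the density at [x] times the density at [x t], and the substitution of
     [x t] turns the second factor into the primitive. *)
  - apply is_RInt_unique.
    apply is_RInt_ext with (fun t => scal (- gauss_density x) (scal x (gauss_density (x * t + 0)))).
    + intros t _. symmetry. apply (eq_trans (is_derive_unique _ _ _ (is_derive_gauss_param x t))).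
      unfold scal; simpl; unfold mult; simpl. unfold gauss_density.
      replace (exp (- (x * x) * (1 + t * t) / 2))
        with (exp (- (x * x) / 2) * exp (- ((x * t + 0) * (x * t + 0)) / 2)); [ring|].
      rewrite <- exp_plus. f_equal. field.
    + apply (is_RInt_scal (V := R_NormedModule)). apply (is_RInt_comp_lin gauss_density x 0 0 1).
      replace (x * 0 + 0) with 0 by ring. replace (x * 1 + 0) with x by ring.
      apply (RInt_correct (V := R_CompleteNormedModule)), continuous_ex_RInt, continuous_gauss_density.
Qed.

Lemma gauss_primitive_sq (x : R) :
  gauss_primitive x ^ 2 / 2 + RInt (gauss_param x) 0 1 = PI / 4.
Proof.
  rewrite (const_of_zero_derive (fun x => gauss_primitive x ^ 2 / 2 + RInt (gauss_param x) 0 1)).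
  (* At 0 only the integral of [1 / (1 + t^2)] remains, which is [atan 1]. *)
  - unfold gauss_primitive. rewrite RInt_point. unfold zero; simpl.
    rewrite (RInt_ext _ (fun t => / (1 + t ^ 2))).
    + rewrite (is_RInt_unique _ 0 1 (atan 1 - atan 0)).
      * rewrite atan_1, atan_0. field.
      * apply (is_RInt_derive atan (fun t => / (1 + t ^ 2))).
        -- intros t _. apply is_derive_Reals, derivable_pt_lim_atan.
        -- intros t _. apply (ex_derive_continuous (fun t => / (1 + t ^ 2))). auto_derive. nra.
    + intros t _. unfold gauss_param. rewrite !Rmult_0_l, Ropp_0, !Rmult_0_l.
      unfold Rdiv at 2. rewrite Rmult_0_l, exp_0. unfold Rdiv. rewrite Rmult_1_l. f_equal. ring.
  - intros y. clear x. rename y into x. set (y := x : R).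
    apply (is_derive_eq _ _ (gauss_primitive y * gauss_density y + - gauss_density y * gauss_primitive y));
      [|ring].
    apply (is_derive_plus (fun x => gauss_primitive x ^ 2 / 2)); [|apply is_derive_gauss_param_int].
    pose proof (is_derive_gauss_primitive y) as H.
    apply is_derive_ext with (fun x => scal (/ 2) (gauss_primitive x ^ 2)).
    { intros t. unfold scal; simpl; unfold mult; simpl. field. }
    replace (gauss_primitive y * gauss_density y)
      with (scal (/ 2) (INR 2 * gauss_density y * gauss_primitive y ^ pred 2)).
    + apply is_derive_scal. apply is_derive_pow. exact H.
    + unfold scal; simpl; unfold mult; simpl. field.
Qed.

(** The integral of the density over a half line, given by its value. No improper integral is
    formed: the bounds on [gauss_tail] replace limits at infinity. *)
Definition half_mass : R := sqrt (PI / 2).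

Lemma half_mass_sq : half_mass ^ 2 = PI / 2.
Proof. apply pow2_sqrt. pose proof PI_RGT_0. lra. Qed.

Lemma half_mass_ge_1 : 1 <= half_mass.
Proof.
  unfold half_mass. rewrite <- sqrt_1 at 1. apply sqrt_le_1_alt. pose proof PI2_1. lra.
Qed.

Definition gauss_tail (x : R) : R := half_mass - gauss_primitive x.

Lemma gauss_param_int_bounds (x : R) : 0 <= RInt (gauss_param x) 0 1 <= gauss_density x.
Proof.
  assert (Hex : ex_RInt (gauss_param x) 0 1) by apply continuous_ex_RInt, continuous_gauss_param.
  split.
  - apply RInt_ge_0; [lra|assumption|]. intros t _. unfold gauss_param.
    apply Rmult_le_pos; [left; apply exp_pos|left; apply Rinv_0_lt_compat; nra].
  - replace (gauss_density x) with (RInt (fun _ => gauss_density x) 0 1)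
      by (rewrite RInt_const; unfold scal; simpl; unfold mult; simpl; ring).
    apply RInt_le; [lra|assumption|apply ex_RInt_const|]. intros t Ht.
    unfold gauss_param, gauss_density.
    apply Rle_trans with (exp (- (x * x) * (1 + t * t) / 2) * 1).
    + apply Rmult_le_compat_l; [left; apply exp_pos|]. rewrite <- Rinv_1.
      apply Rinv_le_contravar; nra.
    + rewrite Rmult_1_r. destruct (Req_dec (x * t) 0) as [H0|H0].
      * right. f_equal. replace (- (x * x) * (1 + t * t) / 2) with (- (x * x) / 2 - (x * t) * (x * t) / 2) by field.
        rewrite H0. field.
      * left. apply exp_increasing.
        replace (- (x * x) * (1 + t * t) / 2) with (- (x * x) / 2 - (x * t) * (x * t) / 2) by field.
        assert (0 < (x * t) * (x * t)) by (destruct (Rdichotomy _ _ H0); nra). lra.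
Qed.

Lemma gauss_primitive_pos (x : R) : 0 <= x -> 0 <= gauss_primitive x.
Proof.
  intros Hx. apply RInt_ge_0; [assumption|apply continuous_ex_RInt, continuous_gauss_density|].
  intros. left. apply gauss_density_pos.
Qed.

Lemma gauss_primitive_le (x : R) : - half_mass <= gauss_primitive x <= half_mass.
Proof.
  pose proof (gauss_primitive_sq x) as H. pose proof (gauss_param_int_bounds x) as Hb.
  pose proof half_mass_sq as Hs. pose proof half_mass_ge_1. nra.
Qed.

(** By [gauss_primitive_sq], the product of [half_mass - gauss_primitive x] and
    [half_mass + gauss_primitive x] is twice an integral bounded by the density, and the second
    factor is at least 1. *)
Lemma gauss_tail_bounds (x : R) : 0 <= x -> 0 <= gauss_tail x <= 2 * gauss_density x.
Proof.
  intros Hx. pose proof (gauss_primitive_le x). unfold gauss_tail. split; [lra|].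
  pose proof (gauss_primitive_sq x) as H1. pose proof (gauss_param_int_bounds x) as Hb.
  pose proof half_mass_sq as Hs. pose proof half_mass_ge_1. pose proof (gauss_primitive_pos x Hx).
  nra.
Qed.

Lemma gauss_density_small e : 0 < e -> exists Z, 0 < Z /\ forall x, Z <= x -> gauss_density x <= e.
Proof.
  intros He. exists (2 / e + 2). assert (0 < 2 / e) by (apply Rdiv_lt_0_compat; lra).
  split; [lra|]. intros x Hx. unfold gauss_density.
  replace (- (x * x) / 2) with (- (x * x / 2)) by field. rewrite exp_Ropp.
  assert (H1 : x * x / 2 < exp (x * x / 2)).
  { pose proof (exp_ineq1 (x * x / 2)) as H1. specialize (H1 ltac:(nra)). lra. }
  assert (H2 : / e <= x * x / 2).
  { replace (/ e) with ((2 / e) / 2) by (field; lra). nra. }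
  rewrite <- (Rinv_inv e). apply Rinv_le_contravar; [now apply Rinv_0_lt_compat|lra].
Qed.

Lemma decreasing_of_derive (f df : R -> R) x y : x <= y ->
  (forall z, x <= z <= y -> is_derive f z (df z)) -> (forall z, x <= z <= y -> df z <= 0) ->
  f y <= f x.
Proof.
  intros Hxy Hd Hn. destruct (MVT_gen f x y df) as [c [Hc Heq]].
  - intros z Hz. rewrite Rmin_left, Rmax_right in Hz by assumption. apply Hd. lra.
  - intros z Hz. rewrite Rmin_left, Rmax_right in Hz by assumption.
    apply continuity_pt_filterlim. apply (ex_derive_continuous f). eexists. now apply Hd.
  - rewrite Rmin_left, Rmax_right in Hc by assumption. specialize (Hn c Hc). nra.
Qed.

Lemma is_derive_gauss_tail (x : R) : is_derive gauss_tail x (- gauss_density x).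
Proof.
  unfold gauss_tail. pose proof (is_derive_gauss_primitive x) as H. auto_derive.
  - eexists. exact H.
  - derive_value H. ring.
Qed.

(** The difference of the two sides is decreasing. Were it equal to [-e] at [x], the tail would stay
    above [e] further out, where it is at most twice a density that can be made smaller than
    [e / 4]. *)
Lemma mills_upper (x : R) : 0 < x -> gauss_tail x <= gauss_density x / x.
Proof.
  intros Hx. apply Rnot_lt_le. intros Hlt.
  set (e := gauss_tail x - gauss_density x / x).
  destruct (gauss_density_small (e / 4)) as [Z [HZ Hsmall]]; [unfold e; lra|].
  set (z := Rmax x Z). assert (Hxz : x <= z) by apply Rmax_l. assert (HZz : Z <= z) by apply Rmax_r.
  pose proof (decreasing_of_derive (fun y => gauss_density y / y - gauss_tail y)
    (fun y => - (gauss_density y / y ^ 2)) x z Hxz) as H. cbv beta in H.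
  assert (H' : gauss_density z / z - gauss_tail z <= gauss_density x / x - gauss_tail x).
  { apply H.
    - intros y Hy. pose proof (is_derive_gauss_density y) as D1. pose proof (is_derive_gauss_tail y) as D2.
      auto_derive.
      + repeat split; try (eexists; eassumption). lra.
      + derive_value D1. derive_value D2. field. lra.
    - intros y Hy. pose proof (gauss_density_pos y).
      assert (0 < gauss_density y / y ^ 2) by (apply Rdiv_lt_0_compat; [assumption|apply pow_lt; lra]). lra. }
  pose proof (gauss_tail_bounds z ltac:(lra)). specialize (Hsmall z HZz).
  assert (0 < gauss_density z / z) by (apply Rdiv_lt_0_compat; [apply gauss_density_pos|lra]).
  unfold e in *. lra.
Qed.

(** The same argument; the rational factor makes the derivative of the difference the single
    negative term [- 2 gauss_density y / (1 + y^2)^2]. *)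
Lemma mills_lower (x : R) : 0 < x -> gauss_density x * (x / (1 + x ^ 2)) <= gauss_tail x.
Proof.
  intros Hx. apply Rnot_lt_le. intros Hlt.
  set (e := gauss_density x * (x / (1 + x ^ 2)) - gauss_tail x).
  destruct (gauss_density_small (e / 2)) as [Z [HZ Hsmall]]; [unfold e; lra|].
  set (z := Rmax x Z). assert (Hxz : x <= z) by apply Rmax_l. assert (HZz : Z <= z) by apply Rmax_r.
  pose proof (decreasing_of_derive (fun y => gauss_tail y - gauss_density y * (y / (1 + y ^ 2)))
    (fun y => - (2 * gauss_density y / (1 + y ^ 2) ^ 2)) x z Hxz) as H. cbv beta in H.
  assert (H' : gauss_tail z - gauss_density z * (z / (1 + z ^ 2))
    <= gauss_tail x - gauss_density x * (x / (1 + x ^ 2))).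
  { apply H.
    - intros y Hy. pose proof (is_derive_gauss_density y) as D1. pose proof (is_derive_gauss_tail y) as D2.
      assert (1 + y ^ 2 <> 0) by nra.
      auto_derive.
      + repeat split; try (eexists; eassumption). nra.
      + derive_value D1. derive_value D2. field. nra.
    - intros y Hy. pose proof (gauss_density_pos y).
      assert (0 < 2 * gauss_density y / (1 + y ^ 2) ^ 2) by (apply Rdiv_lt_0_compat; [lra|apply pow_lt; nra]). lra. }
  pose proof (gauss_tail_bounds z ltac:(lra)). specialize (Hsmall z HZz).
  assert (gauss_density z * (z / (1 + z ^ 2)) <= gauss_density z * 1).
  { apply Rmult_le_compat_l; [left; apply gauss_density_pos|].
    apply Rmult_le_reg_r with (1 + z ^ 2); [nra|]. unfold Rdiv. rewrite Rmult_assoc, Rinv_l by nra. nra. }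
  unfold e in *. lra.
Qed.

(** * A continuously differentiable half-line indicator *)

Lemma is_derive_mul_abs (x : R) : is_derive (fun y => y * Rabs y) x (2 * Rabs x).
Proof.
  apply is_derive_Reals. intros e He. exists (mkposreal e He). simpl. intros k Hk Hke.
  assert (H : Rabs ((x + k) * Rabs (x + k) - x * Rabs x - 2 * Rabs x * k) <= Rabs k * Rabs k).
  { rewrite <- Rabs_mult, (Rabs_pos_eq (k * k)) by nra. apply Rabs_le.
    destruct (Rle_dec 0 x), (Rle_dec 0 (x + k));
      repeat first [rewrite (Rabs_pos_eq x) by lra | rewrite (Rabs_left x) by lra
                   | rewrite (Rabs_pos_eq (x + k)) by lra | rewrite (Rabs_left (x + k)) by lra];
      split; nra. }
  replace (((x + k) * Rabs (x + k) - x * Rabs x) / k - 2 * Rabs x)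
    with (((x + k) * Rabs (x + k) - x * Rabs x - 2 * Rabs x * k) / k) by (field; assumption).
  assert (0 < Rabs k) by now apply Rabs_pos_lt.
  unfold Rdiv. rewrite Rabs_mult, Rabs_inv.
  apply Rle_lt_trans with (Rabs k * Rabs k * / Rabs k).
  - apply Rmult_le_compat_r; [left; now apply Rinv_0_lt_compat|exact H].
  - replace (Rabs k * Rabs k * / Rabs k) with (Rabs k) by (field; lra). exact Hke.
Qed.

(** [pos_sq x = max(x, 0)^2]. *)
Definition pos_sq (x : R) : R := (x * x + x * Rabs x) / 2.

Lemma is_derive_pos_sq (x : R) : is_derive pos_sq x (x + Rabs x).
Proof.
  unfold pos_sq. pose proof (is_derive_mul_abs x) as H.
  assert (Hg : forall g : R -> R, is_derive g x (2 * Rabs x) ->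
    is_derive (fun y => (y * y + g y) / 2) x (x + Rabs x)).
  { clear H. intros g H. auto_derive.
    - eexists. exact H.
    - derive_value H. field. }
  now apply (Hg (fun y => y * Rabs y)).
Qed.

(** A C^1 approximation of the indicator of the half line [z <= 0], decreasing on [0, 1]. *)
Definition ramp (z : R) : R := 1 - 2 * pos_sq z + 4 * pos_sq (z - / 2) - 2 * pos_sq (z - 1).

Definition ramp' (z : R) : R :=
  - 2 * (z + Rabs z) + 4 * (z - / 2 + Rabs (z - / 2)) - 2 * (z - 1 + Rabs (z - 1)).

Lemma is_derive_ramp (z : R) : is_derive ramp z (ramp' z).
Proof.
  unfold ramp, ramp'. pose proof (is_derive_pos_sq z) as H1.
  pose proof (is_derive_pos_sq (z - / 2)) as H2. pose proof (is_derive_pos_sq (z - 1)) as H3.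
  auto_derive.
  - repeat split; eexists; eassumption.
  - replace (z + - / 2) with (z - / 2) by ring. replace (z + - (1)) with (z - 1) by ring.
    derive_value H1. derive_value H2. derive_value H3. ring.
Qed.

(** The second derivative of the Stein solution contains the derivative of the test function; its
    continuity makes that second derivative bounded on compact intervals. *)
Lemma continuous_ramp' (z : R) : continuous ramp' z.
Proof.
  assert (Ha : forall a, continuity_pt (fun y => Rabs (y - a)) z).
  { intros a. apply (continuity_pt_comp (fun y => y - a) Rabs).
    - apply derivable_continuous_pt. reg.
    - apply Rcontinuity_abs. }
  apply continuity_pt_filterlim. unfold ramp'.
  assert (H0 : continuity_pt Rabs z) by apply Rcontinuity_abs.
  assert (Hid : forall a, continuity_pt (fun y => y - a) z) by (intros; apply derivable_continuous_pt; reg).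
  assert (Hid0 : continuity_pt (fun y => y) z) by (apply derivable_continuous_pt; reg).
  apply (continuity_pt_minus (fun z => - 2 * (z + Rabs z) + 4 * (z - / 2 + Rabs (z - / 2)))
           (fun z => 2 * (z - 1 + Rabs (z - 1)))).
  - apply (continuity_pt_plus (fun z => - 2 * (z + Rabs z)) (fun z => 4 * (z - / 2 + Rabs (z - / 2)))).
    + apply (continuity_pt_scal (fun z => z + Rabs z)). now apply continuity_pt_plus.
    + apply (continuity_pt_scal (fun z => z - / 2 + Rabs (z - / 2))).
      apply (continuity_pt_plus (fun z => z - / 2)); auto.
  - apply (continuity_pt_scal (fun z => z - 1 + Rabs (z - 1))).
    apply (continuity_pt_plus (fun z => z - 1)); auto.
Qed.

Lemma ramp_left z : z <= 0 -> ramp z = 1 /\ ramp' z = 0.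
Proof.
  intros H. unfold ramp, ramp', pos_sq. rewrite !Rabs_left1 by lra. split; field.
Qed.

Lemma ramp_right z : 1 <= z -> ramp z = 0 /\ ramp' z = 0.
Proof.
  intros H. unfold ramp, ramp', pos_sq. rewrite !Rabs_pos_eq by lra. split; field.
Qed.

Lemma ramp_bounds z : 0 <= ramp z <= 1.
Proof.
  destruct (Rle_dec z 0) as [H0|H0]; [destruct (ramp_left z); lra|].
  destruct (Rle_dec 1 z) as [H1|H1]; [destruct (ramp_right z); lra|].
  unfold ramp, pos_sq. rewrite (Rabs_pos_eq z), (Rabs_left1 (z - 1)) by lra.
  destruct (Rle_dec z (/ 2)); [rewrite (Rabs_left1 (z - / 2)) by lra|rewrite (Rabs_pos_eq (z - / 2)) by lra];
    split; nra.
Qed.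

Lemma bounded_of_bounded_outside (f : R -> R) a b B : a <= b -> (forall x, continuous f x) ->
  (forall x, x <= a -> Rabs (f x) <= B) -> (forall x, b <= x -> Rabs (f x) <= B) ->
  exists M, forall x, Rabs (f x) <= M.
Proof.
  intros Hab Hc Ha Hb.
  destruct (continuity_ab_maj (fun x => Rabs (f x)) a b Hab) as [x0 [H0 _]].
  - intros c _. apply (continuity_pt_comp f Rabs).
    + apply continuity_pt_filterlim, Hc.
    + apply Rcontinuity_abs.
  - exists (Rmax B (Rabs (f x0))). intros x.
    destruct (Rle_dec x a) as [H1|H1]; [apply Rle_trans with (2 := Rmax_l _ _); auto|].
    destruct (Rle_dec b x) as [H2|H2]; [apply Rle_trans with (2 := Rmax_l _ _); auto|].
    apply Rle_trans with (2 := Rmax_r _ _). apply H0. lra.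
Qed.

Lemma lipschitz_of_derive (f df : R -> R) M : (forall x, is_derive f x (df x)) ->
  (forall x, Rabs (df x) <= M) -> forall x y, Rabs (f x - f y) <= M * Rabs (x - y).
Proof.
  intros Hd HM x y. destruct (MVT_gen f y x df) as [c [_ Hc]].
  - intros; apply Hd.
  - intros z _. apply continuity_pt_filterlim. apply (ex_derive_continuous f). eexists. apply Hd.
  - rewrite Hc, Rabs_mult. apply Rmult_le_compat_r; [apply Rabs_pos|apply HM].
Qed.

Lemma taylor_of_derive (f df : R -> R) M : (forall x, is_derive f x (df x)) ->
  (forall x y, Rabs (df x - df y) <= M * Rabs (x - y)) ->
  forall y k, Rabs (f (y + k) - f y - k * df y) <= M * k ^ 2.
Proof.
  intros Hd HM y k. destruct (MVT_gen f y (y + k) df) as [c [Hc Heq]].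
  - intros; apply Hd.
  - intros z _. apply continuity_pt_filterlim. apply (ex_derive_continuous f). eexists. apply Hd.
  - rewrite Heq. replace (df c * (y + k - y) - k * df y) with ((df c - df y) * k) by ring.
    rewrite Rabs_mult. rewrite <- Rsqr_pow2, Rsqr_abs. unfold Rsqr. rewrite <- Rmult_assoc.
    apply Rmult_le_compat_r; [apply Rabs_pos|]. eapply Rle_trans; [apply HM|].
    assert (HM0 : 0 <= M).
    { pose proof (HM 1 0) as H. rewrite Rminus_0_r, Rabs_R1 in H. pose proof (Rabs_pos (df 1 - df 0)). lra. }
    apply Rmult_le_compat_l; [assumption|].
    destruct (Rle_dec 0 k) as [Hk|Hk].
    + rewrite Rmin_left, Rmax_right in Hc by lra. rewrite !Rabs_pos_eq; lra.
    + rewrite Rmin_right, Rmax_left in Hc by lra. rewrite !Rabs_left1; lra.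
Qed.

Lemma Phi_primitive x : Phi x = (half_mass + gauss_primitive x) / (2 * half_mass).
Proof.
  pose proof half_mass_ge_1. unfold Phi. rewrite gauss_int0_RInt.
  replace (sqrt (2 * PI)) with (2 * half_mass); [field; lra|].
  pose proof PI_RGT_0.
  rewrite <- (sqrt_pow2 (2 * half_mass)) by lra. f_equal.
  rewrite Rpow_mult_distr, half_mass_sq. field.
Qed.

Lemma gauss_primitive_tail_neg x : half_mass + gauss_primitive x = gauss_tail (- x).
Proof. unfold gauss_tail. rewrite gauss_primitive_odd. ring. Qed.

Lemma RInt_diff (g : R -> R) (a b c : R) : (forall x, continuous g x) ->
  RInt g b c = RInt g a c - RInt g a b.
Proof.
  intros Hg. assert (Hex : forall a b, ex_RInt g a b) by (intros; now apply continuous_ex_RInt).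
  pose proof (RInt_Chasles g a b c (Hex a b) (Hex b c)) as H.
  change (RInt g a b + RInt g b c = RInt g a c) in H. lra.
Qed.

(** * The Stein equation for a smoothed half-line indicator *)

Section SteinEquation.
Variables s delta : R.
Hypothesis Hdelta : 0 < delta.

Let h (y : R) : R := ramp ((y - s) / delta).
Let h' (y : R) : R := ramp' ((y - s) / delta) / delta.
Let J (y : R) : R := RInt (fun u => h u * gauss_density u) s y.

(* The Gaussian mean of [h]. *)
Let Nh : R := (half_mass + gauss_primitive s + J (s + delta)) / (2 * half_mass).

(** The integral of [(h - Nh) gauss_density] from minus infinity to [y]: below [s] the function [h]
    is 1, and [half_mass + gauss_primitive s] is the mass there. Then [f] is the classical solution
    of [f' - y f = h - Nh], and [f1], [f2] are its first two derivatives as read off from the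
    equation. *)
Let num (y : R) : R := half_mass + gauss_primitive s + J y - Nh * (half_mass + gauss_primitive y).
Let f (y : R) : R := num y * / gauss_density y.
Let f1 (y : R) : R := y * f y + h y - Nh.
Let f2 (y : R) : R := f y + y * f1 y + h' y.

Let is_derive_h y : is_derive h y (h' y).
Proof.
  unfold h, h'. pose proof (is_derive_ramp ((y - s) / delta)) as H. auto_derive.
  - eexists. exact H.
  - replace ((y + - s) * / delta) with ((y - s) / delta) by (unfold Rdiv; ring).
    derive_value H. field. lra.
Qed.

Let h_left y : y <= s -> h y = 1 /\ h' y = 0.
Proof.
  intros H. destruct (ramp_left ((y - s) / delta)) as [H1 H2].
  - apply Rmult_le_reg_r with delta; [assumption|]. unfold Rdiv. rewrite Rmult_assoc, Rinv_l; lra.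
  - unfold h, h'. rewrite H1, H2. split; [reflexivity|]. unfold Rdiv. ring.
Qed.

Let h_right y : s + delta <= y -> h y = 0 /\ h' y = 0.
Proof.
  intros H. destruct (ramp_right ((y - s) / delta)) as [H1 H2].
  - apply Rmult_le_reg_r with delta; [assumption|]. unfold Rdiv. rewrite Rmult_assoc, Rinv_l; lra.
  - unfold h, h'. rewrite H1, H2. split; [reflexivity|]. unfold Rdiv. ring.
Qed.

Let continuous_h (y : R) : continuous h y.
Proof. apply (ex_derive_continuous h). eexists. apply is_derive_h. Qed.

Let continuous_h' (y : R) : continuous h' y.
Proof.
  unfold h'. apply (continuous_mult (fun y => ramp' ((y - s) / delta)) (fun _ => / delta)).
  - apply (continuous_comp (fun y => (y - s) / delta) ramp').
    + apply (ex_derive_continuous (fun y => (y - s) / delta)). auto_derive. trivial.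
    + apply continuous_ramp'.
  - apply continuous_const.
Qed.

Let continuous_hg (y : R) : continuous (fun u => h u * gauss_density u) y.
Proof. apply (continuous_mult h gauss_density); [apply continuous_h|apply continuous_gauss_density]. Qed.

Let is_derive_J y : is_derive J y (h y * gauss_density y).
Proof. apply (is_derive_primitive (fun u => h u * gauss_density u) s). apply continuous_hg. Qed.

Let is_derive_num y : is_derive num y ((h y - Nh) * gauss_density y).
Proof.
  unfold num. pose proof (is_derive_J y) as H1. pose proof (is_derive_gauss_primitive y) as H2.
  auto_derive.
  - repeat split; eexists; eassumption.
  - derive_value H1. derive_value H2. ring.
Qed.

Let is_derive_f y : is_derive f y (f1 y).
Proof.
  unfold f, f1. pose proof (is_derive_num y) as H1. pose proof (is_derive_gauss_density y) as H2.
  pose proof (gauss_density_pos y). auto_derive.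
  - repeat split; try (eexists; eassumption). lra.
  - derive_value H1. derive_value H2. unfold f. field. lra.
Qed.

Let is_derive_f1 y : is_derive f1 y (f2 y).
Proof.
  unfold f1, f2. pose proof (is_derive_f y) as H1. pose proof (is_derive_h y) as H2.
  auto_derive.
  - repeat split; eexists; eassumption.
  - derive_value H1. derive_value H2. unfold f1. ring.
Qed.

Let RInt_hg_split a b : RInt (fun u => h u * gauss_density u) a b
  = J b - J a.
Proof.
  apply (RInt_diff (fun u => h u * gauss_density u)). apply continuous_hg.
Qed.

Let gauss_primitive_diff a b : RInt gauss_density a b = gauss_primitive b - gauss_primitive a.
Proof.
  apply (RInt_diff gauss_density). apply continuous_gauss_density.
Qed.

Let J_left y : y <= s -> J y = gauss_primitive y - gauss_primitive s.
Proof.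
  intros H. rewrite <- gauss_primitive_diff. unfold J. apply RInt_ext. intros u Hu.
  rewrite Rmin_right, Rmax_left in Hu by assumption.
  destruct (h_left u) as [-> _]; lra.
Qed.

Let J_right y : s + delta <= y -> J y = J (s + delta).
Proof.
  intros H. enough (H0 : J y - J (s + delta) = 0) by lra.
  rewrite <- RInt_hg_split. rewrite (RInt_ext _ (fun _ => 0)).
  - rewrite RInt_const. unfold scal; simpl; unfold mult; simpl. ring.
  - intros u Hu. rewrite Rmin_left, Rmax_right in Hu by assumption.
    destruct (h_right u) as [-> _]; lra.
Qed.

Let J_end_bounds : 0 <= J (s + delta) <= gauss_primitive (s + delta) - gauss_primitive s.
Proof.
  rewrite <- gauss_primitive_diff. unfold J. split.
  - apply RInt_ge_0; [lra|apply continuous_ex_RInt, continuous_hg|]. intros u _.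
    apply Rmult_le_pos; [apply ramp_bounds|left; apply gauss_density_pos].
  - apply RInt_le; [lra|apply continuous_ex_RInt, continuous_hg
      |apply continuous_ex_RInt, continuous_gauss_density|].
    intros u _. pose proof (ramp_bounds ((u - s) / delta)) as Hb. fold (h u) in Hb.
    pose proof (gauss_density_pos u). nra.
Qed.

Let Nh_bounds : Phi s <= Nh <= Phi (s + delta).
Proof.
  rewrite !Phi_primitive. unfold Nh. pose proof half_mass_ge_1. pose proof J_end_bounds.
  split; apply Rmult_le_compat_r; try lra; left; apply Rinv_0_lt_compat; lra.
Qed.

Let Nh_unit : 0 <= Nh <= 1.
Proof.
  pose proof half_mass_ge_1. pose proof J_end_bounds.
  pose proof (gauss_primitive_le s). pose proof (gauss_primitive_le (s + delta)). unfold Nh. split.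
  - apply Rdiv_le_0_compat; lra.
  - apply Rmult_le_reg_r with (2 * half_mass); [lra|]. unfold Rdiv. rewrite Rmult_assoc, Rinv_l; lra.
Qed.

Let f_left y : y <= s -> f y = (1 - Nh) * (gauss_tail (- y) / gauss_density y).
Proof.
  intros H. unfold f, num. rewrite J_left by assumption. rewrite <- gauss_primitive_tail_neg.
  unfold Rdiv. ring.
Qed.

(** The choice of [Nh] makes the total integral vanish, so to the right [num] is a multiple of the
    upper tail, which the division by the density tolerates. *)
Let f_right y : s + delta <= y -> f y = Nh * (gauss_tail y / gauss_density y).
Proof.
  intros H. unfold f, num. rewrite J_right by assumption.
  pose proof half_mass_ge_1. pose proof (gauss_density_pos y).
  replace (half_mass + gauss_primitive s + J (s + delta)) with (Nh * (2 * half_mass))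
    by (unfold Nh; field; lra).
  unfold gauss_tail. field. lra.
Qed.

Let mills_ratio z : 0 < z ->
  z / (1 + z ^ 2) <= gauss_tail z / gauss_density z <= / z.
Proof.
  intros Hz. pose proof (gauss_density_pos z) as Hg.
  pose proof (mills_lower z Hz). pose proof (mills_upper z Hz). split.
  - apply Rmult_le_reg_r with (gauss_density z); [assumption|].
    replace (gauss_tail z / gauss_density z * gauss_density z) with (gauss_tail z) by (field; lra). lra.
  - apply Rmult_le_reg_r with (gauss_density z); [assumption|].
    replace (gauss_tail z / gauss_density z * gauss_density z) with (gauss_tail z) by (field; lra).
    unfold Rdiv in *. lra.
Qed.

(** Outside the ramp these are the two derivatives of [f], up to sign. The upper Mills bound gives
    [z m <= 1]; the lower one gives [(1 + z^2) m >= z], and with the upper one the excess is at most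
    [m <= 1]. *)
Let tail_estimates z c : 1 <= z -> 0 <= c <= 1 ->
  Rabs (c * (z * (gauss_tail z / gauss_density z) - 1)) <= 1 /\
  Rabs (c * ((1 + z ^ 2) * (gauss_tail z / gauss_density z) - z)) <= 1.
Proof.
  intros Hz Hc. destruct (mills_ratio z ltac:(lra)) as [H1 H2].
  set (m := gauss_tail z / gauss_density z) in *.
  assert (A1 : z <= (1 + z ^ 2) * m).
  { apply Rmult_le_compat_l with (r := 1 + z ^ 2) in H1; [|nra].
    replace ((1 + z ^ 2) * (z / (1 + z ^ 2))) with z in H1 by (field; nra). exact H1. }
  assert (A2 : z * m <= 1).
  { apply Rmult_le_compat_l with (r := z) in H2; [|lra]. rewrite Rinv_r in H2; lra. }
  assert (A3 : m <= 1) by nra. assert (A4 : 0 <= m) by nra.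
  assert (B1 : 0 <= (1 + z ^ 2) * m - z <= 1) by nra.
  assert (B2 : -1 <= z * m - 1 <= 0) by nra.
  split; apply Rabs_le; nra.
Qed.

(** Left of [L0] and right of [R0] the function [h] is constant and [|y| >= 1], as [tail_estimates]
    requires. *)
Let L0 := Rmin s (-1).
Let R0 := Rmax (s + delta) 1.

Let L0_le_R0 : L0 <= R0.
Proof.
  unfold L0, R0. pose proof (Rmin_r s (-1)). pose proof (Rmax_r (s + delta) 1). lra.
Qed.

Let outside_left y : y <= L0 -> Rabs (f1 y) <= 1 /\ Rabs (f2 y) <= 1.
Proof.
  intros Hy. assert (H1 : y <= s) by (pose proof (Rmin_l s (-1)); unfold L0 in Hy; lra).
  assert (H2 : y <= -1) by (pose proof (Rmin_r s (-1)); unfold L0 in Hy; lra).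
  destruct (h_left y H1) as [Hh Hh']. pose proof Nh_unit.
  destruct (tail_estimates (- y) (1 - Nh)) as [T1 T2]; [lra|lra|].
  assert (Hg : gauss_density (- y) = gauss_density y) by (unfold gauss_density; f_equal; field).
  rewrite Hg in *. set (m := gauss_tail (- y) / gauss_density y) in *.
  assert (Hf : f y = (1 - Nh) * m) by now apply f_left.
  split.
  - unfold f1. rewrite Hf, Hh. rewrite <- Rabs_Ropp in T1. eapply Rle_trans; [|exact T1].
    right. f_equal. ring.
  - unfold f2, f1. rewrite Hf, Hh, Hh'. eapply Rle_trans; [|exact T2]. right. f_equal. ring.
Qed.

Let outside_right y : R0 <= y -> Rabs (f1 y) <= 1 /\ Rabs (f2 y) <= 1.
Proof.
  intros Hy. assert (H1 : s + delta <= y) by (pose proof (Rmax_l (s + delta) 1); unfold R0 in Hy; lra).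
  assert (H2 : 1 <= y) by (pose proof (Rmax_r (s + delta) 1); unfold R0 in Hy; lra).
  destruct (h_right y H1) as [Hh Hh']. pose proof Nh_unit.
  destruct (tail_estimates y Nh) as [T1 T2]; [lra|lra|].
  set (m := gauss_tail y / gauss_density y) in *.
  assert (Hf : f y = Nh * m) by now apply f_right.
  split.
  - unfold f1. rewrite Hf, Hh. eapply Rle_trans; [|exact T1]. right. f_equal. ring.
  - unfold f2, f1. rewrite Hf, Hh, Hh'. eapply Rle_trans; [|exact T2]. right. f_equal. ring.
Qed.

(** Mills ratios bound the derivatives far out and compactness bounds them in between. The constant
    [M] may depend on [s] and [delta], which are fixed before [n] grows. *)
Lemma stein_equation : exists (h f f1 : R -> R) (M N : R),
  0 <= M /\
  (forall y, 0 <= h y <= 1) /\ (forall y, y <= s -> h y = 1) /\ (forall y, s + delta <= y -> h y = 0) /\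
  (forall x y, Rabs (h x - h y) <= M * Rabs (x - y)) /\
  Phi s <= N <= Phi (s + delta) /\
  (forall y, f1 y - y * f y = h y - N) /\
  (forall y, Rabs (f1 y) <= M) /\
  (forall y k, Rabs (f (y + k) - f y - k * f1 y) <= M * k ^ 2) /\
  (forall y k, Rabs (f1 (y + k) - f1 y) <= M * Rabs k).
Proof.
  assert (Cf : forall y, continuous f y) by (intros; apply (ex_derive_continuous f); eexists; apply is_derive_f).
  assert (Cf1 : forall y, continuous f1 y) by (intros; apply (ex_derive_continuous f1); eexists; apply is_derive_f1).
  assert (Cf2 : forall y, continuous f2 y).
  { intros y. unfold f2. apply (continuous_plus (fun y => f y + y * f1 y) h'); [|apply continuous_h'].
    apply (continuous_plus f (fun y => y * f1 y)); [apply Cf|].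
    apply (continuous_mult (fun y => y) f1); [apply continuous_id|apply Cf1]. }
  destruct (bounded_of_bounded_outside f1 L0 R0 1 L0_le_R0 Cf1) as [M1 HM1];
    [apply outside_left|apply outside_right|].
  destruct (bounded_of_bounded_outside f2 L0 R0 1 L0_le_R0 Cf2) as [M2 HM2];
    [apply outside_left|apply outside_right|].
  destruct (bounded_of_bounded_outside h' L0 R0 0 L0_le_R0 continuous_h') as [M3 HM3].
  { intros y Hy. destruct (h_left y) as [_ ->]; [pose proof (Rmin_l s (-1)); unfold L0 in Hy; lra|].
    rewrite Rabs_R0. lra. }
  { intros y Hy. destruct (h_right y) as [_ ->]; [pose proof (Rmax_l (s + delta) 1); unfold R0 in Hy; lra|].
    rewrite Rabs_R0. lra. }
  set (M := Rmax M1 (Rmax M2 M3)).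
  assert (B1 : M1 <= M) by apply Rmax_l.
  assert (B2 : M2 <= M) by (apply Rle_trans with (2 := Rmax_r _ _); apply Rmax_l).
  assert (B3 : M3 <= M) by (apply Rle_trans with (2 := Rmax_r _ _); apply Rmax_r).
  exists h, f, f1, M, Nh.
  assert (Lip : forall x y, Rabs (f1 x - f1 y) <= M * Rabs (x - y)).
  { apply (lipschitz_of_derive f1 f2); [apply is_derive_f1|]. intros x. specialize (HM2 x). lra. }
  repeat split.
  - specialize (HM1 0). pose proof (Rabs_pos (f1 0)). lra.
  - apply ramp_bounds.
  - apply ramp_bounds.
  - intros y Hy. now apply h_left.
  - intros y Hy. now apply h_right.
  - apply (lipschitz_of_derive h h'); [apply is_derive_h|]. intros x. specialize (HM3 x). lra.
  - apply Nh_bounds.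
  - apply Nh_bounds.
  - intros y. unfold f1. ring.
  - intros y. specialize (HM1 y). lra.
  - apply (taylor_of_derive f f1); [apply is_derive_f|apply Lip].
  - intros y k. eapply Rle_trans; [apply Lip|]. right. f_equal. f_equal. ring.
Qed.

End SteinEquation.

(** [Phi] is 1-Lipschitz, because the unnormalised density is at most 1 and the total mass at least
    1; hence [eta = e] works. *)
Lemma Phi_continuous x e : 0 < e -> exists eta, 0 < eta /\
  Phi (x + eta) <= Phi x + e /\ Phi x - e <= Phi (x - eta).
Proof.
  intros He. exists e. split; [assumption|].
  assert (H : forall a b, a <= b -> Phi b - Phi a <= b - a).
  { intros a b Hab. rewrite !Phi_primitive. pose proof half_mass_ge_1 as Hm.
    assert (Hg : gauss_primitive b - gauss_primitive a <= b - a).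
    { pose proof (decreasing_of_derive (fun y => gauss_primitive y - y) (fun y => gauss_density y - 1) a b Hab) as H.
      cbv beta in H. enough (gauss_primitive b - b <= gauss_primitive a - a) by lra. apply H.
      - intros z _. pose proof (is_derive_gauss_primitive z) as D. auto_derive.
        + eexists. exact D.
        + derive_value D. ring.
      - intros z _. unfold gauss_density. rewrite <- exp_0.
        destruct (Req_dec z 0) as [->|Hz].
        + right. replace (- (0 * 0) / 2) with 0 by field. ring.
        + assert (exp (- (z * z) / 2) < exp 0); [|lra]. apply exp_increasing.
          assert (0 < z * z) by (destruct (Rdichotomy _ _ Hz); nra). lra. }
    replace ((half_mass + gauss_primitive b) / (2 * half_mass) - (half_mass + gauss_primitive a) / (2 * half_mass))
      with ((gauss_primitive b - gauss_primitive a) * / (2 * half_mass)) by (field; lra).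
    assert (/ (2 * half_mass) <= 1) by (rewrite <- Rinv_1; apply Rinv_le_contravar; lra).
    assert (0 < / (2 * half_mass)) by (apply Rinv_0_lt_compat; lra). nra. }
  pose proof (H x (x + e) ltac:(lra)). pose proof (H (x - e) x ltac:(lra)). lra.
Qed.

(** * The central limit theorem *)

(** With [L] the integer logarithm of [n / b], halving [n] that often leaves pieces of length
    between about [b] and [2 b]. *)
Lemma dyadic_scale b n : (1 <= b)%nat -> (b <= n)%nat ->
  exists L, (b * 2 ^ L <= n)%nat /\ (n <= 2 * b * 2 ^ L)%nat.
Proof.
  intros Hb Hn. exists (Nat.log2 (n / b)).
  assert (Hq : (0 < n / b)%nat) by (apply Nat.div_str_pos; lia).
  destruct (Nat.log2_spec (n / b) Hq) as [H1 H2]. rewrite Nat.pow_succ_r' in H2.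
  pose proof (Nat.div_mod_eq n b) as H3. pose proof (Nat.mod_upper_bound n b ltac:(lia)).
  set (q := (n / b)%nat) in *. set (P := (2 ^ Nat.log2 q)%nat) in *. split; nia.
Qed.

Lemma norm1_le_norm2 K n F : (0 < K)%nat -> E K n (fun w => Rabs (F w)) <= norm2 K n F.
Proof.
  intros HK. unfold norm2.
  assert (H0 : 0 <= E K n (fun w => Rabs (F w))) by (apply E_nonneg; [assumption|]; intros; apply Rabs_pos).
  rewrite <- (sqrt_pow2 (E K n (fun w => Rabs (F w)))) by assumption. apply sqrt_le_1_alt.
  eapply Rle_trans; [now apply E_square_le|]. right. apply E_ext. intros w _.
  rewrite <- !Rsqr_pow2. symmetry. apply Rsqr_abs.
Qed.

Section Convergence.
Variables (d : nat) (sigma : R).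
Hypothesis Hd : (6 <= d)%nat.
Hypothesis Hsigma : 0 < sigma.

Let A := cchi d / (root4 2 - 1).
Hypothesis Hlim : forall n, (1 <= n)%nat -> Rabs (sd d n / sqrt (INR n) - sigma) <= A / root4 (INR n).

Let HA : 0 < A.
Proof.
  unfold A, cchi. pose proof (cgreen_pos d Hd). pose proof root4_2_gt_1. apply Rdiv_lt_0_compat; lra.
Qed.

(** The norm of the tree is compared with [sd] through the distance of the two variables, and [sd]
    with [sigma] through its rate of convergence. Both errors are at most [A / root4 b] relative to
    the square root of [n], since [b <= n]. *)
Lemma tree_approximation b n L : (1 <= b)%nat -> (b <= n)%nat -> (b * 2 ^ L <= n)%nat ->
  A / root4 (INR b) <= 1 ->
  norm2 (2 * d) n (fun w => centered d w - tree d L w) <= A / root4 (INR b) * sqrt (INR n) /\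
  Rabs (1 - tree_var d L n / (sigma * sqrt (INR n)) ^ 2)
    <= 4 * (A / root4 (INR b)) * (sigma + 1) / sigma ^ 2.
Proof.
  intros Hb Hn HL Hal1. set (al := A / root4 (INR b)) in *.
  assert (Hb1 : 1 <= INR b) by now apply (le_INR 1).
  assert (Hnb : INR b <= INR n) by now apply le_INR.
  assert (Hrb : 0 < root4 (INR b)) by (apply root4_pos; lra).
  assert (Hal : 0 < al) by (apply Rdiv_lt_0_compat; assumption).
  set (r := sqrt (INR n)). assert (Hr : 0 < r) by (apply sqrt_lt_R0; lra).
  assert (H1 : norm2 (2 * d) n (fun w => centered d w - tree d L w) <= al * r).
  { eapply Rle_trans; [now apply (tree_dist d L b n)|]. fold A al r.
    apply Rmult_le_compat_r; [lra|]. rewrite <- (Rmult_1_r al) at 2.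
    apply Rmult_le_compat_l; [lra|].
    assert (0 < / root4 2 ^ L) by (apply Rinv_0_lt_compat, pow_lt; pose proof root4_2_gt_1; lra). lra. }
  split; [exact H1|].
  set (tau := norm2 (2 * d) n (tree d L)).
  assert (Htau : tree_var d L n = tau ^ 2).
  { unfold tau. rewrite norm2_sq by lia. symmetry. apply E_tree_sq. lia. }
  pose proof (norm2_minus_abs (2 * d) n (centered d) (tree d L) ltac:(lia)) as H2.
  fold (sd d n) tau in H2. pose proof (Hlim n ltac:(lia)) as H3. fold r in H3.
  assert (H4 : A / root4 (INR n) <= al).
  { apply Rmult_le_compat_l; [lra|]. apply Rinv_le_contravar; [assumption|]. now apply root4_le. }
  assert (H5 : Rabs (tau / r - sigma) <= 2 * al).
  { apply Rabs_le_bounds in H2, H3.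
    assert (- al <= (sd d n - tau) / r <= al).
    { split; apply Rmult_le_reg_r with r; try assumption;
        replace ((sd d n - tau) / r * r) with (sd d n - tau) by (field; lra); lra. }
    replace (tau / r) with (sd d n / r - (sd d n - tau) / r) by (field; lra).
    apply Rabs_le. lra. }
  rewrite Htau. set (x := tau / r) in *.
  (* A difference of squares: one factor is at most [2 al], the other at most [2 sigma + 2] since
     [al <= 1]. *)
  replace (1 - tau ^ 2 / (sigma * r) ^ 2) with ((sigma - x) * (sigma + x) / sigma ^ 2)
    by (unfold x; field; lra).
  assert (Hx : 0 <= x) by (apply Rmult_le_pos; [apply norm2_pos|left; now apply Rinv_0_lt_compat]).
  unfold Rdiv. rewrite Rabs_mult, (Rabs_pos_eq (/ _)) by (left; apply Rinv_0_lt_compat, pow_lt; assumption).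
  apply Rmult_le_compat_r; [left; apply Rinv_0_lt_compat, pow_lt; assumption|].
  rewrite Rabs_mult, (Rabs_minus_sym sigma), (Rabs_pos_eq (sigma + x)) by lra.
  apply Rle_trans with (2 * al * (2 * (sigma + 1))); [|right; ring].
  apply Rabs_le_bounds in H5 as H6.
  apply Rmult_le_compat; [apply Rabs_pos|lra|exact H5|lra].
Qed.

(** Three errors: replacing the capacity by the tree, the mismatch between the variance of the tree
    and [sigma^2 n], and the Stein remainder. The first two are made small by [b] alone, uniformly
    in [n]; the last one tends to 0 in [n] once [b] is fixed. *)
Lemma smooth_convergence (h f f1 : R -> R) (M N : R) : 0 <= M ->
  (forall x y, Rabs (h x - h y) <= M * Rabs (x - y)) ->
  (forall y, f1 y - y * f y = h y - N) ->
  (forall y, Rabs (f1 y) <= M) ->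
  (forall y k, Rabs (f (y + k) - f y - k * f1 y) <= M * k ^ 2) ->
  (forall y k, Rabs (f1 (y + k) - f1 y) <= M * Rabs k) ->
  forall e, 0 < e -> exists n0, (1 <= n0)%nat /\ forall n, (n0 <= n)%nat ->
    Rabs (E (2 * d) n (fun w => h (centered d w / (sigma * sqrt (INR n)))) - N) <= e.
Proof.
  intros HM Hh Heq Hf1 Hf Hf1' e He.
  (* The two errors governed by [b] add up to at most [al * D]. *)
  set (D := M / sigma + 4 * M * (sigma + 1) / sigma ^ 2).
  assert (HD : 0 <= D).
  { unfold D. assert (0 < sigma ^ 2) by now apply pow_lt.
    assert (0 <= M / sigma) by (apply Rdiv_le_0_compat; lra).
    assert (0 <= 4 * M * (sigma + 1) / sigma ^ 2)
      by (apply Rdiv_le_0_compat; nra). lra. }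
  destruct (root4_unbounded (A * (1 + 2 * D / e))) as [b0 Hb0].
  set (b := S b0). specialize (Hb0 b ltac:(unfold b; lia)).
  assert (Hb : (1 <= b)%nat) by (unfold b; lia).
  assert (HDe : 0 <= 2 * D / e) by (apply Rdiv_le_0_compat; lra).
  assert (Hrb : 0 < root4 (INR b)) by nra.
  set (al := A / root4 (INR b)).
  assert (Hal0 : 0 < al) by (apply Rdiv_lt_0_compat; assumption).
  assert (Hal : al * (1 + 2 * D / e) <= 1).
  { unfold al. apply Rmult_le_reg_r with (root4 (INR b)); [assumption|].
    replace (A / root4 (INR b) * (1 + 2 * D / e) * root4 (INR b)) with (A * (1 + 2 * D / e)) by (field; lra).
    lra. }
  assert (Hal1 : al <= 1) by nra.
  assert (HalD : al * D <= e / 2).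
  { assert (al * (2 * D / e) <= 1) by lra. apply Rmult_le_compat_r with (r := e / 2) in H; [|lra].
    replace (al * (2 * D / e) * (e / 2)) with (al * D) in H by (field; lra). lra. }
  (* At most [n] leaves, each with an error of order [n^(-3/2)], give a Stein remainder of at most
     [B / r]. *)
  set (B := 2 * M * (INR (2 * b) + 1) ^ 3 / sigma ^ 3).
  destruct (INR_unbounded ((2 * B / e) ^ 2)) as [n1 Hn1].
  exists (Nat.max b n1). split; [lia|]. intros n Hn.
  assert (Hbn : (b <= n)%nat) by lia.
  destruct (dyadic_scale b n Hb Hbn) as [L [HL1 HL2]].
  destruct (tree_approximation b n L Hb Hbn HL1 Hal1) as [T1 T2]. fold al in T1, T2.
  set (r := sqrt (INR n)) in *.
  assert (HnR : 1 <= INR n) by (apply (le_INR 1); lia).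
  assert (Hr : 0 < r) by (apply sqrt_lt_R0; lra).
  set (k := sigma * r) in *. assert (Hk : 0 < k) by (unfold k; nra).
  set (K := (2 * d)%nat) in *. assert (HK : (0 < K)%nat) by (unfold K; lia).
  set (X := centered d) in *. set (T := tree d L) in *. set (v := tree_var d L n) in *.
  assert (S1 : Rabs (E K n (fun w => h (X w / k)) - E K n (fun w => h (T w / k))) <= al * (M / sigma)).
  { rewrite <- E_minus. eapply Rle_trans; [now apply E_Rabs|].
    apply Rle_trans with (E K n (fun w => M / k * Rabs (X w - T w))).
    - apply E_le; [assumption|]. intros w _. eapply Rle_trans; [apply Hh|].
      right. replace (X w / k - T w / k) with ((X w - T w) * / k) by (field; lra).
      rewrite Rabs_mult, (Rabs_pos_eq (/ k)) by (left; now apply Rinv_0_lt_compat). field. lra.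
    - rewrite E_scal. apply Rle_trans with (M / k * (al * r)).
      + apply Rmult_le_compat_l; [apply Rdiv_le_0_compat; lra|].
        eapply Rle_trans; [now apply norm1_le_norm2|exact T1].
      + right. unfold k. field. lra. }
  (* Rescaling the argument by [k] divides the Taylor constant by [k^2]. Pieces have length at most
     [2 b] by the choice of [L]. *)
  assert (S2 : Rabs (E K n (fun w => T w * f ((0 + T w) / k)) - v * E K n (fun w => f1 ((0 + T w) / k) / k))
    <= INR (2 ^ L) * (2 * (M / k ^ 2) * (INR (2 * b) + 1) ^ 3)).
  { apply (tree_stein d L (2 * b) n (fun x => f (x / k)) (fun x => f1 (x / k) / k) (M / k ^ 2) 0).
    - lia.
    - apply Rmult_le_pos; [lra|left; apply Rinv_0_lt_compat; now apply pow_lt].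
    - intros y j. replace ((y + j) / k) with (y / k + j / k) by (field; lra).
      replace (j * (f1 (y / k) / k)) with (j / k * f1 (y / k)) by (field; lra).
      eapply Rle_trans; [apply Hf|]. right. field. lra.
    - intros y j. replace ((y + j) / k) with (y / k + j / k) by (field; lra).
      replace (f1 (y / k + j / k) / k - f1 (y / k) / k) with ((f1 (y / k + j / k) - f1 (y / k)) * / k)
        by (field; lra).
      rewrite Rabs_mult, (Rabs_pos_eq (/ k)) by (left; now apply Rinv_0_lt_compat).
      apply Rle_trans with (M * Rabs (j / k) * / k).
      + apply Rmult_le_compat_r; [left; now apply Rinv_0_lt_compat|apply Hf1'].
      + unfold Rdiv at 1. rewrite Rabs_mult, (Rabs_pos_eq (/ k)) by (left; now apply Rinv_0_lt_compat).
        right. field. lra.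
    - exact HL2. }
  set (e1 := E K n (fun w => f1 (T w / k))).
  assert (S3 : E K n (fun w => h (T w / k)) - N
    = - ((E K n (fun w => T w * f ((0 + T w) / k)) - v * E K n (fun w => f1 ((0 + T w) / k) / k)) * / k)
      + e1 * (1 - v / k ^ 2)).
  { rewrite (E_ext K n (fun w => f1 ((0 + T w) / k) / k) (fun w => f1 (T w / k) * / k))
      by (intros; rewrite Rplus_0_l; reflexivity).
    rewrite E_scal_r. fold e1.
    replace (E K n (fun w => h (T w / k)) - N) with (E K n (fun w => h (T w / k) - N))
      by (rewrite E_minus, E_const by assumption; ring).
    rewrite (E_ext K n (fun w => h (T w / k) - N) (fun w => f1 (T w / k) - T w * f ((0 + T w) / k) * / k)).
    - rewrite E_minus, E_scal_r. fold e1. field. lra.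
    - intros w _. rewrite <- Heq, Rplus_0_l. unfold Rdiv. ring. }
  assert (S4 : Rabs e1 <= M).
  { unfold e1. apply E_Rabs_le; [assumption|]. intros; apply Hf1. }
  assert (S5 : Rabs (e1 * (1 - v / k ^ 2)) <= al * (4 * M * (sigma + 1) / sigma ^ 2)).
  { rewrite Rabs_mult. apply Rle_trans with (M * (4 * al * (sigma + 1) / sigma ^ 2)).
    - apply Rmult_le_compat; try apply Rabs_pos; assumption.
    - right. field. lra. }
  assert (S6 : INR (2 ^ L) * (2 * (M / k ^ 2) * (INR (2 * b) + 1) ^ 3) * / k <= e / 2).
  { assert (HP : INR (2 ^ L) <= r ^ 2).
    { unfold r. rewrite pow2_sqrt by lra. apply le_INR. nia. }
    assert (HB : 0 <= B).
    { unfold B. apply Rmult_le_pos; [|left; apply Rinv_0_lt_compat; now apply pow_lt].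
      apply Rmult_le_pos; [lra|]. apply pow_le. pose proof (pos_INR (2 * b)). lra. }
    replace (INR (2 ^ L) * (2 * (M / k ^ 2) * (INR (2 * b) + 1) ^ 3) * / k)
      with (INR (2 ^ L) * (B / r ^ 3)) by (unfold B, k; field; lra).
    apply Rle_trans with (r ^ 2 * (B / r ^ 3)).
    - apply Rmult_le_compat_r; [|assumption].
      apply Rmult_le_pos; [assumption|left; apply Rinv_0_lt_compat; now apply pow_lt].
    - replace (r ^ 2 * (B / r ^ 3)) with (B / r) by (field; lra).
      assert (Hr2 : 2 * B / e <= r).
      { unfold r. rewrite <- (sqrt_pow2 (2 * B / e)).
        - apply sqrt_le_1_alt. apply Rle_trans with (INR n1); [lra|]. apply le_INR. lia.
        - apply Rdiv_le_0_compat; lra. }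
      apply Rmult_le_reg_r with r; [assumption|].
      replace (B / r * r) with (2 * B / e * (e / 2)) by (field; lra).
      rewrite (Rmult_comm (e / 2)). apply Rmult_le_compat_r; lra. }
  replace (E K n (fun w => h (X w / k)) - N)
    with ((E K n (fun w => h (X w / k)) - E K n (fun w => h (T w / k))) + (E K n (fun w => h (T w / k)) - N))
    by ring.
  rewrite S3.
  eapply Rle_trans; [apply Rabs_triang|].
  eapply Rle_trans; [apply Rplus_le_compat_l, Rabs_triang|].
  rewrite Rabs_Ropp, Rabs_mult, (Rabs_pos_eq (/ k)) by (left; now apply Rinv_0_lt_compat).
  assert (S7 : Rabs (E K n (fun w => T w * f ((0 + T w) / k)) - v * E K n (fun w => f1 ((0 + T w) / k) / k)) * / k
    <= e / 2).
  { eapply Rle_trans; [|exact S6]. apply Rmult_le_compat_r; [left; now apply Rinv_0_lt_compat|exact S2]. }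
  assert (al * D = al * (M / sigma) + al * (4 * M * (sigma + 1) / sigma ^ 2)) by (unfold D; ring).
  lra.
Qed.

Lemma cdf_normalized_E n t : (1 <= n)%nat ->
  cdf_normalized d n t
  = E (2 * d) n (fun w => if Rle_dec (centered d w / (sigma * sqrt (INR n))) (t / sigma) then 1 else 0).
Proof.
  intros Hn. unfold cdf_normalized. rewrite prob_E. apply E_ext. intros w Hw.
  assert (Hr : 0 < sqrt (INR n)) by (apply sqrt_lt_R0, lt_0_INR; lia).
  unfold centered. rewrite Hw. set (x := cap_range d w - mean_cap_range d n).
  replace (x / (sigma * sqrt (INR n))) with (x / sqrt (INR n) * / sigma) by (field; lra).
  assert (Hi : 0 < / sigma) by now apply Rinv_0_lt_compat.
  destruct (Rle_dec (x / sqrt (INR n)) t) as [H|H];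
    destruct (Rle_dec (x / sqrt (INR n) * / sigma) (t / sigma)) as [H'|H']; try reflexivity; exfalso.
  - apply H'. unfold Rdiv. apply Rmult_le_compat_r; [lra|exact H].
  - apply H. apply Rmult_le_reg_r with (/ sigma); assumption.
Qed.

(** The indicator lies between two ramps of width [eta], one ending and one starting at [t / sigma].
    Their Gaussian means differ from [Phi (t / sigma)] by at most [e / 4], and smooth convergence
    costs another [e / 4]. *)
Lemma cdf_convergence t : Un_cv (fun n => cdf_normalized d n t) (Phi (t / sigma)).
Proof.
  intros e He.
  destruct (Phi_continuous (t / sigma) (e / 4)) as [eta [Heta [Hup Hlow]]]; [lra|].
  destruct (stein_equation (t / sigma) eta Heta)
    as (h & f & f1 & M & N & HM & Hb & Hl & Hr & Hlip & HN & Heq & Hf1 & Hf & Hf1').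
  destruct (stein_equation (t / sigma - eta) eta Heta)
    as (g & q & q1 & M' & N' & HM' & Hb' & Hl' & Hr' & Hlip' & HN' & Heq' & Hq1 & Hq & Hq1').
  destruct (smooth_convergence h f f1 M N HM Hlip Heq Hf1 Hf Hf1' (e / 4)) as [n1 [Hn1 C1]]; [lra|].
  destruct (smooth_convergence g q q1 M' N' HM' Hlip' Heq' Hq1 Hq Hq1' (e / 4)) as [n2 [Hn2 C2]]; [lra|].
  exists (Nat.max n1 n2). intros n Hn. specialize (C1 n ltac:(lia)). specialize (C2 n ltac:(lia)).
  apply Rabs_le_bounds in C1, C2.
  unfold Rdist. rewrite cdf_normalized_E by lia.
  set (Y := fun w => centered d w / (sigma * sqrt (INR n))).
  assert (U : E (2 * d) n (fun w => if Rle_dec (Y w) (t / sigma) then 1 else 0)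
    <= E (2 * d) n (fun w => h (Y w))).
  { apply E_le; [lia|]. intros w _. destruct Rle_dec; [rewrite Hl by assumption; lra|apply Hb]. }
  assert (V : E (2 * d) n (fun w => g (Y w))
    <= E (2 * d) n (fun w => if Rle_dec (Y w) (t / sigma) then 1 else 0)).
  { apply E_le; [lia|]. intros w _. destruct Rle_dec; [apply Hb'|rewrite Hr' by lra; lra]. }
  unfold Y in U, V. apply Rabs_def1; lra.
Qed.

End Convergence.

(** The constant is the limit of the normalised standard deviations. The limiting distribution
    function is continuous, so convergence at every [t] is convergence in distribution. *)
Theorem theorem1p1 (d : nat) (Hd : (6 <= d)%nat) :
  exists sigma : R, 0 < sigma /\
    forall t : R, Un_cv (fun n => cdf_normalized d n t) (Phi (t / sigma)).
Proof.
  destruct (sd_limit d Hd) as [sigma [Hs Hlim]]. exists sigma. split; [assumption|].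
  intros t. now apply cdf_convergence.
Qed.
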